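(* Let $n\ge 2$ and $w\in\widetilde{\mathfrak S}_n$. Then: (a) There are natural bijections between the maximal chains of $\mathcal C_w(n,2)$, the reduced words of $w$, the reflection orders of $w$, and $\mathcal A_w(n,2)$. (b) The map sending the commutation class of an admissible order $\rho\in\mathcal A_w(n,2)$ to its reversal set is a poset isomorphism $\mathcal B_w(n,2)\cong\mathcal C_w(n,3)$; this poset is ranked and has a unique minimal element and a unique maximal element, which correspond to the reversal sets $\emptyset$ and $\mathrm{Inv}_3(w)$ respectively. (c) The Hasse diagram of $\mathcal B_w(n,2)\cong\mathcal C_w(n,3)$ (edges directed from smaller to larger elements) is isomorphic as a directed graph to $\mathcal G(w)$. Moreover, the diameter of $\mathcal G(w)$, regarded as an undirected graph, equals $|\mathrm{Inv}_3(w)|$.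
   Context: The affine symmetric group $\widetilde{\mathfrak S}_n$ is the group (under composition) of bijections $w:\mathbb Z\to\mathbb Z$ with $w(x+n)=w(x)+n$ for all $x$ and $\sum_{i=1}^n w(i)=\binom{n+1}{2}$. For $i\in\mathbb Z/n\mathbb Z$, the simple transposition $s_i$ swaps $j$ and $j+1$ for every $j\equiv i \pmod n$ and fixes all other integers. A reduced word for $w$ is a sequence $i_1\cdots i_\ell$ of indices in $\mathbb Z/n\mathbb Z$ of minimal length $\ell=\ell(w)$ with $s_{i_1}\cdots s_{i_\ell}=w$. Two reduced words are commutation equivalent if they differ by a sequence of swaps of adjacent letters $ij\to ji$ with $j\not\equiv i,i\pm1 \pmod n$. The directed graph $\mathcal G(w)$ has as vertices the commutation classes of reduced words of $w$, with a directed edge from class $C$ to class $C'$ if some representative of $C'$ is obtained from some representative of $C$ by replacing three consecutive letters $i(i+1)i$ by $(i+1)i(i+1)$ (indices mod $n$). For a reduced word $\mathbf i=i_1\cdots i_\ell$ of $w$, put $w^{(j)}=s_{i_1}\cdots s_{i_{j-1}}$ and $\rho_j=(w^{(j)}(i_j),w^{(j)}(i_j+1))$; the reflection order of $\mathbf i$ is the sequence $(\rho_1,\dots,\rho_\ell)$, and the reflection orders of $w$ are those arising from reduced words. For $m\ge 1$, $\binom{\mathbb Z}{m}_n$ denotes the set of $m$-element subsets of $\mathbb Z$ whose elements are pairwise distinct mod $n$, modulo the equivalence identifying $\{x_1,\dots,x_m\}$ with $\{x_1+cn,\dots,x_m+cn\}$ for $c\in\mathbb Z$ when $m>1$ (no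 identification when $m=1$); an element is written $[x_1,\dots,x_m]$ with $x_1<\dots<x_m$ for a representative. For $X=[x_1,\dots,x_m]$ and $i\in[m]$, $X_i$ denotes $X$ with $x_i$ removed, and the packet is $P(X)=\{X_1,\dots,X_m\}$; its lex order is $(X_m,X_{m-1},\dots,X_1)$ and its antilex order is $(X_1,\dots,X_m)$; a prefix of $P(X)$ is a set $\{X_m,X_{m-1},\dots,X_i\}$ and a suffix is a set $\{X_i,\dots,X_1\}$ (the empty set counts as both). The $m$-inversion set is $\mathrm{Inv}_m(w)=\{[x_1,\dots,x_m]\in\binom{\mathbb Z}{m}_n: w^{-1}(x_1)>\dots>w^{-1}(x_m)\}$. An element $X=[x_1,\dots,x_m]$ is an $m$-quasi-inversion of $w$ if exactly one of the pairs $[x_a,x_b]$, $a<b$, is not in $\mathrm{Inv}_2(w)$; then $P(X)\cap\mathrm{Inv}_{m-1}(w)=\{X_i,X_{i+1}\}$ for some $i$. Permanent poset $\mathcal P_w(n,m)$: the partial order on $\mathrm{Inv}_m(w)$ that is the reflexive-transitive closure of (1) quasi-inversion relations: whenever $X\in\binom{\mathbb Z}{m+1}_n$ is a quasi-inversion with $P(X)\cap\mathrm{Inv}_m(w)=\{X_i,X_{i+1}\}$, set $X_i<X_{i+1}$ if $m-i$ is odd and $X_{i+1}<X_i$ if $m-i$ is even; and (2) congruence relations: for $X=[x_1,\dots,x_m]$ and $0\le i<m$ let $X+v_i=[x_1,\dots,x_i,x_{i+1}+n,\dots,x_m+n]$; whenever $X,X+v_i\in\mathrm{Inv}_m(w)$,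 set $X<X+v_i$ if $m-i$ is odd and $X+v_i<X$ if $m-i$ is even. For $m\ge2$, an $m$-admissible order is a total order $\rho$ of $\mathrm{Inv}_m(w)$ that is a linear extension of $\mathcal P_w(n,m)$ and such that for each $X\in\mathrm{Inv}_{m+1}(w)$ the restriction of $\rho$ to $P(X)$ is the lex or the antilex order; $\mathcal A_w(n,m)$ is the set of these, and the reversal set of $\rho$ is $\{X\in\mathrm{Inv}_{m+1}(w):\rho|_{P(X)}=(X_1,\dots,X_{m+1})\}$. Two elements of $\mathrm{Inv}_m(w)$ commute if they are incomparable in $\mathcal P_w(n,m)$ and do not lie in a common packet; two total orders are commutation equivalent if related by a sequence of swaps of adjacent commuting elements. For $X\in\mathrm{Inv}_{m+1}(w)$, if $P(X)$ occupies consecutive positions of $\rho$ in lex order, the lex-to-antilex packet flip at $P(X)$ reverses that block. $\mathcal B_w(n,m)$ is the poset on commutation classes of $\mathcal A_w(n,m)$ with $[\rho]\le[\sigma]$ if $\sigma$ is obtained from $\rho$ by a sequence of commutations and lex-to-antilex packet flips. A subset $R\subseteq\mathrm{Inv}_m(w)$ is consistent if it is a lower order ideal of $\mathcal P_w(n,m)$ and for every $X\in\mathrm{Inv}_{m+1}(w)$, $P(X)\cap R$ is a prefix or suffix of $P(X)$. $\mathcal C_w(n,m)$ is the poset on consistent subsets of $\mathrm{Inv}_m(w)$ in which $R\le R'$ iff there is a chain of consistent sets $R=R_0\subset R_1\subset\dots\subset R_t=R'$ with $|R_{j+1}\setminus R_j|=1$ for all $j$. Elements $(x,y)$ of a reflection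 order are identified with $[x,y]\in\binom{\mathbb Z}{2}_n$. *)

(* Defs.v *)
From HB Require Import structures.
From mathcomp Require Import all_boot all_order all_algebra.
From Stdlib Require Import Relation_Definitions Relation_Operators.
Set Implicit Arguments. Unset Strict Implicit. Unset Printing Implicit Defensive.
Import Order.TTheory GRing.Theory Num.Theory.
Local Open Scope ring_scope.

Definition is_affperm (n : nat) (w : int -> int) : Prop :=
  bijective w /\ (forall x : int, w (x + n%:Z) = w x + n%:Z) /\
  \sum_(1 <= i < n.+1) w i%:Z = ('C(n.+1, 2))%:Z.

Definition succ_mod (n : nat) (i : 'I_n) : nat := ((i : nat).+1 %% n)%N.

Definition sref (n : nat) (i : 'I_n) (x : int) : int :=
  if modz x n%:Z == (i : nat)%:Z then x + 1
  else if modz x n%:Z == (succ_mod i)%:Z then x - 1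
  else x.

Definition wprod (n : nat) (u : seq 'I_n) : int -> int :=
  foldr (fun i f => sref i \o f) id u.

Definition is_word_of (n : nat) (w : int -> int) (u : seq 'I_n) : Prop :=
  forall x, wprod u x = w x.

Definition reduced (n : nat) (w : int -> int) (u : seq 'I_n) : Prop :=
  is_word_of w u /\ forall v : seq 'I_n, is_word_of w v -> (size u <= size v)%N.

Definition letters_commute (n : nat) (i j : 'I_n) : Prop :=
  (i : nat) <> j /\ (j : nat) <> succ_mod i /\ (i : nat) <> succ_mod j.

Definition comm_step (n : nat) (u v : seq 'I_n) : Prop :=
  exists (a b : seq 'I_n) (i j : 'I_n),
    letters_commute i j /\ u = a ++ [:: i; j] ++ b /\ v = a ++ [:: j; i] ++ b.

Definition comm_equiv (n : nat) : relation (seq 'I_n) :=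
  clos_refl_trans (seq 'I_n) (@comm_step n).

Definition braid_step (n : nat) (u v : seq 'I_n) : Prop :=
  exists (a b : seq 'I_n) (i j : 'I_n),
    (j : nat) = succ_mod i /\ u = a ++ [:: i; j; i] ++ b /\ v = a ++ [:: j; i; j] ++ b.

(* ---------- The graph G(w) (vertices = commutation classes, via reps) ---------- *)

Definition G_edge (n : nat) (w : int -> int) (u v : seq 'I_n) : Prop :=
  reduced w u /\ reduced w v /\
  exists u' v', comm_equiv u u' /\ comm_equiv v v' /\ braid_step u' v'.

Definition G_adj (n : nat) (w : int -> int) (u v : seq 'I_n) : Prop :=
  G_edge w u v \/ G_edge w v u.

Definition G_dist_le (n : nat) (w : int -> int) (u v : seq 'I_n) (k : nat) : Prop :=
  exists (k' : nat) (f : nat -> seq 'I_n), (k' <= k)%N /\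
    comm_equiv u (f 0%N) /\ comm_equiv (f k') v /\
    forall j, (j < k')%N -> G_adj w (f j) (f j.+1).

Definition G_diameter (n : nat) (w : int -> int) (N : nat) : Prop :=
  (forall u v : seq 'I_n, reduced w u -> reduced w v -> G_dist_le w u v N) /\
  exists u v : seq 'I_n, reduced w u /\ reduced w v /\
    forall k, G_dist_le w u v k -> (N <= k)%N.

(* Elements of binom(Z,m)_n are represented by canonical representatives:
   strictly increasing lists, pairwise distinct mod n, and (when m > 1,
   where translation by multiples of n is quotiented out) with least element
   in [1, n]. *)
Definition is_elt (n m : nat) (X : seq int) : Prop :=
  size X = m /\ sorted (fun x y : int => x < y) X /\
  uniq [seq modz x n%:Z | x <- X] /\
  ((1 < m)%N -> 1 <= head 0 X <= n%:Z).

Definition canon (n : nat) (X : seq int) : seq int :=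
  if (1 < size X)%N then
    let c := divz (head 0 X - 1) n%:Z in [seq x - c * n%:Z | x <- X]
  else X.

Definition mkset (n : nat) (s : seq int) : seq int :=
  canon n (sort (fun x y : int => x <= y) s).

Definition inv_cond (w : int -> int) (X : seq int) : Prop :=
  forall (a b : nat) (p q : int), (a < b < size X)%N ->
    w p = nth 0 X a -> w q = nth 0 X b -> q < p.

Definition Inv (n m : nat) (w : int -> int) (X : seq int) : Prop :=
  is_elt n m X /\ inv_cond w X.

(* X_{k+1} (paper's 1-indexed notation): X with its (0-indexed) k-th element removed *)
Definition pk (n : nat) (X : seq int) (k : nat) : seq int :=
  canon n (take k X ++ drop k.+1 X).

Definition antilex (n : nat) (X : seq int) : seq (seq int) := mkseq (pk n X) (size X).
Definition lex (n : nat) (X : seq int) : seq (seq int) := rev (antilex n X).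

Definition pair_inv (w : int -> int) (X : seq int) (a b : nat) : Prop :=
  inv_cond w [:: nth 0 X a; nth 0 X b].

Definition quasi_inv (n m : nat) (w : int -> int) (X : seq int) : Prop :=
  is_elt n m X /\
  exists a b : nat, (a < b < m)%N /\ ~ pair_inv w X a b /\
    forall a' b' : nat, (a' < b' < m)%N -> ~ pair_inv w X a' b' -> a' = a /\ b' = b.

Definition shiftv (n : nat) (X : seq int) (i : nat) : seq int :=
  canon n (take i X ++ [seq x + n%:Z | x <- drop i X]).

Definition Pgen (n m : nat) (w : int -> int) (Y Z : seq int) : Prop :=
  (exists (X : seq int) (k : nat),
     (* paper's i = k+1, so X_i = pk X k, X_{i+1} = pk X k.+1, m - i = m - k.+1 *)
     quasi_inv n m.+1 w X /\ (k < m)%N /\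
     (forall j, (j < m.+1)%N -> (Inv n m w (pk n X j) <-> j = k \/ j = k.+1)) /\
     (if odd (m - k.+1) then Y = pk n X k /\ Z = pk n X k.+1
      else Y = pk n X k.+1 /\ Z = pk n X k))
  \/
  (exists (X : seq int) (i : nat),
     (i < m)%N /\ Inv n m w X /\ Inv n m w (shiftv n X i) /\
     (if odd (m - i) then Y = X /\ Z = shiftv n X i
      else Y = shiftv n X i /\ Z = X)).

Definition Ple (n m : nat) (w : int -> int) : relation (seq int) :=
  clos_refl_trans (seq int) (Pgen n m w).

Definition tot_order (n m : nat) (w : int -> int) (rho : seq (seq int)) : Prop :=
  uniq rho /\ forall X, X \in rho <-> Inv n m w X.

Definition restr (rho : seq (seq int)) (P : seq (seq int)) : seq (seq int) :=
  [seq Y <- rho | Y \in P].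

Definition admissible (n m : nat) (w : int -> int) (rho : seq (seq int)) : Prop :=
  tot_order n m w rho /\
  (forall X Y, X \in rho -> Y \in rho -> Ple n m w X Y -> (index X rho <= index Y rho)%N) /\
  (forall X, Inv n m.+1 w X ->
     restr rho (antilex n X) = lex n X \/ restr rho (antilex n X) = antilex n X).

Definition revset (n m : nat) (w : int -> int) (rho : seq (seq int)) : seq int -> Prop :=
  fun X => Inv n m.+1 w X /\ restr rho (antilex n X) = antilex n X.

Definition commutes (n m : nat) (w : int -> int) (X Y : seq int) : Prop :=
  ~ Ple n m w X Y /\ ~ Ple n m w Y X /\
  ~ (exists Z, is_elt n m.+1 Z /\ X \in antilex n Z /\ Y \in antilex n Z).

Definition ord_comm_step (n m : nat) (w : int -> int) (rho sigma : seq (seq int)) : Prop :=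
  exists (a b : seq (seq int)) (X Y : seq int),
    commutes n m w X Y /\ rho = a ++ [:: X; Y] ++ b /\ sigma = a ++ [:: Y; X] ++ b.

Definition ord_comm_equiv (n m : nat) (w : int -> int) : relation (seq (seq int)) :=
  clos_refl_trans (seq (seq int)) (ord_comm_step n m w).

Definition flip_step (n m : nat) (w : int -> int) (rho sigma : seq (seq int)) : Prop :=
  exists (a b : seq (seq int)) (X : seq int),
    Inv n m.+1 w X /\ rho = a ++ lex n X ++ b /\ sigma = a ++ antilex n X ++ b.

(* order of B_w(n,m), on representatives of commutation classes *)
Definition Ble (n m : nat) (w : int -> int) : relation (seq (seq int)) :=
  clos_refl_trans (seq (seq int))
    (fun rho sigma => ord_comm_step n m w rho sigma \/ flip_step n m w rho sigma).

(* subsets of binom(Z,m)_n are predicates (equality: via propext/funext) *)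
Definition consistent (n m : nat) (w : int -> int) (R : seq int -> Prop) : Prop :=
  (forall X, R X -> Inv n m w X) /\
  (forall X Y, R Y -> Inv n m w X -> Ple n m w X Y -> R X) /\
  (forall X, Inv n m.+1 w X ->
     exists j : nat,
       (forall Y, Y \in antilex n X -> (R Y <-> Y \in take j (lex n X))) \/
       (forall Y, Y \in antilex n X -> (R Y <-> Y \in take j (antilex n X)))).

Definition Cle (n m : nat) (w : int -> int) (R R' : seq int -> Prop) : Prop :=
  exists (t : nat) (Rs : nat -> seq int -> Prop),
    Rs 0%N = R /\ Rs t = R' /\
    (forall j, (j <= t)%N -> consistent n m w (Rs j)) /\
    (forall j, (j < t)%N -> exists x, ~ Rs j x /\ forall y, Rs j.+1 y <-> Rs j y \/ y = x).

Definition Ccover (n m : nat) (w : int -> int) (R R' : seq int -> Prop) : Prop :=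
  Cle n m w R R' /\ R <> R' /\
  forall R'', consistent n m w R'' -> Cle n m w R R'' -> Cle n m w R'' R' ->
    R'' = R \/ R'' = R'.

Definition Cminimal (n m : nat) (w : int -> int) (R : seq int -> Prop) : Prop :=
  consistent n m w R /\ forall R', consistent n m w R' -> Cle n m w R' R -> R' = R.

Definition Cmaximal (n m : nat) (w : int -> int) (R : seq int -> Prop) : Prop :=
  consistent n m w R /\ forall R', consistent n m w R' -> Cle n m w R R' -> R' = R.

Definition Cranked (n m : nat) (w : int -> int) : Prop :=
  exists rk : (seq int -> Prop) -> nat,
    (forall R, Cminimal n m w R -> rk R = 0%N) /\
    (forall R R', consistent n m w R -> consistent n m w R' ->
       Ccover n m w R R' -> rk R' = (rk R).+1).

Definition Cchain (n m : nat) (w : int -> int) (K : (seq int -> Prop) -> Prop) : Prop :=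
  (forall R, K R -> consistent n m w R) /\
  (forall R R', K R -> K R' -> Cle n m w R R' \/ Cle n m w R' R).

Definition Cmaxchain (n m : nat) (w : int -> int) (K : (seq int -> Prop) -> Prop) : Prop :=
  Cchain n m w K /\
  forall K', Cchain n m w K' -> (forall R, K R -> K' R) -> forall R, K' R -> K R.

Definition prefix_chain (rho : seq (seq int)) : (seq int -> Prop) -> Prop :=
  fun R => exists j : nat, (j <= size rho)%N /\ R = (fun X => X \in take j rho).

(* rho_j = (w^(j)(i_j), w^(j)(i_j + 1)), with f = w^(j) *)
Fixpoint refl_aux (n : nat) (f : int -> int) (u : seq 'I_n) : seq (seq int) :=
  match u with
  | [::] => [::]
  | i :: u' => mkset n [:: f (i : nat)%:Z; f ((i : nat)%:Z + 1)] :: refl_aux (f \o sref i) u'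
  end.

Definition refl_order (n : nat) (u : seq 'I_n) : seq (seq int) := refl_aux id u.

Definition is_refl_order (n : nat) (w : int -> int) (rho : seq (seq int)) : Prop :=
  exists u : seq 'I_n, reduced w u /\ refl_order u = rho.

Definition card_is (P : seq int -> Prop) (N : nat) : Prop :=
  exists s : seq (seq int), uniq s /\ size s = N /\ forall X, X \in s <-> P X.

(* Main.v *)
(* View [w] as an affine wiring diagram: integers are lines, inversions are
   crossings. Reduced words are the orders of the crossings in which the crossings
   on each triple of pairwise inverted lines occur in lex or antilex order and which
   extend the permanent poset; both directions go by removing the last letter.

   A consistent set [R] of triples decides, on every line [a], which of two
   crossings comes first. The conditions on 4-packets and quasi-inversions make
   this a total order, so every line has a last crossing. Among the lines at
   consecutive positions there are neighbours [w p], [w (p + 1)] such that the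
   last crossing of [w p] is with a smaller number and that of [w (p + 1)] with a
   larger one; these two must then cross each other last, and s_p can be split off
   [w] as the last letter of a word whose reversal set is [R]. Hence by induction
   each [R] is the reversal set of a reduced word. The same induction shows that
   this word is unique up to commutations, and that a set with a triple (resp.
   missing one) is the end (resp. the start) of a braid move. So both the order and
   the covers of the poset are given by braid moves, its rank is the cardinality,
   and any two vertices of the graph are joined through the minimum or the maximum
   by a path of length at most [#|Inv_3(w)|], attained between these two. *)

(* In a finite diagram the first line crosses only smaller ones and the last only larger ones. Here
   there are no ends; the bound on [|g x - x|] replaces them. Climbing from a line to a larger one
   that it crosses must stop, at a line crossed only by smaller ones; going down stops at a line
   crossed only by larger ones, and a translate of the latter lies to the right of the former.

   Splitting off a letter makes one inverted pair non-inverted, so that the remaining set must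
   satisfy new order conditions at this pair. They follow from the 4-packets that contain the pair,
   because its crossing is the last on both lines.

   The arguments run on translation-invariant predicates of integers and not on canonical
   representatives. A non-inverted pair may be congruent there, which merges the two kinds of
   permanent relations into one.

   [Cle] asks for chains that add one triple at a time. So every nonempty set must lose, and every
   non-full set gain, a single triple; this is done by finding a word for it that contains a braid.
   For n = 2 the words i j i and j i j are different permutations, but no three lines are pairwise
   inverted either. *)
Require Import Defs.
From HB Require Import structures.
From mathcomp Require Import all_boot all_order all_algebra.
From mathcomp Require Import boolp zify.
From Stdlib Require Import Relation_Definitions Relation_Operators.
Import Order.TTheory GRing.Theory Num.Theory Defs.
Local Open Scope ring_scope.
Set Implicit Arguments. Unset Strict Implicit. Unset Printing Implicit Defensive.

(** * Congruence mod n and simple transpositions indexed by integers *)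

Section Congruence.
Context (m : nat).
Local Notation n := m.+2.

Definition cg (x y : int) : bool := (n%:Z %| x - y)%Z.

Lemma cgP (x y : int) : reflect (exists c : int, x = y + c * n%:Z) (cg x y).
Proof.
apply: (iffP dvdzP) => -[c e]; exists c; lia.
Qed.

Lemma cg_refl x : cg x x.
Proof. by apply/cgP; exists 0; lia. Qed.

Lemma cg_sym x y : cg x y = cg y x.
Proof. by apply/cgP/cgP => -[c ->]; exists (- c); lia. Qed.

Lemma cg_trans y x z : cg x y -> cg y z -> cg x z.
Proof. by move=> /cgP[c ->] /cgP[d ->]; apply/cgP; exists (c + d); lia. Qed.

Lemma cg_addr x y z : cg (x + z) (y + z) = cg x y.
Proof. by rewrite /cg; congr (_ %| _)%Z; lia. Qed.

Lemma cg_mul c x : cg (x + c * n%:Z) x.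
Proof. by apply/cgP; exists c. Qed.

Lemma mul_small (k r : int) : k * n%:Z = r -> - n%:Z < r < n%:Z -> k = 0.
Proof.
move=> <- h; have [?|[k1|k1]] : k = 0 \/ (1 <= k \/ k <= -1) by lia.
- by [].
- have := ler_wpM2r (_ : 0 <= n%:Z) k1; lia.
- have := ler_wpM2r (_ : 0 <= n%:Z) k1; lia.
Qed.

(** Rests on n >= 2, and makes the two moving clauses of [sp] exclusive. *)
Lemma cg_succ x y : cg x y -> ~~ cg x (y + 1).
Proof. move=> /cgP[c ->]; apply/cgP => -[d e].
have h := @mul_small (c - d) 1; rewrite mulrBl in h; lia. Qed.

Lemma cg_small x y : cg x y -> x < y + n%:Z -> y < x + n%:Z -> x = y.
Proof. by move=> /cgP[c ->] h1 h2; rewrite (@mul_small c (c * n%:Z)) //; lia. Qed.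

(* [sp p] is [s_i] for [i] the residue of the integer position [p]. *)
Definition sp (p x : int) : int :=
  if cg x p then x + 1 else if cg x (p + 1) then x - 1 else x.

Lemma sp_l p x : cg x p -> sp p x = x + 1.
Proof. by rewrite /sp => ->. Qed.

Lemma sp_r p x : cg x (p + 1) -> sp p x = x - 1.
Proof.
move=> h; rewrite /sp h; case: ifP => // /cg_succ; by rewrite h.
Qed.

Lemma sp_id p x : ~~ cg x p -> ~~ cg x (p + 1) -> sp p x = x.
Proof. by rewrite /sp => /negbTE-> /negbTE->. Qed.

Lemma spP p x : [\/ cg x p /\ sp p x = x + 1, cg x (p + 1) /\ sp p x = x - 1 |
  [/\ ~~ cg x p, ~~ cg x (p + 1) & sp p x = x]].
Proof.
have [h|h] := boolP (cg x p); first by constructor 1; rewrite sp_l.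
have [h'|h'] := boolP (cg x (p + 1)); first by constructor 2; rewrite sp_r.
by constructor 3; rewrite sp_id.
Qed.

Lemma spK p : involutive (sp p).
Proof.
move=> x; case: (spP p x) => [[h ->]|[h ->]|[h1 h2 e]].
- by rewrite sp_r ?cg_addr //; lia.
- by rewrite sp_l ?subrK // -(cg_addr _ _ 1) subrK.
- by rewrite !e.
Qed.

Lemma sp_add p x c : sp p (x + c * n%:Z) = sp p x + c * n%:Z.
Proof.
have E q : cg (x + c * n%:Z) q = cg x q.
  by apply/idP/idP; apply: cg_trans; rewrite ?cg_mul // cg_sym cg_mul.
by rewrite /sp !E; case: ifP => _; [lia | case: ifP => _; lia].
Qed.

Lemma sp_cg p q : cg p q -> sp p =1 sp q.
Proof.
move=> h x.
have E a b : cg a b -> cg x a = cg x b.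
  by move=> ab; apply/idP/idP => xa; apply: cg_trans xa _; rewrite // cg_sym.
by rewrite /sp (E _ _ h) (E (p + 1) (q + 1)) ?cg_addr.
Qed.

(** Every point moves by at most 1, so only close points can change order, and neighbours do so
    exactly when they are swapped with each other. *)
Lemma sp_lt p a b : a < b -> (sp p a < sp p b) = ~~ ((b == a + 1) && cg a p).
Proof.
move=> ab; case: (eqVneq b (a + 1)) => [->|ne] /=.
  case: (boolP (cg a p)) => h /=.
    by rewrite sp_l // sp_r ?cg_addr //; lia.
  have := spP p a; have := spP p (a + 1); rewrite cg_addr (negPf h).
  by move=> [[? ->]|[? ->]|[? ? ->]] [[? ->]|[? ->]|[? ? ->]]; lia.
(* At distance 2 the points would collide if [a] moved up and [b] moved down; but then a + 1 and a +
   2 would both be congruent to p + 1. *)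
have e2 : b = a + 2 -> sp p a = a + 1 -> cg a p -> ~~ cg b (p + 1).
  move=> -> _ h; have -> : a + 2 = (a + 1) + 1 by lia.
  by rewrite cg_addr cg_sym; apply: cg_succ; rewrite cg_sym.
have := spP p a; have := spP p b.
move=> [[? ->]|[h ->]|[? ? ->]] [[k s]|[? ->]|[? ? ->]]; rewrite ?s; try lia.
Qed.

Lemma sref_sp (i : 'I_n) : sref i =1 sp (i : nat)%:Z.
Proof.
have n0 : (0 < n)%N by lia.
have modE (k : nat) x : (k < n)%N -> (modz x n%:Z == k%:Z) = cg x k%:Z.
  move=> kn; rewrite /cg -eqz_mod_dvd; congr (_ == _).
  by rewrite modz_small //; lia.
move=> x; rewrite /sref /sp modE //.
have -> : (modz x n%:Z == (succ_mod i)%:Z) = cg x ((i : nat)%:Z + 1).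
  rewrite /cg -eqz_mod_dvd /succ_mod -modz_nat; congr (_ == modz _ _); lia.
by [].
Qed.

Fact letter_subproof (p : int) : (`|(p %% n%:Z)%Z| < n)%N.
Proof.
have := ltz_pmod p (_ : 0 < n%:Z); have := modz_ge0 p (_ : n%:Z != 0); lia.
Qed.

Definition letter (p : int) : 'I_n := Ordinal (letter_subproof p).

Lemma cg_letter p : cg (letter p : nat)%:Z p.
Proof.
rewrite /= /cg -eqz_mod_dvd gez0_abs ?modz_ge0 ?modz_mod //; lia.
Qed.

Lemma letterE p : exists c : int, (letter p : nat)%:Z = p + c * n%:Z.
Proof. by apply/cgP; exact: cg_letter. Qed.

Lemma sref_letter p : sref (letter p) =1 sp p.
Proof. by move=> x; rewrite sref_sp; apply: sp_cg; exact: cg_letter. Qed.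

Lemma letter_eq p q : cg p q -> letter p = letter q.
Proof.
move=> h; apply: val_inj => /=; congr absz.
by apply/eqP; rewrite eqz_mod_dvd.
Qed.

Lemma letter_ord (i : 'I_n) : letter (i : nat)%:Z = i.
Proof. by apply: val_inj => /=; rewrite modz_small //; have := ltn_ord i; lia. Qed.

Lemma cg_ord (i j : 'I_n) : cg (i : nat)%:Z (j : nat)%:Z = (i == j).
Proof.
by apply/idP/eqP => [/letter_eq|->]; [rewrite !letter_ord | exact: cg_refl].
Qed.

Lemma letter_succ p : (letter (p + 1) : nat) = succ_mod (letter p).
Proof.
rewrite /succ_mod; apply/eqP; rewrite -eqz_nat; apply/eqP.
apply: cg_small; last first.
- have := ltn_ord (letter (p + 1)); lia.
- have := ltn_ord (letter (p + 1)); have : ((letter p).+1 %% n < n)%N by rewrite ltn_mod; lia.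
  lia.
apply: cg_trans (cg_letter _) _; rewrite cg_sym -modz_nat.
have -> : (letter p).+1%:Z = (letter p)%:Z + 1 by lia.
apply: (@cg_trans ((letter p)%:Z + 1)); last by rewrite cg_addr cg_letter.
by rewrite /cg -eqz_mod_dvd modz_mod.
Qed.

Lemma cg_ord_succ (i j : 'I_n) : cg (j : nat)%:Z ((i : nat)%:Z + 1) = ((j : nat) == succ_mod i).
Proof.
rewrite -{2}(letter_ord i) -letter_succ.
apply/idP/eqP => [/letter_eq <-|e]; first by rewrite letter_ord.
by rewrite e; exact: cg_letter.
Qed.

End Congruence.

(** * Canonical representatives of classes of pairs and triples *)

Section Canon.
Context (m : nat).
Local Notation n := m.+2.

Definition shift (k : int) (s : seq int) := [seq x + k * n%:Z | x <- s].

Lemma shiftD k l s : shift k (shift l s) = shift (l + k) s.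
Proof. rewrite /shift -map_comp; apply: eq_map => x /=; lia. Qed.

Lemma shift0 s : shift 0 s = s.
Proof. rewrite /shift -[RHS]map_id; apply: eq_map => x /=; lia. Qed.

Lemma canonE s : (1 < size s)%N ->
  exists k, canon n s = shift k s /\ 1 <= head 0 (canon n s) <= n%:Z.
Proof.
case: s => [|x [|y s]] // _; rewrite /canon /=.
set c := divz (x - 1) n%:Z; exists (- c); split.
  by rewrite /shift /=; congr [:: _, _ & _]; try lia; apply: eq_map => z; lia.
have := divz_eq (x - 1) n%:Z; have := ltz_pmod (x - 1) (_ : 0 < n%:Z).
have := modz_ge0 (x - 1) (_ : n%:Z != 0); rewrite -/c; lia.
Qed.

Lemma canon_id s : 1 <= head 0 s <= n%:Z -> canon n s = s.
Proof.
case: s => [|x [|y s]] // h; rewrite /canon /=.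
have -> : divz (x - 1) n%:Z = 0 by apply: divz_small; move: h => /=; lia.
by congr [:: _, _ & _]; try lia; rewrite -[RHS]map_id; apply: eq_map => z; lia.
Qed.

Lemma canon_shift k s : (1 < size s)%N -> canon n (shift k s) = canon n s.
Proof.
move=> hs; have [l [el hl]] := canonE hs.
have [|m' [em hm]] := @canonE (shift k s); first by rewrite size_map.
move: hl hm; rewrite el em shiftD => hl hm; congr shift.
case: s hs hl hm {el em} => [|x [|y s]] //= _ hl hm.
suff: k + m' - l = 0 by lia.
apply: (@mul_small m _ ((k + m' - l) * n%:Z)) => //; lia.
Qed.

Lemma canon_eqP s t : (1 < size s)%N -> (1 < size t)%N ->
  canon n s = canon n t <-> exists k, t = shift k s.
Proof.
move=> hs ht; split=> [e|[k ->]]; last by rewrite canon_shift.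
have [k [ek _]] := canonE hs; have [l [el _]] := canonE ht.
exists (k - l); rewrite -shiftD -ek e el shiftD subrr.
by rewrite shift0.
Qed.

Definition c2 (x y : int) := canon n [:: x; y].
Definition c3 (x y z : int) := canon n [:: x; y; z].

Lemma c2_eqP x y x' y' :
  c2 x y = c2 x' y' <-> exists k, x' = x + k * n%:Z /\ y' = y + k * n%:Z.
Proof.
rewrite /c2 canon_eqP //; split=> -[k].
  by case=> -> ->; exists k.
by case=> -> ->; exists k.
Qed.

Lemma c2_neql x y z : x < y -> c2 y z <> c2 x z.
Proof. by move=> xy /c2_eqP[k [e1 e2]]; lia. Qed.

Lemma c2_neqr x y z : y < z -> c2 x y <> c2 x z.
Proof. by move=> yz /c2_eqP[k [e1 e2]]; lia. Qed.

Lemma c3_eqP x y z x' y' z' : c3 x y z = c3 x' y' z' <->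
  exists k, [/\ x' = x + k * n%:Z, y' = y + k * n%:Z & z' = z + k * n%:Z].
Proof.
rewrite /c3 canon_eqP //; split=> -[k].
  by case=> -> -> ->; exists k.
by case=> -> -> ->; exists k.
Qed.

Lemma c2_shift k x y : c2 (x + k * n%:Z) (y + k * n%:Z) = c2 x y.
Proof. by apply/esym/c2_eqP; exists k. Qed.

Lemma c3_shift k x y z :
  c3 (x + k * n%:Z) (y + k * n%:Z) (z + k * n%:Z) = c3 x y z.
Proof. by apply/esym/c3_eqP; exists k. Qed.

End Canon.

(** * Affine permutations, their inversions, and induction on length *)

Section Affine.
Context (m : nat).
Local Notation n := m.+2.
Implicit Types (w g : int -> int) (p q x y z : int).

(** The inverse [g] is carried along because inversions compare its values. The sum condition is
    stated for displacements: these are periodic, so the residues 0, ..., n - 1 of the letters can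
    serve as the window. *)
Definition aff w g : Prop :=
  [/\ cancel w g, cancel g w, forall x c, w (x + c * n%:Z) = w x + c * n%:Z
    & \sum_(i < n) (w (i : nat)%:Z - (i : nat)%:Z) = 0].

Lemma aff_shiftg w g : aff w g -> forall x c, g (x + c * n%:Z) = g x + c * n%:Z.
Proof. by case=> wK gK wS _ x c; rewrite -{1}(gK x) -wS wK. Qed.

Lemma per_mul w : (forall x, w (x + n%:Z) = w x + n%:Z) ->
  forall x c, w (x + c * n%:Z) = w x + c * n%:Z.
Proof.
move=> per; have pos (k : nat) x : w (x + k%:Z * n%:Z) = w x + k%:Z * n%:Z.
  elim: k x => [|k IH] x; first by rewrite mul0r !addr0.
  have -> : x + k.+1%:Z * n%:Z = (x + k%:Z * n%:Z) + n%:Z by lia.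
  by rewrite per IH; lia.
move=> x c; have [k [->|->]] : exists k : nat, c = k%:Z \/ c = - k%:Z.
- by exists `|c|%N; lia.
- exact: pos.
- have := pos k (x + - k%:Z * n%:Z); rewrite mulNr subrK; lia.
Qed.

(** [w] permutes the residues mod n, so this is a reindexing of a sum over residues. *)
Lemma sum_per w g (h : int -> int) : cancel w g -> cancel g w ->
  (forall x c, w (x + c * n%:Z) = w x + c * n%:Z) ->
  (forall x c, h (x + c * n%:Z) = h x) ->
  \sum_(i < n) h (w (i : nat)%:Z) = \sum_(i < n) h (i : nat)%:Z.
Proof.
move=> wK gK wS hS.
have gS x c : g (x + c * n%:Z) = g x + c * n%:Z by rewrite -{1}(gK x) -wS wK.
have K (u v : int -> int) : cancel u v -> (forall x c, v (x + c * n%:Z) = v x + c * n%:Z) ->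
    cancel (fun i : 'I_n => letter m (u (i : nat)%:Z))
           (fun i : 'I_n => letter m (v (i : nat)%:Z)).
  move=> uK vS i; have [c ->] := letterE m (u (i : nat)%:Z).
  rewrite vS uK -[RHS](letter_ord); apply: letter_eq.
  exact: cg_mul.
rewrite [RHS](reindex (fun i : 'I_n => letter m (w (i : nat)%:Z))); last first.
  by apply: onW_bij; exists (fun i : 'I_n => letter m (g (i : nat)%:Z)); apply: K.
apply: eq_bigr => i _.
by have [c ->] := letterE m (w (i : nat)%:Z); rewrite hS.
Qed.

Lemma aff_sp p w g : aff w g -> aff (w \o sp m p) (sp m p \o g).
Proof.
have spK' := @spK m p.
have sum_sp (h : int -> int) : (forall x c, h (x + c * n%:Z) = h x + c * n%:Z) ->
    \sum_(i < n) (h (sp m p (i : nat)%:Z) - (i : nat)%:Z) =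
    \sum_(i < n) (h (i : nat)%:Z - (i : nat)%:Z) + \sum_(i < n) (sp m p (i : nat)%:Z - (i : nat)%:Z).
  move=> hS; rewrite -(@sum_per (sp m p) (sp m p) (fun x => h x - x)) //.
  - by rewrite -big_split; apply: eq_bigr => i _ /=; lia.
  - by move=> x c; rewrite sp_add.
  - by move=> x c; rewrite hS; lia.
(* [sum_sp] for the involution [sp m p] itself says that twice its displacement sum is 0. *)
have sp0 : \sum_(i < n) (sp m p (i : nat)%:Z - (i : nat)%:Z) = 0.
  have := sum_sp (sp m p) (@sp_add m p).
  rewrite [X in X = _]big1 => [|i _]; last by rewrite spK' subrr.
  by move/eqP; rewrite eq_sym -mulr2n mulrn_eq0 => /eqP.
case=> wK gK wS w0; split=> [x|x|x c|] /=.
- by rewrite wK spK'.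
- by rewrite spK' gK.
- by rewrite sp_add wS.
- by rewrite sum_sp // w0 sp0.
Qed.

Lemma aff_id : aff id id.
Proof. by split=> //; rewrite big1 // => i _; rewrite subrr. Qed.

Lemma comp_spK w p : (w \o sp m p) \o sp m p = w.
Proof. by apply: funext => x /=; rewrite spK. Qed.

Lemma sp_compK g p : sp m p \o (sp m p \o g) = g.
Proof. by apply: funext => x /=; rewrite spK. Qed.

(* Below, [g] is always the inverse of [w], so [g x] is the position of [x]. *)
Definition inv g x y := (x < y) && (g y < g x).

Lemma inv_trans g : ssrbool.transitive (inv g).
Proof. by move=> y x z; rewrite /inv; lia. Qed.

Lemma inv_shift w g : aff w g -> forall k x y,
  inv g (x + k * n%:Z) (y + k * n%:Z) = inv g x y.
Proof. by move=> A k x y; rewrite /inv !(aff_shiftg A); lia. Qed.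

(** Congruent lines are parallel. *)
Lemma inv_cg w g x y : aff w g -> inv g x y -> ~~ cg m x y.
Proof.
move=> A; apply: contraTN => /cgP[c ->]; rewrite /inv (aff_shiftg A); lia.
Qed.

(* [(x, y)] is a translate of [(w (p + 1), w p)]. *)
Definition pair_at g p x y := (g x == g y + 1) && cg m (g y) p.

Lemma aff_inj w g x y : aff w g -> g x = g y -> x = y.
Proof. by case=> _ gK _ _ e; rewrite -(gK x) e gK. Qed.

Lemma pair_atP w g p x y : aff w g ->
  reflect (c2 m x y = c2 m (w (p + 1)) (w p)) (pair_at g p x y).
Proof.
move=> A; have [wK gK wS _] := A; apply: (iffP andP) => [[/eqP gx /cgP[c gy]]|].
  apply/c2_eqP => //; exists (- c).
  by split; apply: (aff_inj A); rewrite wK (aff_shiftg A); lia.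
move/c2_eqP => [] // k [e1 e2].
have e1' := congr1 g e1; have e2' := congr1 g e2.
move: e1' e2'; rewrite !wK !(aff_shiftg A) => e1' e2'.
split; first by lia.
by apply/cgP; exists (- k); lia.
Qed.

Lemma desc_cg w g p q : aff w g -> cg m q p -> (w (q + 1) < w q) = (w (p + 1) < w p).
Proof.
case=> _ _ wS _ /cgP[c ->].
have -> : p + c * n%:Z + 1 = (p + 1) + c * n%:Z by lia.
by rewrite !wS; lia.
Qed.

Lemma pair_at_inv w g p x y : aff w g -> w (p + 1) < w p -> pair_at g p x y -> inv g x y.
Proof.
move=> A d /andP[/eqP gx gy]; rewrite /inv gx; apply/andP; split; last by lia.
have [_ gK _ _] := A; move: d; rewrite -(desc_cg A gy) //.
by rewrite -gx !gK.
Qed.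

(** By [sp_lt] only the order of neighbouring positions congruent to p and p + 1 changes. At a
    descent the lines there are inverted before and not after, so exactly one class of inversions is
    lost. *)
Lemma inv_sp w g p x y : aff w g -> w (p + 1) < w p ->
  inv (sp m p \o g) x y = inv g x y && ~~ pair_at g p x y.
Proof.
move=> A d; rewrite /inv /=; case: (ltrP x y) => xy //=.
case: (ltrgtP (g y) (g x)) => h /=.
- by rewrite sp_lt.
- rewrite -[LHS]negbK -leNgt le_eqVlt sp_lt //.
  suff -> : (g y == g x + 1) && cg m (g x) p = false by rewrite orbT.
  apply/negbTE/negP => t; have := @pair_at_inv w g p y x A d.
  by rewrite /pair_at t /inv => /(_ isT); lia.
- by move: xy; rewrite (aff_inj A h) ltxx.
Qed.

Lemma noninv w g x y : aff w g -> x < y -> (g x < g y) = ~~ inv g x y.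
Proof.
move=> A xy; rewrite /inv xy; case: (ltrgtP (g x) (g y)) => // /(aff_inj A); lia.
Qed.

Lemma pair_at_disjoint g p x y z : pair_at g p x y -> ~~ pair_at g p y z.
Proof.
move=> t; apply/negP => /andP[/eqP e1 c1]; case/andP: t => _; rewrite e1 => /cg_succ.
by rewrite cg_addr c1.
Qed.

(** The case distinction of all inductions: a pair that is not inverted after splitting off p was so
    before, or it is the pair split off. *)
Lemma sp_noninv w g p x y : aff w g -> w (p + 1) < w p -> x < y ->
  (sp m p \o g) x < (sp m p \o g) y -> g x < g y \/ pair_at g p x y.
Proof.
move=> A d xy; rewrite (noninv A xy) (noninv (aff_sp p A) xy) (inv_sp _ _ A d).
by case: (inv g x y) => /=; [rewrite negbK; right | left].
Qed.

(** Such an [M] exists since [g x - x] is periodic, hence bounded. It makes the classes of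
    inversions a finite list, [inv2s]. *)
Definition bounded g (M : nat) := forall x y, inv g x y -> y <= x + M%:Z.

Lemma aff_disp w g : aff w g -> exists D : nat, forall x, `|g x - x| <= D%:Z.
Proof.
move=> A; pose D := (\sum_(i < n) `|g (i : nat)%:Z - (i : nat)%:Z|)%N; exists D => x.
have [c] := letterE m x; set i := letter m x => e.
have -> : x = (i : nat)%:Z + (- c) * n%:Z by lia.
rewrite (aff_shiftg A) /D (bigD1 i) //=; lia.
Qed.

Lemma aff_bounded w g : aff w g -> exists M, bounded g M.
Proof.
move=> /aff_disp[D HD]; exists (D + D)%N => x y; rewrite /inv.
have := HD x; have := HD y; lia.
Qed.

Definition inv2s g (M : nat) : seq (seq int) :=
  [seq X <- [seq [:: k%:Z; (k + d)%:Z] | k <- iota 1 n, d <- iota 1 M]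
     | g (nth 0 X 1) < g (nth 0 X 0)].

Lemma mem_inv2s g M X : bounded g M ->
  reflect (exists x y, [/\ X = [:: x; y], 1 <= x <= n%:Z & inv g x y]) (X \in inv2s g M).
Proof.
move=> B; rewrite mem_filter; apply: (iffP andP).
  case=> + /allpairsPdep[k [d []]]; rewrite !mem_iota => + + + e; rewrite e /= => h hx hd.
  by exists k%:Z, (k + d)%:Z; rewrite /inv h; split=> //; lia.
move=> [x [y [-> hx hxy]]]; have yM := B _ _ hxy.
case/andP: hxy => xy gxy; split=> //; apply/allpairsPdep; exists `|x|%N, `|y - x|%N; rewrite !mem_iota /=.
by split; try lia; congr [:: _; _]; lia.
Qed.

Lemma uniq_inv2s g M : uniq (inv2s g M).
Proof.
apply: filter_uniq; apply: allpairs_uniq; rewrite ?iota_uniq //.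
by move=> [x d] [x' d'] _ _ /= [e1 e2]; congr pair; lia.
Qed.

Lemma mem_c2 w g M x y : aff w g -> bounded g M -> (c2 m x y \in inv2s g M) = inv g x y.
Proof.
move=> A B; have [//|k [e]] := @canonE m [:: x; y].
rewrite /c2 e /= => hk; apply/(mem_inv2s _ B)/idP.
  by move=> [x' [y' [[<- <-] _]]]; rewrite (inv_shift A).
by move=> h; do 2![eexists]; split; [reflexivity|done|rewrite (inv_shift A)].
Qed.

Lemma bounded_sp w g M p : aff w g -> w (p + 1) < w p -> bounded g M ->
  bounded (sp m p \o g) M.
Proof. by move=> A d B x y; rewrite (inv_sp _ _ A d) // => /andP[/B]. Qed.

Lemma in_inv2s_sp w g M p X : aff w g -> w (p + 1) < w p -> bounded g M ->
  (X \in inv2s (sp m p \o g) M) = (X \in inv2s g M) && (X != c2 m (w (p + 1)) (w p)).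
Proof.
move=> A d B; have B' := bounded_sp A d B.
apply/(mem_inv2s _ B')/andP => [[x [y [-> hx]]]|[]].
  rewrite (inv_sp _ _ A d) // => /andP[ixy nt]; split.
    by apply/(mem_inv2s _ B); exists x, y.
  apply: contra nt => /eqP e; apply/(pair_atP _ _ _ A) => //.
  by rewrite -e /c2 canon_id.
move=> /(mem_inv2s _ B)[x [y [-> hx ixy]]] nt.
exists x, y; split=> //; rewrite (inv_sp _ _ A d) // ixy /=; apply: contra nt => /(pair_atP _ _ _ A).
by rewrite /c2 canon_id // => ->.
Qed.

Lemma size_inv2s_sp w g M p : aff w g -> w (p + 1) < w p -> bounded g M ->
  size (inv2s g M) = (size (inv2s (sp m p \o g) M)).+1.
Proof.
move=> A d B; rewrite -/(size (c2 m (w (p + 1)) (w p) :: _)).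
apply: perm_size; apply: uniq_perm => [||X]; rewrite ?uniq_inv2s //.
  by rewrite /= uniq_inv2s (in_inv2s_sp _ A d B) // eqxx andbF.
rewrite in_cons (in_inv2s_sp _ A d B) //; case: eqP => [->|_] /=; last by rewrite andbT.
by rewrite (mem_c2 _ _ A B) // /inv d; case: A => wK _ _ _; rewrite !wK; lia.
Qed.

(** Induction on the number of classes of inversions, which drops by one at any descent. The
    hypothesis is offered for all descents, so that the step may choose one that suits the set at
    hand. *)
Lemma aff_ind (P : (int -> int) -> (int -> int) -> Prop) :
  (forall w g, aff w g ->
     (forall p, w (p + 1) < w p -> P (w \o sp m p) (sp m p \o g)) -> P w g) ->
  forall w g, aff w g -> P w g.
Proof.
move=> IH w g A; have [M B] := aff_bounded A.
have [k] := ubnP (size (inv2s g M)); elim: k w g A B => // k IHk w g A B hk.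
apply: (IH) => // p d; apply: IHk; first exact: aff_sp.
  exact: bounded_sp A d B.
by move: hk; rewrite (size_inv2s_sp A d B).
Qed.

(** Without descents [w] rises by at least 1 at each step, and it rises by n over a period, hence by
    exactly 1 at each step. So [w] is a translation, and the sum condition makes it trivial. *)
Lemma aff_nodesc w g : aff w g -> (forall p, ~ w (p + 1) < w p) -> w = id.
Proof.
move=> A h; have [wK gK wS w0] := A.
have st p : w p + 1 <= w (p + 1).
  have := h p; have := congr1 g (_ : w p = w (p + 1)); rewrite !wK; lia.
have stk (k : nat) p : w p + k%:Z <= w (p + k%:Z).
  elim: k => [|k IH]; first by rewrite !addr0.
  by have := st (p + k%:Z); rewrite (_ : p + k%:Z + 1 = p + k.+1%:Z); lia.
have st1 p : w (p + 1) = w p + 1.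
  by have := stk m.+1 (p + 1); have := st p; have := wS p 1;
    rewrite mul1r (_ : p + 1 + m.+1%:Z = p + n%:Z); lia.
have pos (k : nat) p : w (p + k%:Z) = w p + k%:Z.
  elim: k => [|k IH]; first by rewrite !addr0.
  rewrite (_ : p + k.+1%:Z = p + k%:Z + 1) ?st1 ?IH; lia.
have w0' : w 0 = 0.
  move: w0; rewrite (eq_bigr (fun=> w 0)); last first.
    by move=> i _; have := pos i 0; rewrite add0r => ->; lia.
  rewrite sumr_const card_ord -mulr_natr => /eqP; rewrite mulf_eq0; lia.
apply: funext => x; have [k [->|->]] : exists k : nat, x = k%:Z \/ x = - k%:Z.
- by exists `|x|%N; lia.
- by rewrite -[k%:Z]add0r pos w0'.
- by have := pos k (- k%:Z); rewrite addNr w0' /=; lia.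
Qed.

Lemma affperm_aff w : is_affperm n w -> exists g, aff w g.
Proof.
case=> -[g wK gK] [per s]; exists g; split=> //; first exact: per_mul.
rewrite sumrB.
(* Passing from the window 1, ..., n to 0, ..., n - 1 replaces the value at n by the one at 0; the
   change is n for [w] as for the identity. *)
have e (h : int -> int) : \sum_(i < n) h (i : nat)%:Z =
   \sum_(1 <= i < n.+1) h i%:Z - h n%:Z + h 0.
  rewrite -(big_mkord xpredT (fun i => h i%:Z)) big_add1 [n.+1.-1]/=.
  have := @big_nat_recl int 0 +%R n 0 (fun i => h i%:Z) (leq0n _).
  rewrite (@big_nat_recr _ _ _ n 0) // => /(canRL (addrK _)) ->.
  by rewrite -addrA addrC.
have wn : w n%:Z = w 0 + n%:Z by rewrite -per add0r.
suff sum_id k : \sum_(1 <= i < k.+1) i%:Z = ('C(k.+1, 2))%:Z :> int.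
  by rewrite (e w) (e id) s wn sum_id /=; lia.
elim: k => [|k IH]; first by rewrite big_geq.
by rewrite big_nat_recr //= IH (binS k.+1 1) bin1 PoszD.
Qed.

End Affine.

(** * Consistent sets of triples and the order of crossings on a line *)

Section Descents.
Context (m : nat).
Local Notation n := m.+2.
Implicit Types (w g : int -> int) (p q x y z : int) (R : int -> int -> int -> bool).

(** The arguments are the bits along the lex order of a 4-packet: nondecreasing if the set meets the
    packet in a suffix, nonincreasing if in a prefix. *)
Definition mono (a b c d : bool) :=
  [&& a ==> b, b ==> c & c ==> d] || [&& b ==> a, c ==> b & d ==> c].

(* Consistency of a set [R] of triples. The entries x_a, x_(a+1) in the q-fields
   may be congruent mod n: this case is a congruence relation of the permanent
   poset (a composite of two for [cons3_q23]), the other case a quasi-inversion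
   relation. *)
Record cons3 g R : Prop := Cons3 {
  cons3_inv : forall x y z, R x y z -> inv g x y && inv g y z;
  cons3_shift : forall k x y z,
    R (x + k * n%:Z) (y + k * n%:Z) (z + k * n%:Z) = R x y z;
  cons3_q12 : forall x1 x2 x3 x4, x1 < x2 -> g x1 < g x2 ->
    inv g x1 x3 -> inv g x2 x3 -> inv g x3 x4 -> R x2 x3 x4 -> R x1 x3 x4;
  cons3_q23 : forall x1 x2 x3 x4, x2 < x3 -> g x2 < g x3 ->
    inv g x1 x2 -> inv g x1 x3 -> inv g x2 x4 -> inv g x3 x4 ->
    R x1 x2 x4 -> R x1 x3 x4;
  cons3_q34 : forall x1 x2 x3 x4, x3 < x4 -> g x3 < g x4 ->
    inv g x1 x2 -> inv g x2 x3 -> inv g x2 x4 -> R x1 x2 x4 -> R x1 x2 x3;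
  cons3_mono : forall x1 x2 x3 x4, inv g x1 x2 -> inv g x2 x3 -> inv g x3 x4 ->
    mono (R x1 x2 x3) (R x1 x2 x4) (R x1 x3 x4) (R x2 x3 x4)
}.

Section LineOrder.
Context (w g : int -> int) (R : int -> int -> int -> bool).
Hypotheses (A : aff m w g) (C : cons3 g R).

(* [rev_on a b c], for [b < c] both crossing the line [a], says that [a] crosses
   [c] before [b]; [before a b c] is the resulting order. If one pair of the
   triple is not inverted the order is forced, and [ext3] extends [R] to these
   triples: reversed if [(x, y)] is not inverted, unreversed if [(y, z)] is not. *)
Definition ext3 x y z := inv g x y ==> inv g y z && R x y z.

Definition rev_on a b c :=
  if c < a then ext3 b c a else if b < a then ext3 b a c else ext3 a b c.

Definition before a b c := if b < c then ~~ rev_on a b c else rev_on a c b.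

Definition crosses a b := inv g a b || inv g b a.

(** This excludes cycles among three crossings on [a]. There are four cases for the place of [a]
    among b < c < d. Each is a finite check on four bits: the 4-packet condition applies if all
    pairs are inverted, and otherwise a relation of the permanent poset or the forced values of
    [ext3] decide. *)
Lemma rev_on_acyclic a b c d : b < c -> c < d -> crosses a b -> crosses a c -> crosses a d ->
  rev_on a b c = rev_on a c d -> rev_on a b d = rev_on a b c.
Proof.
move=> bc cd ab ac ad; rewrite /rev_on.
have ga x : crosses a x -> x != a by rewrite /crosses /inv; case: eqP => // ->; lia.
have := ga _ ab; have := ga _ ac; have := ga _ ad; move=> da ca ba {ga}.
have gne x y : x < y -> g x != g y.
  by move=> xy; apply/eqP => /(aff_inj A); lia.
have [da'|da'] := ltrP d a.
  have ca' : c < a by lia.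
  rewrite ca'.
  have := gne _ _ bc; have := gne _ _ cd; have := gne _ _ (lt_trans bc cd).
  have := @cons3_mono _ _ C b c d a; have := @cons3_q12 _ _ C b c d a.
  have := @cons3_q23 _ _ C b c d a.
  move: ab ac ad; rewrite /ext3 /crosses /inv /mono.
  case: (R b c d); case: (R b c a); case: (R b d a); case: (R c d a) => /=; lia.
have [ca'|ca'] := ltrP c a.
  have ba' : b < a by lia.
  rewrite ba'.
  have := gne _ _ bc.
  have := @cons3_mono _ _ C b c a d; have := @cons3_q12 _ _ C b c a d.
  move: ab ac ad; rewrite /ext3 /crosses /inv /mono.
  case: (R b c d); case: (R b c a); case: (R b a d); case: (R c a d) => /=; lia.
have [ba'|ba'] := ltrP b a.
  have := gne _ _ cd.
  have := @cons3_mono _ _ C b a c d; have := @cons3_q34 _ _ C b a c d.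
  move: ab ac ad; rewrite /ext3 /crosses /inv /mono.
  case: (R b c d); case: (R b a c); case: (R b a d); case: (R a c d) => /=; lia.
have := gne _ _ bc; have := gne _ _ cd; have := gne _ _ (lt_trans bc cd).
have := @cons3_mono _ _ C a b c d; have := @cons3_q34 _ _ C a b c d.
have := @cons3_q23 _ _ C a b c d.
move: ab ac ad; rewrite /ext3 /crosses /inv /mono.
case: (R a b c); case: (R b c d); case: (R a b d); case: (R a c d) => /=; lia.
Qed.

End LineOrder.
End Descents.

(** * Existence of a crossing that is last on both of its lines *)

Section LastCrossings.
Context (m : nat).
Local Notation n := m.+2.
Context (w g : int -> int) (R : int -> int -> int -> bool).
Hypotheses (A : aff m w g) (C : cons3 m g R).
Implicit Types (a b c d p x y z : int).
Local Notation before := (before g R).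
Local Notation crosses := (crosses g).

Lemma before_total a b c : b != c -> before a b c = ~~ before a c b.
Proof. by rewrite /before; case: ltrgtP => //; rewrite negbK. Qed.

(** Sorting [b], [c], [d] by number gives six cases; in each of them a failure would contradict
    [rev_on_acyclic] for the sorted triple. *)
Lemma before_trans a b c d : crosses a b -> crosses a c -> crosses a d ->
  b != c -> c != d -> b != d -> before a b c -> before a c d -> before a b d.
Proof.
move=> ab ac ad; rewrite /before.
have tr x y z : crosses a x -> crosses a y -> crosses a z -> x < y -> y < z ->
    rev_on g R a x y = rev_on g R a y z -> rev_on g R a x z = rev_on g R a x y.
  by move=> *; exact: (rev_on_acyclic A C).
case: (ltrgtP b c) => // bc; case: (ltrgtP c d) => // cd; case: (ltrgtP b d) => // bd _ _ _; try lia.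
- move=> /negbTE e1 /negbTE e2; by rewrite (tr b c d) ?e1 ?e2.
- move=> /negbTE e1 e2; have := tr b d c ab ad ac bd cd; rewrite e1 e2.
  by case: (rev_on _ _ a b d) => // /(_ erefl).
- move=> /negbTE e1 e2; have := tr d b c ad ab ac bd bc; rewrite e1 e2.
  by case: (rev_on _ _ a d b) => // /(_ erefl).
- move=> e1 /negbTE e2; have := tr c b d ac ab ad bc bd; rewrite e1 e2.
  by case: (rev_on _ _ a b d) => // /(_ erefl).
- move=> e1 /negbTE e2; have := tr c d b ac ad ab cd bd; rewrite e1 e2.
  by case: (rev_on _ _ a d b) => // /(_ erefl).
- by move=> e1 e2; rewrite (tr d c b) ?e1 ?e2.
Qed.

Definition last_on a c := crosses a c /\ forall d, crosses a d -> d != c -> before a d c.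

Lemma last_on_ex a b : crosses a b -> exists c, last_on a c.
Proof.
move=> ab; have [D hD] := aff_disp A.
have main (s : seq int) : (forall x, x \in s -> crosses a x) -> s != [::] ->
    exists2 c, c \in s & forall d, d \in s -> d != c -> before a d c.
  elim: s => // x [|y s] IH hs _.
    by exists x; rewrite ?mem_head // => d; rewrite inE => ->.
  have [|//|c cs hc] := IH; first by move=> z zs; apply: hs; rewrite inE zs orbT.
  have [->|xc] := eqVneq x c.
    exists c; first exact: mem_head.
    by move=> d; rewrite inE => /orP[->//|]; exact: hc.
  have axx := hs x (mem_head _ _).
  have ac : crosses a c by apply: hs; rewrite inE cs orbT.
  case: (boolP (before a x c)) => bxc.
    exists c; first by rewrite inE cs orbT.
    by move=> d; rewrite inE => /orP[/eqP->//|]; exact: hc.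
  rewrite (before_total _ xc) negbK in bxc.
  exists x; first exact: mem_head.
  move=> d; rewrite inE => /orP[->//|ds] dx.
  have [->//|dc] := eqVneq d c.
  apply: (@before_trans a d c x) => //; [|by rewrite eq_sym|exact: hc].
  by apply: hs; rewrite inE ds orbT.
(* Since [|g x - x|] is at most D for both lines, a line that crosses [a] has its number within 2 D
   of [a]; this window has 4 D + 1 entries. *)
pose s := [seq x <- [seq a - (D + D)%:Z + k%:Z | k <- iota 0 (4 * D).+1] | crosses a x].
have sP x : (x \in s) = crosses a x.
  rewrite mem_filter andb_idr // => h.
  apply/mapP; exists (absz (x - a + (D + D)%:Z)); last first.
    by have := hD x; have := hD a; move: h; rewrite /crosses /inv; lia.
  by rewrite mem_iota; have := hD x; have := hD a; move: h; rewrite /crosses /inv; lia.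
have [x||c] := main s; rewrite ?sP //.
  by apply/eqP => e; have := sP b; rewrite e ab.
by move=> ac hc; exists c; split=> // d ad; apply: hc; rewrite sP.
Qed.

(** Passing from [a] to a larger line that it crosses increases the number and decreases the
    position, so [a - g a] grows; as it is at most D, this ends. *)
Lemma only_right a b : crosses a b ->
  exists a' b', crosses a' b' /\ forall c, crosses a' c -> c < a'.
Proof.
have [D hD] := aff_disp A.
have [k] := ubnP (absz (D%:Z - (a - g a))%R); elim: k a b => // k IH a b hk ab.
have [[c ac ca]|h] := pselect (exists2 c, crosses a c & a < c); last first.
  exists a, b; split=> // c ac; rewrite ltNge; apply/negP => ca; apply: h; exists c => //.
  by move: ac ca; rewrite /crosses /inv; lia.
apply: (IH c a); last by rewrite /crosses orbC.
have := hD a; have := hD c; move: ac ca hk; rewrite /crosses /inv; lia.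
Qed.

Lemma only_left a b : crosses a b ->
  exists a' b', crosses a' b' /\ forall c, crosses a' c -> a' < c.
Proof.
have [D hD] := aff_disp A.
have [k] := ubnP (absz (D%:Z + (a - g a))%R); elim: k a b => // k IH a b hk ab.
have [[c ac ca]|h] := pselect (exists2 c, crosses a c & c < a); last first.
  exists a, b; split=> // c ac; rewrite ltNge; apply/negP => ca; apply: h; exists c => //.
  by move: ac ca; rewrite /crosses /inv; lia.
apply: (IH c a); last by rewrite /crosses orbC.
have := hD a; have := hD c; move: ac ca hk; rewrite /crosses /inv; lia.
Qed.

(* The crossing of [w (p + 1)] and [w p] is the last one on both of these lines. *)
Definition removable_at p := forall z,
  (inv g z (w (p + 1)) -> ~~ R z (w (p + 1)) (w p)) /\
  (inv g (w p) z -> R (w (p + 1)) (w p) z).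

Lemma find_switch (P : int -> Prop) p q : P p -> ~ P q -> p < q ->
  exists2 r, P r & ~ P (r + 1).
Proof.
move=> Pp Pq pq; apply: contrapT => h.
have step k : P (p + k%:Z).
  elim: k => [|k IH]; first by rewrite addr0.
  apply: contrapT => h'; apply: h; exists (p + k%:Z) => //.
  have e : p + k%:Z + 1 = p + k.+1%:Z by lia.
  by rewrite e.
have e : p + (absz (q - p)%R)%:Z = q by lia.
by apply: Pq; rewrite -e; exact: step.
Qed.

Lemma before_lt a x y : x < y ->
  before a x y = ~~ rev_on g R a x y /\ before a y x = rev_on g R a x y.
Proof. by move=> xy; rewrite /before xy ltNge (ltW xy). Qed.

Lemma rev_on_rr a x y : x < y -> y < a -> rev_on g R a x y = ext3 g R x y a.
Proof. by rewrite /rev_on => _ ->. Qed.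

Lemma rev_on_rl a x y : x < a -> a < y -> rev_on g R a x y = ext3 g R x a y.
Proof. by rewrite /rev_on => -> h; rewrite ltNge (ltW h). Qed.

Lemma rev_on_ll a x y : a < x -> x < y -> rev_on g R a x y = ext3 g R a x y.
Proof.
by rewrite /rev_on => h h'; rewrite !ltNge (ltW h) (ltW (lt_trans h h')).
Qed.

(** Let a = w p and b = w (p + 1). No line lies between them, so a third line is on the same side of
    both, and whether it crosses them is decided by numbers alone. If only one of the two claims
    fails, both last crossings concern a single triple and contradict each other; the case in which
    both fail needs four lines. *)
Lemma last_adjacent p c d : last_on (w p) c -> c < w p ->
  last_on (w (p + 1)) d -> w (p + 1) < d -> c = w (p + 1) /\ d = w p.
Proof.
have [wK gK _ _] := A.
have : g (w (p + 1)) = g (w p) + 1 by rewrite !wK.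
move: (w p) (w (p + 1)) => a b gb [ac lc] ca [bd ld] db.
have gne x y : g x = g y -> x = y := @aff_inj _ _ _ x y A.
have ne : a != b by apply/eqP => e; move: gb; rewrite e; lia.
have [cb|cb] := eqVneq c b; have [da|da] := eqVneq d a; try by [].
- rewrite {c}cb in ac lc ca *.
  have gda : g d != g a by apply: contra_neq da => /gne.
  have ba : crosses b a by rewrite /crosses orbC.
  have := ld a ba; rewrite eq_sym => /(_ da).
  have [ad|ad] : a < d \/ d < a by move: da; case: ltrgtP; auto.
    rewrite (before_lt b ad).1 rev_on_ll // => nR.
    have := lc d; rewrite (before_lt a (lt_trans ca ad)).2 rev_on_rl // (negbTE nR).
    by have /= := @gne d b; move: ac bd; rewrite /crosses /inv; lia.
  by rewrite (before_lt b ad).2 rev_on_ll //; move: ac bd; rewrite /ext3 /crosses /inv; lia.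
- rewrite {d}da in bd ld db *.
  have gcb : g c != g b by apply: contra_neq cb => /gne.
  have ab : crosses a b by rewrite /crosses orbC.
  have := lc b ab; rewrite eq_sym => /(_ cb).
  have [bc|bc] : b < c \/ c < b by move: cb; case: ltrgtP; auto.
    by rewrite (before_lt a bc).1 rev_on_rr //; move: ac bd; rewrite /ext3 /crosses /inv; lia.
  rewrite (before_lt a bc).2 rev_on_rr // => nR.
  have := ld c; rewrite (before_lt b (lt_trans bc db)).1 rev_on_rl // nR.
  by have /= := @gne c a; move: ac bd; rewrite /crosses /inv; lia.
- have gda : g d != g a by apply: contra_neq da => /gne.
  have gcb : g c != g b by apply: contra_neq cb => /gne.
  (* On [a] the crossing with [d] precedes the one with [c], which makes the triple c, a, d
     reversed; on [b] the crossing with [c] precedes the one with [d], so that c, b, d is not. *)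
  have key : a < d -> c < b -> R c a d && ~~ R c b d.
    move=> ad cb'; have icb : inv g c b by move: ac; rewrite /crosses /inv; lia.
    have iad : inv g a d by move: bd; rewrite /crosses /inv; lia.
    have cd : d != c by apply/eqP; lia.
    have := lc d; rewrite (before_lt a (lt_trans ca ad)).2 rev_on_rl //.
    have := ld c; rewrite (before_lt b (lt_trans cb' db)).1 rev_on_rl // eq_sym.
    by move: ac bd icb iad; rewrite /ext3 /crosses /inv; lia.
  case: (ltrgtP a b) ne => // ab _.
    have := key (lt_trans ab db) (lt_trans ca ab).
    have := @cons3_q23 _ _ _ C c a b d ab; move: ac bd; rewrite /crosses /inv; lia.
  have ba : crosses b a by move: ab; rewrite /crosses /inv; lia.
  have ba' : crosses a b by rewrite /crosses orbC.
  have ad : a < d.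
    have := ld a ba; rewrite eq_sym => /(_ da).
    case: (ltrgtP a d) da => // da' _.
    by rewrite (before_lt b da').2 rev_on_ll //; move: ac bd; rewrite /ext3 /crosses /inv; lia.
  have cb' : c < b.
    have := lc b ba'; rewrite eq_sym => /(_ cb).
    case: (ltrgtP c b) cb => // cb' _.
    by rewrite (before_lt a cb').1 rev_on_rr //; move: ac bd; rewrite /ext3 /crosses /inv; lia.
  (* For b < a the 4-packet c, b, a, d would have the bits 1, 0, 1, 0 along its lex order, which is
     neither a prefix nor a suffix. *)
  have := key ad cb'; have := @cons3_mono _ _ _ C c b a d.
  have := lc b ba'; rewrite eq_sym (before_lt a cb').2 rev_on_rr // => /(_ cb).
  have := ld a ba; rewrite eq_sym (before_lt b ad).1 rev_on_ll // => /(_ da).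
  by move: ac bd; rewrite /ext3 /crosses /inv /mono; lia.
Qed.

Lemma removable_ex x y : inv g x y -> exists p, w (p + 1) < w p /\ removable_at p.
Proof.
move=> ixy; have [wK gK wS _] := A.
have cxy : crosses x y by rewrite /crosses ixy.
have [a [a1 [aa1 ar]]] := only_right cxy.
have [b [b1 [bb1 bl]]] := only_left cxy.
pose P p := exists2 c, c < w p & last_on (w p) c.
have Pa : P (g a).
  by have [c lc] := last_on_ex aa1; exists c; rewrite gK //; apply: ar; case: lc.
(* A translate of [b] to the right of [a]; by periodicity it is also crossed only by larger
   lines. *)
have [k kn] : exists k : nat, g a < g b + k%:Z * n%:Z.
  by exists (absz (g a - g b)%R).+1; lia.
have Pb : ~ P (g b + k%:Z * n%:Z).
  case=> c; rewrite wS gK => cb [bc _].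
  have := bl (c - k%:Z * n%:Z).
  rewrite /crosses -(inv_shift A k%:Z b) -(inv_shift A k%:Z _ b) subrK => /(_ bc); lia.
have [p [c ca lc] nP] := find_switch Pa Pb kn.
have ne : w p != w (p + 1) by apply/eqP => /(congr1 g); rewrite !wK; lia.
(* Failure of [P] at p + 1 could also mean that this line crosses nothing. It does cross something:
   [w p] if the two are inverted, and [c] otherwise. *)
have [d' bd'] : exists d', crosses (w (p + 1)) d'.
  have [->|cb] := eqVneq (w (p + 1)) c; first by exists (w p); rewrite /crosses orbC; case: lc.
  have gcb : g (w (p + 1)) <> g c by move/(aff_inj A)/eqP; rewrite (negbTE cb).
  case: (ltrgtP (w p) (w (p + 1))) ne => // ab _.
    by exists c; case: lc => + _; move: gcb; rewrite /crosses /inv !wK; lia.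
  by exists (w p); rewrite /crosses /inv !wK; lia.
have [d ld] := last_on_ex bd'.
have db : w (p + 1) < d.
  case: (ltrgtP (w (p + 1)) d) => // h; first by case: nP; exists d.
  by case: ld; rewrite -h /crosses /inv; lia.
have [ec ed] := last_adjacent lc ca ld db.
subst c d; exists p; split=> // z; case: lc ld => _ lc [_ ld]; split=> h.
- have zb : z < w (p + 1) by case/andP: h.
  have cz : crosses (w p) z by move: h ca; rewrite /crosses /inv !wK; lia.
  have := lc z cz; rewrite lt_eqF // => /(_ isT).
  by rewrite (before_lt _ zb).1 rev_on_rr //; move: h ca; rewrite /ext3 /inv !wK; lia.
- have bz : w p < z by case/andP: h.
  have cz : crosses (w (p + 1)) z by move: h ca; rewrite /crosses /inv !wK; lia.
  have := ld z cz; rewrite gt_eqF // => /(_ isT).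
  by rewrite (before_lt _ bz).2 rev_on_ll //; move: h ca; rewrite /ext3 /inv !wK; lia.
Qed.

End LastCrossings.

(** * Length and reduced words *)

Section Words.
Context (m : nat).
Local Notation n := m.+2.
Implicit Types (w g : int -> int) (p q x y z : int) (u v : seq 'I_n).

Local Notation pos i := (Posz (nat_of_ord i)).

(** Words are built and taken apart at the right end, where a letter acts on positions. *)
Lemma wprod_rcons u i : wprod (rcons u i) = wprod u \o sp m (pos i).
Proof.
apply: funext => x /=; elim: u x => [|j u IH] x /=; last by rewrite IH.
by rewrite sref_sp.
Qed.

Lemma refl_aux_rcons f u i : refl_aux f (rcons u i) =
  rcons (refl_aux f u) (mkset n [:: f (wprod u (pos i)); f (wprod u (pos i + 1))]).
Proof.
elim: u f => [|j u IH] f //=.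
by rewrite IH.
Qed.

Lemma mkset_lt x y : x < y -> mkset n [:: x; y] = c2 m x y.
Proof. by move=> xy; rewrite /mkset /c2 /sort /= (ltW xy). Qed.

Lemma refl_order_rcons w u i : wprod u \o sp m (pos i) = w -> w (pos i + 1) < w (pos i) ->
  refl_order (rcons u i) = rcons (refl_order u) (c2 m (w (pos i + 1)) (w (pos i))).
Proof.
move=> <- /=; rewrite (@sp_r m (pos i)) ?cg_refl // (@sp_l m _ (pos i)) ?cg_refl //.
by rewrite addrK /refl_order refl_aux_rcons => /mkset_lt ->.
Qed.

Lemma size_refl_aux f u : size (refl_aux f u) = size u.
Proof. by elim: u f => //= i u IH f; rewrite IH. Qed.

Lemma size_refl_order u : size (refl_order u) = size u.
Proof. exact: size_refl_aux. Qed.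

(** The length, as the number of classes of inversions. It is a relation because the list depends on
    a bound [M]; by [ell_uniq] the value does not. *)
Definition ell g k := exists2 M, bounded g M & size (inv2s m g M) = k.

Lemma ell_ex w g : aff m w g -> exists k, ell g k.
Proof. by move=> /aff_bounded[M B]; exists (size (inv2s m g M)), M. Qed.

Lemma ell_uniq g k k' : ell g k -> ell g k' -> k = k'.
Proof.
case=> M B <- [M' B' <-]; apply: perm_size; apply: uniq_perm; rewrite ?uniq_inv2s //.
by move=> X; apply/(mem_inv2s m _ B)/(mem_inv2s m _ B').
Qed.

Lemma ell_desc w g p k : aff m w g -> w (p + 1) < w p ->
  ell (sp m p \o g) k <-> ell g k.+1.
Proof.
move=> A d; have [M B] := aff_bounded A; have B' := bounded_sp A d B.
have e1 : ell g (size (inv2s m g M)) by exists M.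
have e2 : ell (sp m p \o g) (size (inv2s m (sp m p \o g) M)) by exists M.
split=> e.
- by rewrite (ell_uniq e e2) -(size_inv2s_sp A d B).
- by have := ell_uniq e e1; rewrite (size_inv2s_sp A d B) => -[->].
Qed.

Lemma ell_asc w g p k : aff m w g -> w p < w (p + 1) ->
  ell g k <-> ell (sp m p \o g) k.+1.
Proof.
move=> A d; have := @ell_desc (w \o sp m p) (sp m p \o g) p k (aff_sp p A).
rewrite sp_compK; apply.
by rewrite /= (@sp_r m p) ?cg_refl // (@sp_l m p p) ?cg_refl // addrK.
Qed.

Lemma ell_id : ell id 0.
Proof.
exists 0%N; first by move=> x y; rewrite /inv; lia.
apply/eqP; rewrite size_eq0; apply/eqP; case E: (inv2s m id 0) => [//|X s].
have : X \in inv2s m id 0 by rewrite E mem_head.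
by move/mem_inv2s => [|x [y []]]; [move=> x y|]; rewrite /inv; lia.
Qed.

Lemma desc_or_asc w g p : aff m w g -> w (p + 1) < w p \/ w p < w (p + 1).
Proof.
case=> wK _ _ _; case: (ltrgtP (w (p + 1)) (w p)); auto.
by move/(congr1 g); rewrite !wK; lia.
Qed.

Lemma aff_uniq w g g' : aff m w g -> aff m w g' -> g = g'.
Proof.
case=> _ gK _ _ [wK' _ _ _]; apply: funext => x.
by rewrite -{2}(gK x) wK'.
Qed.

Lemma aff_id_eq g : aff m id g -> g = id.
Proof. by move=> A; apply: aff_uniq A (aff_id m). Qed.

(** A letter changes the number of inversions by exactly one, up or down. *)
Lemma ell_word w g u k : aff m w g -> wprod u = w -> ell g k -> (k <= size u)%N.
Proof.
elim/last_ind: u w g k => [|u i IH] w g k A.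
  move=> /= e; move: A; rewrite -e => /aff_id_eq -> /ell_uniq /(_ ell_id) ->.
  by [].
rewrite wprod_rcons size_rcons => e hk.
have eu : wprod u = w \o sp m (pos i) by rewrite -e comp_spK.
have A' := aff_sp (pos i) A.
have [d|d] := desc_or_asc (pos i) A.
  case: k hk => // k /(ell_desc _ A d) hk; exact: IH A' eu hk.
have /(ell_asc _ A d) hk' := hk.
by have := IH _ _ _ A' eu hk'; lia.
Qed.

Lemma word_ex w g : aff m w g -> exists2 u : seq 'I_n, wprod u = w & ell g (size u).
Proof.
move: w g; apply: aff_ind => w g A IH.
have [[p d]|h] := pselect (exists p, w (p + 1) < w p).
  have [u eu lu] := IH p d; exists (rcons u (letter m p)); last first.
    by rewrite size_rcons; apply/(ell_desc _ A d).
  rewrite wprod_rcons eu; apply: funext => x /=.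
  rewrite -(sp_cg (p := p)) ?spK // cg_sym; exact: cg_letter.
have w1 : w = id.
  by apply: (aff_nodesc A) => p d; apply: h; exists p.
by exists [::] => //; move: A; rewrite w1 => /aff_id_eq ->; exact: ell_id.
Qed.

Lemma reducedP w g u : aff m w g ->
  reduced w u <-> wprod u = w /\ ell g (size u).
Proof.
move=> A; split=> [[/funext e h]|[e l]].
  split=> //; have [v ev lv] := word_ex A.
  have [k lk] := ell_ex A; have := ell_word A e lk.
  have := h v (fun x => congr1 (@^~ x) ev).
  by have -> := ell_uniq lv lk; move=> ? ?; have -> : size u = k by lia.
split=> [x|v /funext ev]; first by rewrite e.
exact: ell_word A ev l.
Qed.

Lemma reduced_rcons w g u i : aff m w g ->
  reduced w (rcons u i) <->
  w (pos i + 1) < w (pos i) /\ reduced (w \o sp m (pos i)) u.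
Proof.
move=> A; have A' := aff_sp (pos i) A.
rewrite (reducedP _ A) (reducedP _ A') wprod_rcons size_rcons.
split=> [[e l]|[d [e l]]]; last first.
  by rewrite e comp_spK; split=> //; apply/(ell_desc _ A d).
have e' : wprod u = w \o sp m (pos i) by rewrite -e comp_spK.
have [d|d] := desc_or_asc (pos i) A.
  by split=> //; split=> //; apply/(ell_desc _ A d).
have := ell_word A' e'; move/(ell_asc _ A d): l => l /(_ _ l); lia.
Qed.

Lemma reduced_nil w g : aff m w g -> reduced w ([::] : seq 'I_n) <-> w = id.
Proof.
move=> A; rewrite (reducedP _ A) /=; split=> [[<-]//|e]; split=> //.
by move: A; rewrite e => /aff_id_eq ->; exact: ell_id.
Qed.

End Words.

(** * Reflection orders of reduced words *)

Section ReflectionOrders.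
Context (m : nat).
Local Notation n := m.+2.
Implicit Types (w g : int -> int) (p q x y z : int) (u v : seq 'I_n) (rho : seq (seq int)).
Local Notation pos i := (Posz (nat_of_ord i)).
Local Notation idx rho x y := (index (c2 m x y) rho).

Definition lists g rho := uniq rho /\
  forall X, X \in rho <-> exists x y, [/\ X = [:: x; y], 1 <= x <= n%:Z & inv g x y].

Lemma lists_c2 w g rho x y : aff m w g -> lists g rho -> (c2 m x y \in rho) = inv g x y.
Proof.
move=> A [_ U]; have [M B] := aff_bounded A.
rewrite -(mem_c2 _ _ A B); apply/idP/idP => [/U h|/(mem_inv2s _ _ B) h].
  exact/(mem_inv2s _ _ B).
exact/U.
Qed.

Lemma refl_lists w g u : aff m w g -> reduced w u -> lists g (refl_order u).
Proof.
elim/last_ind: u w g => [|u i IH] w g A.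
  move/(reduced_nil A) => e; split=> // X; split=> // -[x [y [_ _]]].
  by move: A; rewrite e => /aff_id_eq ->; rewrite /inv; lia.
move=> r; have /(reduced_rcons _ _ A)[d r'] := r.
have [U1 U2] := IH _ _ (aff_sp (pos i) A) r'.
have /(reducedP _ (aff_sp (pos i) A))[e _] := r'.
have -> := @refl_order_rcons m w u i _ d; last by rewrite e comp_spK.
have [M B] := aff_bounded A; have B' := bounded_sp A d B.
have E X : (X \in refl_order u) = (X \in inv2s m g M) && (X != c2 m (w (pos i + 1)) (w (pos i))).
  rewrite -(in_inv2s_sp _ A d B); apply/idP/idP.
    by move/U2 => h; apply/(mem_inv2s _ _ B').
  by move/(mem_inv2s _ _ B') => h; apply/U2.
split; first by rewrite rcons_uniq E eqxx andbF.
move=> X; rewrite mem_rcons inE E.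
split=> [h|/(mem_inv2s _ _ B) ->]; last by rewrite /= orbN.
apply/(mem_inv2s _ _ B); case/orP: h => [/eqP ->|/andP[] //].
by rewrite (mem_c2 _ _ A B) /inv d; case: A => wK _ _ _; rewrite !wK; lia.
Qed.

Lemma c2_in_refl w g u x y : aff m w g -> reduced w u ->
  (c2 m x y \in refl_order u) = inv g x y.
Proof. by move=> A r; exact: lists_c2 A (refl_lists A r). Qed.

(* The line form of the reversal set of [rho]. *)
Definition reversed g (rho : seq (seq int)) x y z :=
  [&& inv g x y, inv g y z & (idx rho y z < idx rho x y)%N].

Definition cut g (R : int -> int -> int -> bool) x y z :=
  [&& R x y z, inv g x y & inv g y z].

(** The letter [i] contributes the last entry of the order. A triple with this pair as its lower
    pair is therefore reversed, one with it as its upper pair is not, and it cannot be the outer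
    pair since no line lies between adjacent positions. *)
Lemma reversed_rcons w g u i : aff m w g -> reduced w (rcons u i) ->
  (forall x y z, pair_at m g (pos i) x y -> inv g y z -> reversed g (refl_order (rcons u i)) x y z) /\
  (forall x y z, pair_at m g (pos i) y z -> ~~ reversed g (refl_order (rcons u i)) x y z) /\
  cut (sp m (pos i) \o g) (reversed g (refl_order (rcons u i))) =
    reversed (sp m (pos i) \o g) (refl_order u).
Proof.
move=> A r; have /(reduced_rcons _ _ A)[d r'] := r.
have A' := aff_sp (pos i) A.
have /(reducedP _ A')[e _] := r'.
have -> := @refl_order_rcons m w u i _ d; last by rewrite e comp_spK.
set rho := rcons _ _.
have mem x y : (c2 m x y \in refl_order u) = inv g x y && ~~ pair_at m g (pos i) x y.
  by rewrite (c2_in_refl _ _ A' r') (inv_sp _ _ A d).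
have pairE x y : pair_at m g (pos i) x y -> c2 m x y = c2 m (w (pos i + 1)) (w (pos i)).
  by move/(pair_atP _ _ _ A).
have last_t x y : pair_at m g (pos i) x y ->
    idx rho x y = size (refl_order u).
  move=> t; rewrite /rho -cats1 index_cat mem t andbF /= (pairE _ _ t) eqxx addn0 //.
have no_t x y : inv g x y -> ~~ pair_at m g (pos i) x y ->
    idx rho x y = idx (refl_order u) x y.
  by move=> h t; rewrite /rho -cats1 index_cat mem h t.
have lt_t x y : inv g x y -> ~~ pair_at m g (pos i) x y ->
    (idx (refl_order u) x y < size (refl_order u))%N.
  by move=> h t; rewrite index_mem mem h t.
split=> [x y z t iyz|]; last split=> [x y z t|].
- have nt := pair_at_disjoint z t.
  rewrite /reversed iyz (pair_at_inv A d t) /= (last_t _ _ t) (no_t _ _ iyz nt).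
  exact: lt_t.
- rewrite /reversed; apply/negP => /and3P[ixy iyz]; rewrite (last_t _ _ t).
  have [t'|t'] := boolP (pair_at m g (pos i) x y); first by rewrite last_t ?ltnn.
  by rewrite (no_t _ _ ixy t') ltnNge index_size.
- apply: funext => x; apply: funext => y; apply: funext => z; rewrite /cut /reversed.
  rewrite !(inv_sp _ _ A d); case ixy: (inv g x y) => //; case iyz: (inv g y z) => //=; last by rewrite !andbF.
  case txy: (pair_at m g (pos i) x y) => /=; first by rewrite !andbF.
  case tyz: (pair_at m g (pos i) y z) => /=; first by rewrite !andbF.
  by rewrite !andbT !no_t ?txy ?tyz.
Qed.

(* Admissibility of [rho], with the permanent poset replaced by the relations
   among integers that may be congruent mod n. *)
Record pair_order g rho : Prop := PairOrder {
  pair_order12 : forall x1 x2 x3, x1 < x2 -> g x1 < g x2 -> inv g x1 x3 -> inv g x2 x3 ->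
    (idx rho x2 x3 < idx rho x1 x3)%N;
  pair_order23 : forall x1 x2 x3, x2 < x3 -> g x2 < g x3 -> inv g x1 x2 -> inv g x1 x3 ->
    (idx rho x1 x2 < idx rho x1 x3)%N;
  pair_order123 : forall x1 x2 x3, inv g x1 x2 -> inv g x2 x3 ->
    (idx rho x1 x2 < idx rho x1 x3 < idx rho x2 x3)%N \/
    (idx rho x2 x3 < idx rho x1 x3 < idx rho x1 x2)%N
}.

Lemma reversed_cons3 w g rho : aff m w g -> lists g rho -> pair_order g rho ->
  cons3 m g (reversed g rho).
Proof.
move=> A L [a12 a23 a123]; split.
- by move=> x y z /and3P[-> ->].
- by move=> k x y z; rewrite /reversed !(inv_shift A) !c2_shift.
- move=> x1 x2 x3 x4 l12 l12' i13 i23 i34; rewrite /reversed i13 i23 i34 /=.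
  have := a12 x1 x2 x3 l12 l12' i13 i23; lia.
- move=> x1 x2 x3 x4 l23 l23' i12 i13 i24 i34; rewrite /reversed i12 i13 i24 i34 /=.
  have := a12 x2 x3 x4 l23 l23' i24 i34; have := a123 _ _ _ i12 i24.
  have := a123 _ _ _ i13 i34; lia.
- move=> x1 x2 x3 x4 l34 l34' i12 i23 i24; rewrite /reversed i12 i23 i24 /=.
  have := a23 x2 x3 x4 l34 l34' i23 i24; lia.
- move=> x1 x2 x3 x4 i12 i23 i34.
  have i13 := inv_trans i12 i23; have i24 := inv_trans i23 i34.
  rewrite /reversed i12 i23 i34 i13 i24 /=.
  have := a123 _ _ _ i12 i23; have := a123 _ _ _ i12 i24.
  have := a123 _ _ _ i13 i34; have := a123 _ _ _ i23 i34; rewrite /mono; lia.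
Qed.

(** The appended pair is inverted for [g] and not for [sp m p \o g]. For a triple that contains it,
    [pair_order123] with this pair in last place says the same as [pair_order12] or [pair_order23]
    once the pair is no longer inverted. By [adj] it is never the outer pair of a triple. *)
Lemma pair_order_rcons w g p rho : aff m w g -> w (p + 1) < w p ->
  lists (sp m p \o g) rho ->
  pair_order g (rcons rho (c2 m (w (p + 1)) (w p))) <-> pair_order (sp m p \o g) rho.
Proof.
move=> A d L; have A' := aff_sp p A; set g' := sp m p \o g.
set rho' := rcons _ _.
have I x y : inv g' x y = inv g x y && ~~ pair_at m g p x y by exact: (inv_sp _ _ A d).
have idx_t x y : pair_at m g p x y -> inv g x y /\ idx rho' x y = size rho.
  move=> t; split; first exact: pair_at_inv A d t.
  rewrite /rho' -cats1 index_cat (lists_c2 _ _ A' L) I t andbF.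
  by move/(pair_atP _ _ _ A): t => ->; rewrite /= eqxx addn0.
have idx_n x y : inv g' x y -> idx rho' x y = idx rho x y /\ (idx rho x y < size rho)%N.
  by move=> h; rewrite /rho' -cats1 index_cat index_mem (lists_c2 _ _ A' L) h.
have adj x y z : pair_at m g p x y -> ~ (g y < g z < g x).
  by case/andP => /eqP -> _; lia.
have nn x y : x < y -> g x < g y -> g' x < g' y.
  by move=> xy; rewrite (noninv A xy) (noninv A' xy) I => /negbTE ->.
have nt x y (xy : x < y) : g' x < g' y -> g x < g y \/ pair_at m g p x y := sp_noninv A d xy.
split=> -[a12 a23 a123]; split.
- move=> x1 x2 x3 l12 l12' i13 i23.
  have [e13 s13] := idx_n _ _ i13; have [e23 s23] := idx_n _ _ i23.
  move: i13 i23; rewrite !I => /andP[i13 n13] /andP[i23 n23].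
  case: (nt _ _ l12 l12') => [l|t].
    by have := a12 _ _ _ l12 l i13 i23; rewrite e13 e23.
  have [i12 e12] := idx_t _ _ t.
  by have := a123 _ _ _ i12 i23; rewrite e12 e13 e23; lia.
- move=> x1 x2 x3 l23 l23' i12 i13.
  have [e13 s13] := idx_n _ _ i13; have [e12 s12] := idx_n _ _ i12.
  move: i13 i12; rewrite !I => /andP[i13 n13] /andP[i12 n12].
  case: (nt _ _ l23 l23') => [l|t].
    by have := a23 _ _ _ l23 l i12 i13; rewrite e13 e12.
  have [i23 e23] := idx_t _ _ t.
  by have := a123 _ _ _ i12 i23; rewrite e12 e13 e23; lia.
- move=> x1 x2 x3 i12 i23; have i13 := inv_trans i12 i23.
  have [e12 _] := idx_n _ _ i12; have [e13 _] := idx_n _ _ i13.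
  have [e23 _] := idx_n _ _ i23; rewrite -e12 -e13 -e23.
  by move: i12 i23; rewrite !I => /andP[i12 _] /andP[i23 _]; exact: a123.
- move=> x1 x2 x3 l12 l12' i13 i23.
  have n23 : ~~ pair_at m g p x2 x3.
    apply/negP => /(adj _ _ x1); apply; move: i13; rewrite /inv; lia.
  have [|e23 s23] := idx_n x2 x3; first by rewrite I i23.
  have [/idx_t[_ e13]|n13] := boolP (pair_at m g p x1 x3); first by rewrite e23 e13.
  have i13' : inv g' x1 x3 by rewrite I i13.
  have i23' : inv g' x2 x3 by rewrite I i23.
  have [e13 s13] := idx_n _ _ i13'; rewrite e13 e23.
  by apply: a12 => //; exact: nn.
- move=> x1 x2 x3 l23 l23' i12 i13.
  have n12 : ~~ pair_at m g p x1 x2.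
    apply/negP => /(adj _ _ x3); apply; move: i13; rewrite /inv; lia.
  have [|e12 s12] := idx_n x1 x2; first by rewrite I i12.
  have [/idx_t[_ e13]|n13] := boolP (pair_at m g p x1 x3); first by rewrite e12 e13.
  have i13' : inv g' x1 x3 by rewrite I i13.
  have i12' : inv g' x1 x2 by rewrite I i12.
  have [e13 s13] := idx_n _ _ i13'; rewrite e13 e12.
  by apply: a23 => //; exact: nn.
- move=> x1 x2 x3 i12 i23; have i13 := inv_trans i12 i23.
  have n13 : ~~ pair_at m g p x1 x3.
    apply/negP => /(adj _ _ x2); apply; move: i12 i23; rewrite /inv; lia.
  have i13' : inv g' x1 x3 by rewrite I i13.
  have [e13 s13] := idx_n _ _ i13'; rewrite e13.
  have [t12|n12] := boolP (pair_at m g p x1 x2).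
    have i23' : inv g' x2 x3 by rewrite I i23 (pair_at_disjoint x3 t12).
    have [e23 s23] := idx_n _ _ i23'; have [_ ->] := idx_t _ _ t12; rewrite e23; right.
    have l12 : x1 < x2 by case/andP: i12.
    have := a12 x1 x2 x3 l12 _ i13' i23'; rewrite (noninv A' l12) I t12 andbF => /(_ isT); lia.
  have i12' : inv g' x1 x2 by rewrite I i12.
  have [e12 s12] := idx_n _ _ i12'; rewrite e12.
  have [t23|n23] := boolP (pair_at m g p x2 x3).
    have [_ ->] := idx_t _ _ t23; left.
    have l23 : x2 < x3 by case/andP: i23.
    have := a23 x1 x2 x3 l23 _ i12' i13'; rewrite (noninv A' l23) I t23 andbF => /(_ isT); lia.
  have i23' : inv g' x2 x3 by rewrite I i23.
  by have [-> _] := idx_n _ _ i23'; exact: a123.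
Qed.

Lemma refl_pair_order w g u : aff m w g -> reduced w u -> pair_order g (refl_order u).
Proof.
elim/last_ind: u w g => [|u i IH] w g A.
  move/(reduced_nil A) => e; move: A; rewrite e => /aff_id_eq ->.
  by split; rewrite /inv => *; lia.
move=> r; have /(reduced_rcons _ _ A)[d r'] := r.
have A' := aff_sp (pos i) A; have /(reducedP _ A')[e _] := r'.
rewrite (@refl_order_rcons m w u i _ d); last by rewrite e comp_spK.
by apply/(pair_order_rcons A d (refl_lists A' r')); apply: IH A' r'.
Qed.

Lemma lists_sp w g p rho : aff m w g -> w (p + 1) < w p ->
  lists g (rcons rho (c2 m (w (p + 1)) (w p))) -> lists (sp m p \o g) rho.
Proof.
move=> A d [U E]; have [M B] := aff_bounded A.
move: U; rewrite rcons_uniq => /andP[tn U]; split=> // X.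
have B' := bounded_sp A d B.
have -> : X \in rho <-> X \in inv2s m (sp m p \o g) M.
  rewrite (in_inv2s_sp _ A d B).
  have -> : (X \in inv2s m g M) = (X \in rcons rho (c2 m (w (p + 1)) (w p))).
    by apply/(mem_inv2s _ _ B)/idP => [/E|/E].
  rewrite mem_rcons inE; case: eqP => [->|_] /=; last by rewrite andbT.
  by rewrite (negbTE tn).
by split=> [/(mem_inv2s _ _ B')|h] //; apply/(mem_inv2s _ _ B').
Qed.

Lemma pair_order_word w g rho : aff m w g -> lists g rho -> pair_order g rho ->
  exists2 u : seq 'I_n, reduced w u & refl_order u = rho.
Proof.
move=> A; move: w g A rho; apply: aff_ind => w g A IH rho.
case/lastP: rho => [|rho t] L Ld.
  have w1 : w = id.
    apply: (aff_nodesc A) => p d.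
    have : c2 m (w (p + 1)) (w p) \in [::] :> bool; last by [].
    rewrite (lists_c2 _ _ A L) /inv d; case: A => wK _ _ _; rewrite !wK; lia.
  by exists [::] => //; apply/(reduced_nil A).
have [wK gK _ _] := A.
have [x [y [et hx ixy]]] : exists x y, [/\ t = [:: x; y], 1 <= x <= n%:Z & inv g x y].
  by case: L => _ E; apply/E; rewrite mem_rcons mem_head.
have tE : t = c2 m x y by rewrite et /c2 canon_id.
have last_idx a b : inv g a b -> (idx (rcons rho t) a b <= idx (rcons rho t) x y)%N.
  rewrite -(lists_c2 _ _ A L) -index_mem size_rcons ltnS => h.
  suff -> : idx (rcons rho t) x y = size rho by [].
  rewrite -tE -cats1 index_cat /= eqxx addn0; case: ifP => // tr.
  by case: L; rewrite rcons_uniq tr.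
(* The last pair of the order is at adjacent positions. Otherwise the line z next to y lies between
   y and x, and depending on its number [pair_order12], [pair_order23] or [pair_order123] puts a
   pair with z after (x, y). *)
have gxy : g x = g y + 1.
  apply: contrapT => ne; pose z := w (g y + 1).
  have gz : g z = g y + 1 by rewrite /z wK.
  have [zx|zx] := ltrP z x.
    have izy : inv g z y by move: ixy; rewrite /inv; lia.
    have := last_idx _ _ izy; have := @pair_order12 _ _ Ld z x y zx _ izy ixy.
    by move: ixy; rewrite /inv; lia.
  have [zy|zy] := ltrP y z.
    have ixz : inv g x z by move: ixy; rewrite /inv; lia.
    have := last_idx _ _ ixz; have := @pair_order23 _ _ Ld x y z zy _ ixy ixz.
    by move: ixy; rewrite /inv; lia.
  have nx : x <> z by move=> e; apply: ne; rewrite e.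
  have ny : y <> z by move=> e; move: gz; rewrite -e; lia.
  have ixz : inv g x z by move: ixy; rewrite /inv; lia.
  have izy : inv g z y by move: ixy; rewrite /inv; lia.
  have := last_idx _ _ ixz; have := last_idx _ _ izy.
  by have := @pair_order123 _ _ Ld x z y ixz izy; lia.
pose i := letter m (g y).
have cgi : cg m (g y) (pos i) by rewrite cg_sym; exact: cg_letter.
have d : w (pos i + 1) < w (pos i).
  by rewrite -(desc_cg A cgi) -gxy !gK; case/andP: ixy.
have tE' : t = c2 m (w (pos i + 1)) (w (pos i)).
  by rewrite tE; apply/(pair_atP _ _ _ A); rewrite /pair_at gxy eqxx.
rewrite tE' in L Ld *; have L' := lists_sp A d L.
have [u r e] := IH (pos i) d rho L' ((pair_order_rcons A d L').1 Ld).
exists (rcons u i); first by apply/(reduced_rcons _ _ A).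
rewrite (@refl_order_rcons m w u i _ d) ?e //.
by have /(reducedP _ (aff_sp _ A))[-> _] := r; rewrite comp_spK.
Qed.

End ReflectionOrders.

(** * Splitting off the last letter of a word with a given reversal set *)

Section Steps.
Context (m : nat).
Local Notation n := m.+2.
Implicit Types (w g : int -> int) (p q x y z : int) (u v : seq 'I_n).
Implicit Types (R : int -> int -> int -> bool).
Local Notation pos i := (Posz (nat_of_ord i)).

(** [removable_at] for all translates of the pair, which is the shape that depends on p only mod
    n. *)
Definition removable g R p := forall x y z, pair_at m g p x y ->
  (inv g z x -> ~~ R z x y) /\ (inv g y z -> R x y z).

Lemma pair_at_cg g p q x y : cg m p q -> pair_at m g p x y = pair_at m g q x y.
Proof.
move=> pq; congr (_ && _); apply/idP/idP => h; apply: cg_trans h _ => //.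
by rewrite cg_sym.
Qed.

Lemma removable_at_translate w g R p : aff m w g -> cons3 m g R -> removable_at w g R p -> removable g R p.
Proof.
move=> A C G x y z t; have /c2_eqP[k [ex ey]] := esym (elimT (pair_atP _ _ _ A) t).
have zE : z = (z - k * n%:Z) + k * n%:Z by lia.
have [G1 G2] := G (z - k * n%:Z).
by split; rewrite ex ey zE (inv_shift A) (cons3_shift C).
Qed.

Lemma cut_cut g1 g2 R : (forall x y, inv g2 x y -> inv g1 x y) ->
  cut g2 (cut g1 R) = cut g2 R.
Proof.
move=> h; apply: funext => x; apply: funext => y; apply: funext => z.
rewrite /cut; case ixy: (inv g2 x y); case iyz: (inv g2 y z); rewrite ?andbF //.
by rewrite (h _ _ ixy) (h _ _ iyz) !andbT.
Qed.

Lemma inv_sp_sub w g p x y : aff m w g -> w (p + 1) < w p ->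
  inv (sp m p \o g) x y -> inv g x y.
Proof. by move=> A d; rewrite (inv_sp _ _ A d) => /andP[]. Qed.

(** The pair split off brings new instances of the q-conditions. Each lives in a 4-packet containing
    the pair; removability fixes two of its bits (both 1 at the low end, 0 and 1 in the middle, both
    0 at the high end), and [mono] then orders the other two as required. *)
Lemma cut_cons3 w g R p : aff m w g -> cons3 m g R -> w (p + 1) < w p ->
  removable g R p -> cons3 m (sp m p \o g) (cut (sp m p \o g) R).
Proof.
move=> A C d G; have A' := aff_sp p A; set g' := sp m p \o g.
have I x y : inv g' x y = inv g x y && ~~ pair_at m g p x y by exact: (inv_sp _ _ A d).
have sub x y : inv g' x y -> inv g x y by exact: inv_sp_sub A d.
have nt x y (xy : x < y) : g' x < g' y -> g x < g y \/ pair_at m g p x y := sp_noninv A d xy.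
have inv_t x y : pair_at m g p x y -> inv g x y by exact: pair_at_inv A d.
have lt_inv x y : inv g' x y -> x < y by case/andP.
rewrite /cut; split.
- by move=> x y z /and3P[_ -> ->].
- by move=> k x y z; rewrite !(inv_shift A') (cons3_shift C).
- move=> x1 x2 x3 x4 l12 l12' i13 i23 i34; rewrite i13 i23 i34 !andbT.
  case: (nt _ _ l12 l12') => [l|t].
    exact: (cons3_q12 C l12 l (sub _ _ i13) (sub _ _ i23) (sub _ _ i34)).
  have := cons3_mono C (inv_t _ _ t) (sub _ _ i23) (sub _ _ i34).
  have := (G _ _ x3 t).2 (sub _ _ i23).
  have := (G _ _ x4 t).2 (inv_trans (sub _ _ i23) (sub _ _ i34)).
  by rewrite /mono; case: (R x1 x2 x3); case: (R x1 x2 x4); case: (R x1 x3 x4); case: (R x2 x3 x4).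
- move=> x1 x2 x3 x4 l23 l23' i12 i13 i24 i34; rewrite i12 i13 i24 i34 !andbT.
  case: (nt _ _ l23 l23') => [l|t].
    exact: (cons3_q23 C l23 l (sub _ _ i12) (sub _ _ i13) (sub _ _ i24) (sub _ _ i34)).
  have := cons3_mono C (sub _ _ i12) (inv_t _ _ t) (sub _ _ i34).
  have := (G _ _ x1 t).1 (sub _ _ i12); have := (G _ _ x4 t).2 (sub _ _ i34).
  by rewrite /mono; case: (R x1 x2 x3); case: (R x1 x2 x4); case: (R x1 x3 x4); case: (R x2 x3 x4).
- move=> x1 x2 x3 x4 l34 l34' i12 i23 i24; rewrite i12 i23 i24 !andbT.
  case: (nt _ _ l34 l34') => [l|t].
    exact: (cons3_q34 C l34 l (sub _ _ i12) (sub _ _ i23) (sub _ _ i24)).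
  have := cons3_mono C (sub _ _ i12) (sub _ _ i23) (inv_t _ _ t).
  have := (G _ _ x2 t).1 (sub _ _ i23).
  have := (G _ _ x1 t).1 (inv_trans (sub _ _ i12) (sub _ _ i23)).
  by rewrite /mono; case: (R x1 x2 x3); case: (R x1 x2 x4); case: (R x1 x3 x4); case: (R x2 x3 x4).
- move=> x1 x2 x3 x4 i12 i23 i34.
  rewrite i12 i23 i34 (inv_trans i12 i23) (inv_trans i23 i34) !andbT.
  by have := cons3_mono C (sub _ _ i12) (sub _ _ i23) (sub _ _ i34).
Qed.

Definition realizes w g R u := reduced w u /\ R = reversed m g (refl_order u).

Lemma realizes_cons3 w g R u : aff m w g -> realizes w g R u -> cons3 m g R.
Proof.
by move=> A [r ->]; exact: reversed_cons3 A (refl_lists A r) (refl_pair_order A r).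
Qed.

Lemma sp_letter p : sp m (pos (letter m p)) = sp m p.
Proof. by apply: funext; apply: sp_cg; exact: cg_letter. Qed.

Lemma realizes_last w g R u i : aff m w g -> realizes w g R (rcons u i) ->
  [/\ w (pos i + 1) < w (pos i), removable g R (pos i) &
      realizes (w \o sp m (pos i)) (sp m (pos i) \o g) (cut (sp m (pos i) \o g) R) u].
Proof.
move=> A [r ->]; have [h1 [h2 h3]] := reversed_rcons A r.
have [d r'] := (reduced_rcons u i A).1 r.
by split=> // x y z t; split=> h; [exact: h2 | exact: h1].
Qed.

(** Nothing is lost in the cut: the triples that contain the pair at p are decided by removability,
    for [R] as for the word. *)
Lemma realizes_rcons w g R u p : aff m w g -> cons3 m g R -> w (p + 1) < w p ->
  removable g R p -> realizes (w \o sp m p) (sp m p \o g) (cut (sp m p \o g) R) u ->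
  realizes w g R (rcons u (letter m p)).
Proof.
move=> A C d G [r e]; set i := letter m p.
have ip : cg m (pos i) p by exact: cg_letter.
have r1 : reduced w (rcons u i).
  by apply/(reduced_rcons _ _ A); rewrite (desc_cg A ip) sp_letter.
split=> //; have [h1 [h2 h3]] := reversed_rcons A r1.
rewrite sp_letter -e in h3.
apply: funext => x; apply: funext => y; apply: funext => z.
case ixy: (inv g x y); last by rewrite /reversed ixy; apply/negbTE/negP => /(cons3_inv C); rewrite ixy.
case iyz: (inv g y z); last by rewrite /reversed iyz andbF; apply/negbTE/negP => /(cons3_inv C); rewrite iyz andbF.
have [t|nt] := boolP (pair_at m g p x y).
  by rewrite (G _ _ z t).2 ?iyz // h1 // (pair_at_cg _ _ _ ip).
have [t|nt'] := boolP (pair_at m g p y z).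
  by rewrite (negbTE ((G _ _ x t).1 ixy)) (negbTE (h2 x y z _)) // (pair_at_cg _ _ _ ip).
have := congr1 (fun f => f x y z) h3.
by rewrite /cut !(inv_sp _ _ A d) ixy iyz nt nt' !andbT => ->.
Qed.

Lemma realizes_ex w g R : aff m w g -> cons3 m g R -> exists u, realizes w g R u.
Proof.
move=> A; move: w g A R; apply: aff_ind => w g A IH R C.
have [[p d]|h] := pselect (exists p, w (p + 1) < w p).
  have [|q [dq Gq]] := @removable_ex m w g R A C (w (p + 1)) (w p).
    by rewrite /inv d; case: A => wK _ _ _; rewrite !wK; lia.
  have {}Gq := removable_at_translate A C Gq.
  have [u hu] := IH q dq _ (cut_cons3 A C dq Gq).
  by exists (rcons u (letter m q)); exact: realizes_rcons.
have w1 : w = id.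
  by apply: (aff_nodesc A) => p d; apply: h; exists p.
exists [::]; split; first exact/(reduced_nil A).
have g1 : g = id by move: A; rewrite w1; exact: aff_id_eq.
apply: funext => x; apply: funext => y; apply: funext => z.
have /negbTE -> : ~~ R x y z by apply/negP => /(cons3_inv C); rewrite g1 /inv; lia.
by apply/esym/negbTE; rewrite /reversed g1 /inv; lia.
Qed.

Lemma realizes_step w g R p x y : aff m w g -> cons3 m g R ->
  w (p + 1) = x -> w p = y -> x < y ->
  (forall z, inv g z x -> ~~ R z x y) -> (forall z, inv g y z -> R x y z) ->
  cons3 m (sp m p \o g) (cut (sp m p \o g) R) /\
  forall u, realizes (w \o sp m p) (sp m p \o g) (cut (sp m p \o g) R) u ->
    realizes w g R (rcons u (letter m p)).
Proof.
move=> A C ex ey xy h1 h2; have d : w (p + 1) < w p by rewrite ex ey.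
have G : removable g R p.
  by apply: (removable_at_translate A C) => z; rewrite ex ey; split; [exact: h1 | exact: h2].
by split=> [|u]; [exact: cut_cons3 A C d G | exact: realizes_rcons].
Qed.

End Steps.

(** * Braid relations, and uniqueness of words up to commutations *)

Section Braids.
Context (m : nat).
Local Notation n := m.+2.
Implicit Types (w g : int -> int) (p q x y z : int) (u v : seq 'I_n).
Implicit Types (R : int -> int -> int -> bool).
Local Notation pos i := (Posz (nat_of_ord i)).
Local Notation letter := (letter m).

Lemma cg_succ_neq p : ~~ cg m p (p + 1).
Proof. exact: cg_succ (cg_refl m p). Qed.

Lemma sp_braid_at p : ~~ cg m p (p + 1 + 1) ->
  [/\ sp m (p + 1) p = p, sp m p (p + 1 + 1) = p + 1 + 1,
      sp m p p = p + 1, sp m p (p + 1) = p &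
      sp m (p + 1) (p + 1) = p + 1 + 1 /\ sp m (p + 1) (p + 1 + 1) = p + 1].
Proof.
move=> h; split; last split.
- by rewrite sp_id // cg_succ_neq.
- by rewrite sp_id // cg_sym // cg_succ_neq.
- by rewrite sp_l ?cg_refl.
- by rewrite sp_r ?cg_refl ?addrK.
- by rewrite sp_l ?cg_refl.
- by rewrite sp_r ?cg_refl ?addrK.
Qed.

(** The hypothesis means n > 2. By periodicity only p, p + 1 and p + 2 need to be checked. *)
Lemma sp_braid p x : ~~ cg m p (p + 1 + 1) ->
  sp m p (sp m (p + 1) (sp m p x)) = sp m (p + 1) (sp m p (sp m (p + 1) x)).
Proof.
move=> h; have [e1 e2 e3 e4 [e5 e6]] := sp_braid_at h.
have S q a c : sp m q (a + c * n%:Z) = sp m q a + c * n%:Z by exact: sp_add.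
have [/cgP[c ->]|n0] := boolP (cg m x p); first by rewrite !(S, e1, e2, e3, e4, e5, e6).
have [/cgP[c ->]|n1] := boolP (cg m x (p + 1)); first by rewrite !(S, e1, e2, e3, e4, e5, e6).
have [/cgP[c ->]|n2] := boolP (cg m x (p + 1 + 1)); first by rewrite !(S, e1, e2, e3, e4, e5, e6).
by rewrite !(sp_id n0 n1, sp_id n1 n2).
Qed.

(** If p + 2 were congruent to p, its value would be a larger translate of [w p]. *)
Lemma desc2_cg w g p : aff m w g -> w (p + 1 + 1) < w p -> ~~ cg m p (p + 1 + 1).
Proof.
case=> _ _ wS _ d; apply/negP => /cgP[c e].
have c0 : c < 0 by nia.
by move: d; rewrite {2}e wS; nia.
Qed.

(* The directed edges of the graph replace [braid3 p false] by [braid3 p true]. *)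
Definition braid3 p (b : bool) : seq 'I_n :=
  if b then [:: letter (p + 1); letter p; letter (p + 1)]
  else [:: letter p; letter (p + 1); letter p].

(** The hypotheses say that the crossings among x, y, z come after all others on these lines. They
    are split off one by one, from the side that [R x y z] decides. The exceptions [t != z] and
    [t != x] concern the triple itself: at the first step it is settled by [R x y z], at the third
    one of its pairs is already split off. *)
Lemma realizes_braid w g R p x y z : aff m w g -> cons3 m g R ->
  w p = z -> w (p + 1) = y -> w (p + 1 + 1) = x -> x < y -> y < z ->
  (forall t, inv g t x -> ~~ R t x y) ->
  (forall t, inv g y t -> t != z -> R x y t) ->
  (forall t, inv g t x -> ~~ R t x z) -> (forall t, inv g z t -> R x z t) ->
  (forall t, inv g t y -> t != x -> ~~ R t y z) ->
  (forall t, inv g z t -> R y z t) ->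
  let w3 := w \o sp m p \o sp m (p + 1) \o sp m p in
  let g3 := sp m p \o (sp m (p + 1) \o (sp m p \o g)) in
  cons3 m g3 (cut g3 R) /\
  forall u, realizes w3 g3 (cut g3 R) u -> realizes w g R (u ++ braid3 p (R x y z)).
Proof.
move=> A C ez ey ex xy yz h1 h1' h2 h2' h3 h3' w3 g3.
have n3 : ~~ cg m p (p + 1 + 1) by apply: (desc2_cg A); lia.
have [e1 e2 e3 e4 [e5 e6]] := sp_braid_at n3.
have [wK _ _ _] := A.
have gz : g z = p by rewrite -ez wK.
have gy : g y = p + 1 by rewrite -ey wK.
have gx : g x = p + 1 + 1 by rewrite -ex wK.
have A1 q w' g' : aff m w' g' -> aff m (w' \o sp m q) (sp m q \o g') by exact: aff_sp.
have catE u a b c : u ++ [:: a; b; c] = rcons (rcons (rcons u a) b) c :> seq 'I_n.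
  by rewrite -!cats1 -!catA.
have sub q w' g' a b : aff m w' g' -> w' (q + 1) < w' q -> inv (sp m q \o g') a b -> inv g' a b.
  by move=> A'; exact: inv_sp_sub A'.
rewrite /braid3; case Rxyz: (R x y z).
- have [|C1 S1] := @realizes_step m w g R (p + 1) x y A C ex ey xy h1.
    move=> t iyt; have [->//|] := eqVneq t z; exact: h1'.
  set w1 := w \o _ in S1; set g1 := sp m (p + 1) \o g in C1 S1.
  have AA1 : aff m w1 g1 := A1 _ _ _ A.
  have s1 a b : inv g1 a b -> inv g a b by apply: (sub _ w) => //; lia.
  have [|||||C2 S2] := @realizes_step m w1 g1 _ p x z AA1 C1.
  + by rewrite /w1 /= e5.
  + by rewrite /w1 /= e1.
  + lia.
  + by move=> t /s1 /h2 h; rewrite /cut (negbTE h).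
  + move=> t i; rewrite /cut h2' ?s1 // i andbT /inv /g1 /= gx gz e1 e6; lia.
  rewrite cut_cut in C2 S2; last by move=> a b; apply: (sub _ w1) => //; rewrite /w1 /= e5 e1; lia.
  set w2 := w1 \o _ in S2; set g2 := sp m p \o g1 in C2 S2.
  have AA2 : aff m w2 g2 := A1 _ _ _ AA1.
  have s2 a b : inv g2 a b -> inv g1 a b by apply: (sub _ w1) => //; rewrite /w1 /= e5 e1; lia.
  have nxy : ~~ inv g2 x y by rewrite /inv /g2 /g1 /= gx gy e5 e6 e2 e4; lia.
  have [|||||C3 S3] := @realizes_step m w2 g2 _ (p + 1) y z AA2 C2.
  + by rewrite /w2 /w1 /= e2 e6.
  + by rewrite /w2 /w1 /= e4 e1.
  + done.
  + move=> t i; rewrite /cut; apply/negP => /and3P[r _ _].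
    have tx : t != x by apply: contraNneq nxy => <-.
    by have := h3 t (s1 _ _ (s2 _ _ i)) tx; rewrite r.
  + move=> t i; rewrite /cut h3' ?s1 ?s2 // i andbT /inv /g2 /g1 /= gy gz e1 e5 e2 e3; lia.
  rewrite cut_cut in C3 S3; last first.
    by move=> a b; apply: (sub _ w2) => //; rewrite /w2 /w1 /= e2 e6 e4 e1; lia.
  (* [w3] and [g3] are written with the other side of the braid relation, so that both cases leave
     the same remainder. *)
  have eg : g3 = sp m (p + 1) \o g2.
    by apply: funext => t; rewrite /g3 /g2 /g1 /= sp_braid.
  have ew : w3 = w2 \o sp m (p + 1).
    by apply: funext => t; rewrite /w3 /w2 /w1 /= sp_braid.
  rewrite eg ew; split=> // u /S3 /S2 /S1.
  by rewrite catE.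
- have [||C1 S1] := @realizes_step m w g R p y z A C ey ez yz.
  + by move=> t ity; have [->|] := eqVneq t x; [rewrite Rxyz | exact: h3].
  + exact: h3'.
  set w1 := w \o _ in S1; set g1 := sp m p \o g in C1 S1.
  have AA1 : aff m w1 g1 := A1 _ _ _ A.
  have s1 a b : inv g1 a b -> inv g a b by apply: (sub _ w) => //; lia.
  have [|||||C2 S2] := @realizes_step m w1 g1 _ (p + 1) x z AA1 C1.
  + by rewrite /w1 /= e2.
  + by rewrite /w1 /= e4.
  + lia.
  + by move=> t /s1 /h2 h; rewrite /cut (negbTE h).
  + move=> t i; rewrite /cut h2' ?s1 // i andbT /inv /g1 /= gx gz e2 e3; lia.
  rewrite cut_cut in C2 S2; last by move=> a b; apply: (sub _ w1) => //; rewrite /w1 /= e2 e4; lia.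
  set w2 := w1 \o _ in S2; set g2 := sp m (p + 1) \o g1 in C2 S2.
  have AA2 : aff m w2 g2 := A1 _ _ _ AA1.
  have s2 a b : inv g2 a b -> inv g1 a b by apply: (sub _ w1) => //; rewrite /w1 /= e2 e4; lia.
  have nyz : ~~ inv g2 y z by rewrite /inv /g2 /g1 /= gy gz e4 e3 e1 e5; lia.
  have [|||||C3 S3] := @realizes_step m w2 g2 _ p x y AA2 C2.
  + by rewrite /w2 /w1 /= e5 e2.
  + by rewrite /w2 /w1 /= e1 e3.
  + done.
  + by move=> t i; rewrite /cut (negbTE (h1 t (s1 _ _ (s2 _ _ i)))).
  + move=> t i; rewrite /cut h1' ?s1 ?s2 //; last by apply: contraNneq nyz => <-.
    rewrite i andbT /inv /g2 /g1 /= gx gy e2 e4 e6 e1; lia.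
  rewrite cut_cut in C3 S3; last first.
    by move=> a b; apply: (sub _ w2) => //; rewrite /w2 /w1 /= e5 e2 e1 e3; lia.
  by split=> // u /S3 /S2 /S1; rewrite catE.
Qed.

Lemma comm_equiv_rcons u v (i : 'I_n) : comm_equiv u v -> comm_equiv (rcons u i) (rcons v i).
Proof.
elim=> {u v} [u v [a [b [j [k [jk [-> ->]]]]]]|u|u v t _ h1 _ h2].
- by apply: rt_step; exists a, (rcons b i), j, k; rewrite -!rcons_cat.
- exact: rt_refl.
- exact: rt_trans h1 h2.
Qed.

Lemma comm_equiv_sym u v : comm_equiv u v -> comm_equiv v u.
Proof.
elim=> {u v} [u v [a [b [j [k [[h1 [h2 h3]] [-> ->]]]]]]|u|u v t _ h1 _ h2].
- apply: rt_step; exists a, b, k, j; split=> //; split=> //.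
  by move=> e; apply: h1.
- exact: rt_refl.
- exact: rt_trans h2 h1.
Qed.

Lemma sp_comm p q x : ~~ cg m q p -> ~~ cg m q (p + 1) -> ~~ cg m p (q + 1) ->
  sp m p (sp m q x) = sp m q (sp m p x).
Proof.
move=> h1 h2 h3.
have S r a c : sp m r (a + c * n%:Z) = sp m r a + c * n%:Z by exact: sp_add.
have h4 : ~~ cg m (q + 1) p by rewrite cg_sym.
have h5 : ~~ cg m (q + 1) (p + 1) by rewrite cg_addr.
have e1 : sp m p q = q by rewrite sp_id.
have e2 : sp m p (q + 1) = q + 1 by rewrite sp_id.
have e3 : sp m q q = q + 1 by rewrite sp_l ?cg_refl.
have e4 : sp m q (q + 1) = q by rewrite sp_r ?cg_refl ?addrK.
have [/cgP[c ->]|n0] := boolP (cg m x q); first by rewrite !(S, e1, e2, e3, e4).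
have [/cgP[c ->]|n1] := boolP (cg m x (q + 1)); first by rewrite !(S, e1, e2, e3, e4).
rewrite [sp m q x]sp_id //.
have shiftE (a b c : int) : cg m (a + c * n%:Z) b = cg m a b.
  by apply/idP/idP; apply: cg_trans; rewrite ?cg_mul // cg_sym cg_mul.
have subE (a b c : int) : cg m (a + 1 + c * n%:Z - 1) b = cg m a b.
  by rewrite -(shiftE a b c); congr cg; lia.
have addE (a b c : int) : cg m (a + c * n%:Z + 1) b = cg m (a + 1) b.
  by rewrite -(shiftE (a + 1) b c); congr cg; lia.
case: (spP m p x) => [[/cgP[c ->] ->]|[/cgP[c ->] ->]|[_ _ ->]]; rewrite sp_id //.
- by rewrite addE cg_sym.
- by rewrite addE cg_addr cg_sym.
- by rewrite subE cg_sym.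
- by rewrite subE.
Qed.

Lemma removable_comm w g R p q : aff m w g -> w (p + 1) < w p -> w (q + 1) < w q ->
  ~~ cg m q p -> ~~ cg m q (p + 1) -> ~~ cg m p (q + 1) -> removable m g R q ->
  (w \o sp m p) (q + 1) < (w \o sp m p) q /\
  removable m (sp m p \o g) (cut (sp m p \o g) R) q.
Proof.
move=> A dp dq h1 h2 h3 G; have A' := aff_sp p A.
have h4 : ~~ cg m (q + 1) p by rewrite cg_sym.
have h5 : ~~ cg m (q + 1) (p + 1) by rewrite cg_addr.
have d' : (w \o sp m p) (q + 1) < (w \o sp m p) q by rewrite /= !sp_id.
split=> // x y z t.
have sub a b : inv (sp m p \o g) a b -> inv g a b by exact: inv_sp_sub A dp.
have cgn a b r : cg m a b -> ~~ cg m b r -> ~~ cg m a r.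
  by move=> ab; apply: contra => ar; apply: cg_trans ar; rewrite cg_sym.
have t' : pair_at m g q x y.
  case/andP: (t) => /eqP gx gy; rewrite /= in gx gy.
  have gy' : g y = sp m p (g y) by rewrite -{1}(spK m p (g y)) sp_id // (cgn _ _ _ gy).
  have gx' : g x = sp m p (g x).
    by rewrite -{1}(spK m p (g x)) sp_id // gx; apply: (cgn _ (q + 1)); rewrite ?cg_addr.
  by rewrite /pair_at gx' gy' gx eqxx.
split=> i; first by rewrite /cut (negbTE ((G _ _ z t').1 (sub _ _ i))).
by rewrite /cut (G _ _ z t').2 ?sub // i (pair_at_inv A' d' t).
Qed.

(** The lines at p, p + 1, p + 2 form a triple that would be reversed by one hypothesis and not by
    the other. *)
Lemma removable_not_succ w g R p : aff m w g -> w (p + 1) < w p ->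
  w (p + 1 + 1) < w (p + 1) -> removable m g R p -> removable m g R (p + 1) -> False.
Proof.
case=> wK _ _ _ d1 d2 G1 G2.
have t1 : pair_at m g p (w (p + 1)) (w p) by rewrite /pair_at !wK eqxx cg_refl.
have t2 : pair_at m g (p + 1) (w (p + 1 + 1)) (w (p + 1)) by rewrite /pair_at !wK eqxx cg_refl.
have := (G1 _ _ (w (p + 1 + 1)) t1).1; have := (G2 _ _ (w p) t2).2.
rewrite /inv !wK d1 d2 /= => r1 r2.
have {r1}r1 : R (w (p + 1 + 1)) (w (p + 1)) (w p) by apply: r1; lia.
have {}r2 : ~~ R (w (p + 1 + 1)) (w (p + 1)) (w p) by apply: r2; lia.
by rewrite r1 in r2.
Qed.

Lemma removable_cg g R p q : cg m p q -> removable m g R p -> removable m g R q.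
Proof. by move=> pq G x y z; rewrite -(pair_at_cg _ _ _ pq); exact: G. Qed.

(** A diamond argument. Different last letters i and j are both removable, hence not neighbours by
    [removable_not_succ]. A word [a] for what remains after splitting off both gives the words a j i
    and a i j, one commutation apart, which are equivalent to the given ones by induction. *)
Lemma realizes_comm_equiv w g R u v : aff m w g -> realizes w g R u ->
  realizes w g R v -> comm_equiv u v.
Proof.
move=> A; move: w g A R u v; apply: aff_ind => w g A IH R u v ru rv.
have C := realizes_cons3 A ru.
have suv : size u = size v.
  case: ru rv => /(reducedP _ A)[_ l1] _ [/(reducedP _ A)[_ l2] _]; exact: ell_uniq l1 l2.
case/lastP: u suv ru => [|u i]; first by case: v rv => // *; exact: rt_refl.
case/lastP: v rv => [|v j]; rewrite ?size_rcons // => rv _ ru.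
have [di Gi ru'] := realizes_last A ru; have [dj Gj rv'] := realizes_last A rv.
have [eij|ne] := eqVneq i j.
  by subst j; apply: comm_equiv_rcons; apply: IH ru' rv'.
have nij (k l : 'I_n) : w (pos k + 1) < w (pos k) -> w (pos l + 1) < w (pos l) ->
    removable m g R (pos k) -> removable m g R (pos l) -> ~~ cg m (pos l) (pos k + 1).
  move=> dk dl Gk Gl; apply/negP => c; apply: (removable_not_succ A dk _ Gk (removable_cg c Gl)).
  by rewrite -(desc_cg A c).
have n1 : ~~ cg m (pos j) (pos i) by rewrite cg_ord eq_sym.
have n1' : ~~ cg m (pos i) (pos j) by rewrite cg_ord.
have n2 := nij i j di dj Gi Gj; have n3 := nij j i dj di Gj Gi.
have [dj' Gj'] := removable_comm A di dj n1 n2 n3 Gj.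
have [di' Gi'] := removable_comm A dj di n1' n3 n2 Gi.
have Ai := aff_sp (pos i) A; have Aj := aff_sp (pos j) A.
have Ci := cut_cons3 A C di Gi; have Cj := cut_cons3 A C dj Gj.
have [a ra] := realizes_ex (aff_sp (pos j) Ai) (cut_cons3 Ai Ci dj' Gj').
have r1 := realizes_rcons Ai Ci dj' Gj' ra.
have eg : sp m (pos j) \o (sp m (pos i) \o g) = sp m (pos i) \o (sp m (pos j) \o g).
  by apply: funext => x /=; rewrite sp_comm.
have ew : (w \o sp m (pos i)) \o sp m (pos j) = (w \o sp m (pos j)) \o sp m (pos i).
  by apply: funext => x /=; rewrite sp_comm.
have r2 : realizes (w \o sp m (pos j)) (sp m (pos j) \o g) (cut (sp m (pos j) \o g) R) (rcons a i).
  rewrite -(letter_ord i); apply: (realizes_rcons Aj Cj di' Gi').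
  rewrite -ew -eg cut_cut; last by move=> x y; rewrite eg; exact: inv_sp_sub Aj di'.
  by move: ra; rewrite cut_cut // => x y; exact: inv_sp_sub Ai dj'.
rewrite letter_ord in r1.
have e1 := comm_equiv_rcons i (IH _ di _ _ _ ru' r1).
have e2 := comm_equiv_rcons j (IH _ dj _ _ _ rv' r2).
apply: rt_trans e1 _; apply: rt_trans _ (comm_equiv_sym e2).
apply: rt_step; exists a, [::], j, i; split.
  by split; [move=> e; move/eqP: ne; apply; apply: val_inj | split; apply/eqP; rewrite -cg_ord_succ].
by rewrite cats0 -!cats1 -!catA.
Qed.

End Braids.

(** * Braids that remove or add a triple *)

Section Flips.
Context (m : nat).
Local Notation n := m.+2.
Implicit Types (w g : int -> int) (p q x y z : int) (u v : seq 'I_n).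
Implicit Types (R : int -> int -> int -> bool).
Local Notation pos i := (Posz (nat_of_ord i)).
Local Notation letter := (letter m).

Lemma inv_max w g y z : aff m w g -> inv g y z ->
  exists2 x, inv g y x & forall t, inv g y t -> t <= x.
Proof.
move=> /aff_bounded[M B]; have [k] := ubnP (absz (y + M%:Z - z)%R).
elim: k z => // k IH z hk yz.
have [[t yt zt]|h] := pselect (exists2 t, inv g y t & z < t); last first.
  by exists z => // t yt; rewrite leNgt; apply/negP => zt; apply: h; exists t.
by apply: (IH t) => //; have := B _ _ yt; have := B _ _ yz; lia.
Qed.

Lemma inv_min w g y z : aff m w g -> inv g y z ->
  exists2 x, inv g x z & forall t, inv g t z -> x <= t.
Proof.
move=> /aff_bounded[M B]; have [k] := ubnP (absz (y - z + M%:Z)%R).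
elim: k y => // k IH y hk yz.
have [[t yt zt]|h] := pselect (exists2 t, inv g t z & t < y); last first.
  by exists y => // t yt; rewrite leNgt; apply/negP => zt; apply: h; exists t.
by apply: (IH t) => //; have := B _ _ yt; have := B _ _ yz; lia.
Qed.

Lemma removable_desc w g R x y : aff m w g -> cons3 m g R -> inv g x y ->
  exists p, w (p + 1) < w p /\ removable m g R p.
Proof.
move=> A C ixy; have [p [d G]] := removable_ex A C ixy.
by exists p; split=> //; exact: removable_at_translate A C G.
Qed.

Lemma pair_at_uniq_l w g p x y z : aff m w g -> pair_at m g p x z -> pair_at m g p y z -> x = y.
Proof.
move=> A /andP[/eqP e1 _] /andP[/eqP e2 _]; apply: (aff_inj A); lia.
Qed.

Lemma pair_at_uniq_r w g p x y z : aff m w g -> pair_at m g p x y -> pair_at m g p x z -> y = z.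
Proof.
move=> A /andP[/eqP e1 _] /andP[/eqP e2 _]; apply: (aff_inj A); lia.
Qed.

(** Removable crossings are split off as long as some triple of [R] survives; when none would, the
    position of the remaining triples is rigid enough to exhibit a braid, or a better crossing to
    split off. *)
Lemma flip_down_ex w g R x y z : aff m w g -> cons3 m g R -> R x y z ->
  exists a p b, realizes w g R (a ++ braid3 m p true ++ b).
Proof.
move=> A; move: w g A R x y z; apply: aff_ind => w g A IH R x y z C Rxyz.
have [ixy iyz] := andP (cons3_inv C Rxyz).
have step q x' y' z' : w (q + 1) < w q -> removable m g R q ->
    cut (sp m q \o g) R x' y' z' -> exists a p b, realizes w g R (a ++ braid3 m p true ++ b).
  move=> d G c; have [a [p [b r]]] := IH q d _ _ _ _ (cut_cons3 A C d G) c.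
  exists a, p, (rcons b (letter q)); rewrite -!rcons_cat.
  exact: realizes_rcons A C d G r.
have [p [d G]] := removable_desc A C ixy.
have [[x' [y' [z' c]]]|nc] := pselect (exists x y z, cut (sp m p \o g) R x y z).
  exact: step d G c.
(* If no triple survives, each triple of [R] contains the pair at p, and by removability only as its
   lower pair. *)
have Rt a b c : R a b c -> pair_at m g p a b.
  move=> r; have /andP[iab ibc] := cons3_inv C r.
  apply: contrapT => nt; apply: nc; exists a, b, c.
  rewrite /cut r !(inv_sp _ _ A d) iab ibc /=; apply/andP; split; first exact/negP.
  by apply/negP => t; have := (G _ _ a t).1 iab; rewrite r.
have txy := Rt _ _ _ Rxyz.
have /andP[/eqP gx cgy] := txy.
(* Among the lines to the left of y, Z has the largest number. If Z is next to y, the lines Z, y, x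
   form a braid. Otherwise the crossing of Z with its right neighbour is removable, and x, y, Z
   survives. *)
have [Z iyZ maxZ] := inv_max A iyz.
have [wK gK wS _] := A.
have rec t : g t < g y -> t <= Z.
  move=> gt; have [ty|yt] := lerP t y; first by move: iyZ; rewrite /inv; lia.
  by apply: maxZ; rewrite /inv yt.
have noZ t : inv g Z t -> False.
  by move=> i; have := rec t; move: i iyZ; rewrite /inv; lia.
have RZ : R x y Z := (G _ _ Z txy).2 iyZ.
pose k := g Z; have wk : w k = Z by rewrite /k gK.
have kp : k < g y by case/andP: iyZ.
have [kp1|kp1] := eqVneq (k + 1) (g y).
  have [||||||||||C3 S3] := @realizes_braid m w g R k x y Z A C wk.
  - by rewrite kp1 gK.
  - by rewrite kp1 -gx gK.
  - by case/andP: ixy.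
  - by case/andP: iyZ.
  - by move=> t; exact: (G _ _ t txy).1.
  - by move=> t i _; exact: (G _ _ t txy).2.
  - move=> t i; apply/negP => /Rt t'; by have := pair_at_disjoint y t'; rewrite txy.
  - by move=> t /noZ.
  - move=> t i tx; apply/negP => /Rt t'; by rewrite (pair_at_uniq_l A t' txy) eqxx in tx.
  - by move=> t /noZ.
  have [u ru] := realizes_ex (aff_sp k (aff_sp (k + 1) (aff_sp k A))) C3.
  by exists u, k, [::]; rewrite cats0; have := S3 u ru; rewrite RZ.
have qZ : w (k + 1) < w k.
  have h : g (w (k + 1)) < g y by rewrite wK; lia.
  have := rec _ h; rewrite wk le_eqVlt => /orP[/eqP e|//].
  by have := wK (k + 1); rewrite e -/k; lia.
apply: (step k x y Z qZ).
  apply: (removable_at_translate A C) => t; rewrite wk; split; last by move=> /noZ.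
  move=> i; apply/negP => /Rt /andP[_]; rewrite wK => c.
  (* Then the line just before y is a translate of Z with a larger number, against the choice of
     Z. *)
  have /cgP[e E] : cg m (k + 1) (g y) by apply: cg_trans c _; rewrite cg_sym.
  have := rec (w (g y - 1)); rewrite wK.
  have -> : g y - 1 = k + (- e) * n%:Z by move: E; clear; lia.
  by rewrite wS wk; move: E kp kp1; clear; lia.
rewrite /cut RZ !(inv_sp _ _ A qZ) ixy iyZ /=; apply/andP; split.
  apply/negP => /andP[_ /cgP[e E]].
  have : y = Z + e * n%:Z by rewrite -(gK y) E wS wk.
  by move: iyZ kp E; rewrite /inv; clear; lia.
by apply/negP => /andP[/eqP e _]; move: kp1; rewrite e eqxx.
Qed.

(** Mirror image of [flip_down_ex]: in the rigid case the missing triples have their upper pair at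
    p, and X is the smallest line to the right of y. *)
Lemma flip_up_ex w g R x y z : aff m w g -> cons3 m g R ->
  inv g x y -> inv g y z -> ~~ R x y z ->
  exists a p b, realizes w g R (a ++ braid3 m p false ++ b).
Proof.
move=> A; move: w g A R x y z; apply: aff_ind => w g A IH R x y z C ixy iyz Rxyz.
have step q x' y' z' : w (q + 1) < w q -> removable m g R q ->
    inv (sp m q \o g) x' y' -> inv (sp m q \o g) y' z' -> ~~ R x' y' z' ->
    exists a p b, realizes w g R (a ++ braid3 m p false ++ b).
  move=> d G i1 i2 c; have [|a [p [b r]]] := IH q d _ _ _ _ (cut_cons3 A C d G) i1 i2.
    by rewrite /cut (negbTE c).
  exists a, p, (rcons b (letter q)); rewrite -!rcons_cat.
  exact: realizes_rcons A C d G r.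
have [p [d G]] := removable_desc A C ixy.
have [[x' [y' [z' [i1 [i2 c]]]]]|nc] := pselect (exists x y z,
    inv (sp m p \o g) x y /\ inv (sp m p \o g) y z /\ ~~ R x y z).
  exact: step d G i1 i2 c.
have Rt a b c : inv g a b -> inv g b c -> ~~ R a b c -> pair_at m g p b c.
  move=> iab ibc r; apply: contrapT => nt; apply: nc; exists a, b, c.
  rewrite !(inv_sp _ _ A d) iab ibc r /=; split; last by split=> //; exact/negP.
  by apply/negP => t; move: r; rewrite (G _ _ c t).2.
have tyz := Rt _ _ _ ixy iyz Rxyz.
have /andP[/eqP gy cgz] := tyz.
have [X iXy minX] := inv_min A ixy.
have [wK gK wS _] := A.
have rec t : g y < g t -> X <= t.
  move=> gt; have [ty|yt] := lerP y t; first by move: iXy; rewrite /inv; lia.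
  by apply: minX; rewrite /inv yt.
have noX t : inv g t X -> False.
  by move=> i; have := rec t; move: i iXy; rewrite /inv; lia.
have RX : ~~ R X y z := (G _ _ X tyz).1 iXy.
pose k := g X - 1; have wk : w (k + 1) = X by rewrite /k subrK gK.
have kp : g y <= k by move: iXy; rewrite /k /inv; lia.
have [kp1|kp1] := eqVneq k (g y).
  have [|||||||||||C3 S3] := @realizes_braid m w g R (g z) X y z A C.
  - by rewrite gK.
  - by rewrite -gy gK.
  - by rewrite -gy -kp1.
  - by case/andP: iXy.
  - by case/andP: iyz.
  - by move=> t /noX.
  - move=> t i tz; apply: contraT => /(Rt _ _ _ iXy i) t'.
    by rewrite (pair_at_uniq_r A t' tyz) eqxx in tz.
  - by move=> t /noX.
  - move=> t i; apply: contraT => /(Rt _ _ _ (inv_trans iXy iyz) i) t'.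
    by have := pair_at_disjoint t tyz; rewrite t'.
  - by move=> t i _; exact: (G _ _ t tyz).1.
  - by move=> t; exact: (G _ _ t tyz).2.
  have [u ru] := realizes_ex (aff_sp (g z) (aff_sp (g z + 1) (aff_sp (g z) A))) C3.
  by exists u, (g z), [::]; rewrite cats0; have := S3 u ru; rewrite (negbTE RX).
have qX : w (k + 1) < w k.
  have h : g y < g (w k) by rewrite wK; lia.
  have := rec _ h; rewrite wk le_eqVlt => /orP[/eqP e|//].
  by have := wK k; rewrite -e /k; lia.
apply: (step k X y z qX) => //.
- apply: (removable_at_translate A C) => t; rewrite wk; split; first by move=> /noX.
  move=> i; apply: contraT => r.
  have iXq : inv g X (w k) by rewrite /inv wK -{1}wk qX /k; clear; lia.
  have /andP[/eqP e1 e2] := Rt _ _ _ iXq i r; rewrite wK in e1.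
  have /cgP[e E] : cg m (g t) (g z) by apply: cg_trans e2 _; rewrite cg_sym.
  have := rec (w (g y + 1)); rewrite wK.
  have -> : g y + 1 = k + 1 + (- e) * n%:Z by move: E e1 gy; clear; lia.
  by rewrite wS wk; move: E e1 gy kp kp1; clear; lia.
- rewrite (inv_sp _ _ A qX) iXy; apply/negP => /andP[/eqP e _].
  by move: kp1; rewrite /k e addrK eqxx.
- rewrite (inv_sp _ _ A qX) iyz; apply/negP => /andP[_ /cgP[e E]].
  have : y = X + e * n%:Z by rewrite -(gK y) gy E -wk -wS; congr w; lia.
  by move: iXy kp gy E; rewrite /k /inv; clear; lia.
Qed.

(** Letters are split off from both sets at once. One removable for [R2] is so for [R1] unless it
    sits at (x, y); one removable for [R1] is so for [R2] unless it sits at (y, z). If both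
    exceptions occur, then z, y, x are at consecutive positions, and the two sets end with the two
    sides of a braid after a common word. *)
Lemma cover_words w g R1 R2 x y z : aff m w g -> cons3 m g R1 -> cons3 m g R2 ->
  R2 x y z -> ~~ R1 x y z ->
  (forall a b c, R2 a b c = R1 a b c || (c3 m a b c == c3 m x y z)) ->
  exists a p b, realizes w g R1 (a ++ braid3 m p false ++ b) /\
    realizes w g R2 (a ++ braid3 m p true ++ b).
Proof.
move=> A; move: w g A R1 R2 x y z; apply: aff_ind => w g A IH R1 R2 x y z C1 C2 r2 r1 E.
have [ixy iyz] := andP (cons3_inv C2 r2).
have [wK gK wS _] := A.
have R12 a b c : R1 a b c -> R2 a b c by rewrite E => ->.
have R21 a b c : R2 a b c -> c3 m a b c <> c3 m x y z -> R1 a b c.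
  by rewrite E => /orP[//|/eqP].
have xyz a b c : c3 m a b c = c3 m x y z -> exists k,
    [/\ x = a + k * n%:Z, y = b + k * n%:Z & z = c + k * n%:Z].
  by move=> /c3_eqP.
have tpS q k a b : pair_at m g q (a + k * n%:Z) (b + k * n%:Z) = pair_at m g q a b.
  by apply/(pair_atP _ _ _ A)/(pair_atP _ _ _ A); rewrite c2_shift.
have step q : w (q + 1) < w q -> removable m g R1 q -> removable m g R2 q ->
    ~~ pair_at m g q x y -> ~~ pair_at m g q y z ->
    exists a p b, realizes w g R1 (a ++ braid3 m p false ++ b) /\
      realizes w g R2 (a ++ braid3 m p true ++ b).
  move=> d G1 G2 n1 n2.
  have i1 : inv (sp m q \o g) x y by rewrite (inv_sp _ _ A d) ixy.
  have i2 : inv (sp m q \o g) y z by rewrite (inv_sp _ _ A d) iyz.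
  have [|||a [p [b [rr1 rr2]]]] := IH q d _ _ x y z (cut_cons3 A C1 d G1) (cut_cons3 A C2 d G2).
  - by rewrite /cut r2 i1 i2.
  - by rewrite /cut (negbTE r1).
  - move=> a b c; rewrite /cut E; case: eqP => [e|_]; last by rewrite !orbF.
    have [k [ex ey ez]] := xyz _ _ _ e; rewrite !orbT /=.
    by move: i1 i2; rewrite ex ey ez !(inv_shift (aff_sp q A)) => -> ->.
  exists a, p, (rcons b (letter q)); rewrite -!rcons_cat.
  by split; apply: realizes_rcons => //; rewrite catA.
have [p [dp Gp]] := removable_desc A C2 ixy.
have np : ~~ pair_at m g p y z.
  by apply/negP => t; have := (Gp _ _ x t).1 ixy; rewrite r2.
have [tpxy|np'] := boolP (pair_at m g p x y); last first.
  apply: (step p) => // a b c t; have [h1 h2] := Gp a b c t; split=> i.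
    by apply: contra (h1 i); exact: R12.
  apply: R21 (h2 i) _ => /xyz[k [ex ey _]].
  by move: np'; rewrite ex ey tpS t.
have [q [dq Gq]] := removable_desc A C1 ixy.
have nq : ~~ pair_at m g q x y.
  by apply/negP => t; have := (Gq _ _ z t).2 iyz; rewrite (negbTE r1).
have [tqyz|nq'] := boolP (pair_at m g q y z); last first.
  apply: (step q) => // a b c t; have [h1 h2] := Gq a b c t; split=> i; last exact/R12/h2.
  apply/negP => r; have := h1 i; apply/negP; rewrite negbK; apply: R21 r _ => /xyz[k [_ ey ez]].
  by move: nq'; rewrite ey ez tpS t.
have /andP[/eqP gx _] := tpxy; have /andP[/eqP gy _] := tqyz.
(* A translate of the triple that shares one entry with it is the triple itself. *)
have eq3 a b c : c3 m a b c = c3 m x y z -> a = x \/ b = y \/ c = z ->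
    [/\ a = x, b = y & c = z].
  move=> /xyz[k [-> -> ->]] h; have k0 : k = 0 by move: h; clear; case=> [|[|]]; nia.
  by rewrite k0 mul0r !addr0.
have xy : x < y by case/andP: ixy.
have yz : y < z by case/andP: iyz.
have H1 t : inv g t x -> ~~ R2 t x y by exact: (Gp _ _ t tpxy).1.
have H1' t : inv g y t -> R2 x y t by exact: (Gp _ _ t tpxy).2.
have H3 t : inv g t y -> ~~ R1 t y z by exact: (Gq _ _ t tqyz).1.
have H3' t : inv g z t -> R1 y z t by exact: (Gq _ _ t tqyz).2.
have H1'' t : inv g y t -> t != z -> R1 x y t.
  move=> i tz; apply: R21 (H1' t i) _ => e.
  have [_ _ ez] := eq3 _ _ _ e (or_introl erefl).
  by rewrite ez eqxx in tz.
have H3'' t : inv g t y -> t != x -> ~~ R2 t y z.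
  move=> i tx; apply/negP => r; have := H3 t i; rewrite R21 // => e.
  have [ex _ _] := eq3 _ _ _ e (or_intror (or_introl erefl)).
  by rewrite ex eqxx in tx.
(* In the 4-packet t, x, y, z the bit of t, x, z lies between those of t, x, y and t, y, z, which
   are both 0. *)
have H2 t : inv g t x -> ~~ R2 t x z.
  move=> i; have := cons3_mono C2 i ixy iyz; have := H1 t i.
  have := H3'' t (inv_trans i ixy); rewrite r2 lt_eqF; last by case/andP: i.
  move=> /(_ isT); rewrite /mono.
  by case: (R2 t x y); case: (R2 t x z); case: (R2 t y z).
have H2' t : inv g z t -> R1 x z t.
  move=> i; have := cons3_mono C1 ixy iyz i; have := H3' t i.
  have := H1'' t (inv_trans iyz i); rewrite gt_eqF; last by case/andP: i.
  move=> /(_ isT); rewrite (negbTE r1) /mono.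
  by case: (R1 x y t); case: (R1 x z t); case: (R1 y z t).
have wz : w (g z) = z by rewrite gK.
have wy : w (g z + 1) = y by rewrite -gy gK.
have wx : w (g z + 1 + 1) = x by rewrite -gy -gx gK.
have [|||||| D1 S1] := @realizes_braid m w g R1 (g z) x y z A C1 wz wy wx xy yz.
- by move=> t /H1; apply: contra; exact: R12.
- exact: H1''.
- by move=> t /H2; apply: contra; exact: R12.
- exact: H2'.
- by move=> t /H3.
- exact: H3'.
have [|||||| D2 S2] := @realizes_braid m w g R2 (g z) x y z A C2 wz wy wx xy yz.
- exact: H1.
- by move=> t /H1'.
- exact: H2.
- by move=> t /H2'/R12.
- exact: H3''.
- by move=> t /H3'/R12.
have [u ru] := realizes_ex (aff_sp (g z) (aff_sp (g z + 1) (aff_sp (g z) A))) D1.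
exists u, (g z), [::]; rewrite !cats0.
have := S1 u ru; rewrite (negbTE r1) => h1; split; first exact: h1.
have := S2 u; rewrite r2; apply.
(* The sets differ only in x, y, z, and x, y are no longer inverted after the braid. *)
suff e : cut (sp m (g z) \o (sp m (g z + 1) \o (sp m (g z) \o g))) R2 =
    cut (sp m (g z) \o (sp m (g z + 1) \o (sp m (g z) \o g))) R1 by rewrite e.
apply: funext => a; apply: funext => b; apply: funext => c; rewrite /cut E.
case: eqP => [/xyz[k [ex ey _]]|_]; last by rewrite orbF.
set g3 := sp m (g z) \o _.
have A3 := aff_sp (g z) (aff_sp (g z + 1) (aff_sp (g z) A)).
have n3 : ~~ cg m (g z) (g z + 1 + 1) by apply: (desc2_cg A); rewrite wx wz (lt_trans xy yz).
have [e1 e2 e3 e4 [e5 e6]] := sp_braid_at n3.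
have : ~~ inv g3 x y.
  by rewrite /inv /g3 /= gx gy e2 e6 e4 e1 e3; clear; lia.
by rewrite ex ey (inv_shift A3) => /negbTE ->; rewrite /= !andbF.
Qed.

End Flips.

(** * From canonical lists to integers *)

Section Bridge.
Context (m : nat).
Local Notation n := m.+2.
Implicit Types (p q x y z : int) (X Y Z s : seq int) (rho : seq (seq int)).
Context (w g : int -> int) (A : aff m w g).

Lemma inv_condP X : inv_cond w X <->
  forall a b, (a < b < size X)%N -> g (nth 0 X b) < g (nth 0 X a).
Proof.
have [wK gK _ _] := A.
split=> [h a b ab|h a b p q ab e1 e2]; first by apply: (h a b); rewrite ?gK.
by have := h a b ab; rewrite -e1 -e2 !wK.
Qed.

Lemma mod_cg x y : (modz x n%:Z == modz y n%:Z) = cg m x y.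
Proof. by rewrite eqz_mod_dvd. Qed.

Lemma is_eltP k X : (1 < k)%N -> is_elt n k X <->
  [/\ size X = k, sorted (fun x y : int => x < y) X,
      pairwise (fun x y => ~~ cg m x y) X & 1 <= head 0 X <= n%:Z].
Proof.
move=> k1; rewrite /is_elt.
have -> : uniq [seq modz x n%:Z | x <- X] = pairwise (fun x y => ~~ cg m x y) X.
  rewrite uniq_pairwise pairwise_map; elim: X => //= x X ->; congr (_ && _).
  by apply: eq_all => y /=; rewrite mod_cg.
split=> [[h1 [h2 [h3 h4]]]|[h1 h2 h3 h4]]; first by split=> //; exact: h4.
by split=> //; split=> //; split.
Qed.

(** Distinctness mod n comes for free because congruent lines are parallel. *)
Lemma InvP k X : (1 < k)%N -> Inv n k w X <->
  [/\ size X = k, sorted (inv g) X & 1 <= head 0 X <= n%:Z].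
Proof.
move=> k1; rewrite /Inv is_eltP // inv_condP.
have tr : ssrbool.transitive (inv g) := @inv_trans g.
split=> [[[h1 h2 h3 h4] h5]|[h1 h2 h3]].
  split=> //; apply/(sortedP 0) => i hi; move/(sortedP 0): h2 => /(_ i hi) h.
  by rewrite /inv h h5 // leqnn.
have h2' := h2; rewrite sorted_pairwise // in h2'.
split; first split=> //.
- by apply: sub_sorted h2 => x y /andP[].
- by apply: sub_pairwise h2' => x y; exact: inv_cg A.
- move=> a b /andP[ab bX]; have /andP[_ //] : inv g (nth 0 X a) (nth 0 X b).
  by move/(pairwiseP 0): h2'; apply => //; rewrite inE (ltn_trans ab).
Qed.

Lemma sorted_shift k s : sorted (inv g) (shift m k s) = sorted (inv g) s.
Proof.
rewrite sorted_map; apply: eq_sorted => x y /=; exact: inv_shift A k x y.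
Qed.

Lemma Inv_canon k s : (1 < size s)%N ->
  Inv n k w (canon n s) <-> size s = k /\ sorted (inv g) s.
Proof.
move=> s1; have [l [e h]] := canonE m s1.
split=> [i|[sk so]].
  have k1 : (1 < k)%N by case: i => -[sk _] _; rewrite -sk e size_map.
  by have [] := (InvP _ k1).1 i; rewrite e size_map sorted_shift.
by apply/InvP; rewrite -?sk //; split=> //; rewrite e ?size_map ?sorted_shift.
Qed.

Lemma Inv_canon_id k X : (1 < k)%N -> Inv n k w X -> canon n X = X.
Proof. by move=> k1 /(InvP _ k1)[_ _]; exact: canon_id. Qed.

Lemma Inv2_c2 x y : Inv n 2 w (c2 m x y) <-> inv g x y.
Proof. by rewrite /c2 Inv_canon //= andbT; split=> [[]|]. Qed.

Lemma Inv3_c3 x y z : Inv n 3 w (c3 m x y z) <-> inv g x y && inv g y z.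
Proof. by rewrite /c3 Inv_canon //= andbT; split=> [[]|]. Qed.

Definition c4 (x y z t : int) := canon n [:: x; y; z; t].

Lemma Inv4_c4 x y z t : Inv n 4 w (c4 x y z t) <-> [&& inv g x y, inv g y z & inv g z t].
Proof. by rewrite /c4 Inv_canon //= andbT; split=> [[]|]. Qed.

Lemma Inv2_ex X : Inv n 2 w X -> exists x y, X = c2 m x y /\ inv g x y.
Proof.
move=> i; have e := @Inv_canon_id 2 _ isT i; have [] := (@InvP 2 X isT).1 i.
move: X i e => [|x [|y [|]]] //= _ e _; rewrite andbT => h _; exists x, y.
by rewrite /c2 e.
Qed.

Lemma Inv3_ex X : Inv n 3 w X -> exists x y z, X = c3 m x y z /\ inv g x y /\ inv g y z.
Proof.
move=> i; have e := @Inv_canon_id 3 _ isT i; have [] := (@InvP 3 X isT).1 i.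
move: X i e => [|x [|y [|z [|]]]] //= _ e _; rewrite andbT => /andP[h1 h2] _; exists x, y, z.
by rewrite /c3 e.
Qed.

Lemma Inv4_ex X : Inv n 4 w X -> exists x y z t,
  X = c4 x y z t /\ [&& inv g x y, inv g y z & inv g z t].
Proof.
move=> i; have e := @Inv_canon_id 4 _ isT i; have [] := (@InvP 4 X isT).1 i.
move: X i e => [|x [|y [|z [|t [|]]]]] //= _ e _; rewrite andbT => h _; exists x, y, z, t.
by rewrite /c4 e.
Qed.

Lemma pk_canon s j : (2 < size s)%N -> pk n (canon n s) j = canon n (take j s ++ drop j.+1 s).
Proof.
move=> hs; have [k [-> _]] := @canonE m s (ltnW hs).
rewrite /pk /shift -map_take -map_drop -map_cat; apply: canon_shift.
rewrite size_cat size_take size_drop; case: (ltnP j (size s)); lia.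
Qed.

Lemma shiftv_canon s i : (1 < size s)%N ->
  shiftv n (canon n s) i = canon n (take i s ++ [seq x + n%:Z | x <- drop i s]).
Proof.
move=> hs; have [k [-> _]] := canonE m hs.
rewrite /shiftv /shift -map_take -map_drop -map_comp.
rewrite -[RHS](@canon_shift m k); last first.
  by rewrite size_cat size_map -size_cat cat_take_drop.
rewrite /shift map_cat -map_comp; congr (canon _ (_ ++ _)).
by apply: eq_map => x /=; lia.
Qed.

Lemma antilex_c3 x y z : antilex n (c3 m x y z) = [:: c2 m y z; c2 m x z; c2 m x y].
Proof.
have [k [e _]] := @canonE m [:: x; y; z] isT.
have sz : size (c3 m x y z) = 3 by rewrite /c3 e.
by rewrite /antilex sz /mkseq /= /c3 !pk_canon.
Qed.

Lemma antilex_c4 x y z t : antilex n (c4 x y z t) =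
  [:: c3 m y z t; c3 m x z t; c3 m x y t; c3 m x y z].
Proof.
have [k [e _]] := @canonE m [:: x; y; z; t] isT.
have sz : size (c4 x y z t) = 4 by rewrite /c4 e.
by rewrite /antilex sz /mkseq /= /c4 !pk_canon.
Qed.

Lemma lex_c3 x y z : lex n (c3 m x y z) = [:: c2 m x y; c2 m x z; c2 m y z].
Proof. by rewrite /lex antilex_c3. Qed.

Lemma lex_c4 x y z t : lex n (c4 x y z t) =
  [:: c3 m x y z; c3 m x y t; c3 m x z t; c3 m y z t].
Proof. by rewrite /lex antilex_c4. Qed.

Lemma pair_inv_canon s a b : (1 < size s)%N -> (a < b < size s)%N ->
  pair_inv w (canon n s) a b <-> g (nth 0 s b) < g (nth 0 s a).
Proof.
move=> s1 /andP[ab bs]; have [k [-> _]] := canonE m s1.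
rewrite /pair_inv inv_condP /shift !(nth_map 0) //; last exact: ltn_trans bs.
split=> [/(_ 0%N 1%N isT)|h a' b' ab']; first by rewrite /= !(aff_shiftg A) ltrD2r.
have [-> ->] : a' = 0%N /\ b' = 1%N by move: ab' => /=; lia.
by rewrite /= !(aff_shiftg A) ltrD2r.
Qed.

Lemma elt_ex k X : (1 < k)%N -> is_elt n k X -> canon n X = X.
Proof. by move=> k1 /(is_eltP _ k1)[_ _ _]; exact: canon_id. Qed.

Lemma is_elt_canon k s : (1 < size s)%N -> size s = k ->
  sorted (fun x y : int => x < y) s -> pairwise (fun x y => ~~ cg m x y) s ->
  is_elt n k (canon n s).
Proof.
move=> s1 sk so pw; apply/is_eltP; first by rewrite -sk.
have [l [e h]] := canonE m s1; split=> //; rewrite e.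
- by rewrite size_map.
- by rewrite sorted_map; apply: sub_sorted so => x y /=; lia.
- by rewrite pairwise_map; apply: sub_pairwise pw => x y /=; rewrite cg_addr.
Qed.

(* The generating relations of the permanent posets, in terms of integers that
   may be congruent mod n: the congruence relations are the instances where the
   two non-inverted integers are congruent. *)
Lemma Pgen2P Y Z : Pgen n 2 w Y Z ->
  [\/ Y = Z,
    exists x1 x2 x3, [/\ x1 < x2, g x1 < g x2, inv g x1 x3, inv g x2 x3 &
      Y = c2 m x2 x3 /\ Z = c2 m x1 x3] |
    exists x1 x2 x3, [/\ x2 < x3, g x2 < g x3, inv g x1 x2, inv g x1 x3 &
      Y = c2 m x1 x2 /\ Z = c2 m x1 x3]].
Proof.
case=> [[X [k [[E _] [k2 [I O]]]]]|[X [i [i2 [I1 [I2 O]]]]]].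
  have eX := @elt_ex 3 _ isT E; move: E => /(@is_eltP 3 _ isT)[].
  move: X eX I O => [|x1 [|x2 [|x3 [|]]]] // eX I O _ /= /andP[l12 /andP[l23 _]] _ _.
  rewrite -eX in I O.
  rewrite !pk_canon // in O.
  case: k k2 I O => [|[|//]] _ I /= [-> ->].
    constructor 2; exists x1, x2, x3.
    have i23 : inv g x2 x3 by apply/Inv2_c2; move: (I 0%N isT).2; rewrite pk_canon //=; apply; left.
    have i13 : inv g x1 x3 by apply/Inv2_c2; move: (I 1%N isT).2; rewrite pk_canon //=; apply; right.
    split=> //; rewrite (noninv A l12); apply/negP => /Inv2_c2 h.
    by move: (I 2%N isT).1; rewrite pk_canon //= => /(_ h)[].
  constructor 3; exists x1, x2, x3.
  have i13 : inv g x1 x3 by apply/Inv2_c2; move: (I 1%N isT).2; rewrite pk_canon //=; apply; left.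
  have i12 : inv g x1 x2 by apply/Inv2_c2; move: (I 2%N isT).2; rewrite pk_canon //=; apply; right.
  split=> //; rewrite (noninv A l23); apply/negP => /Inv2_c2 h.
  by move: (I 0%N isT).1; rewrite pk_canon //= => /(_ h)[].
have [x1 [x2 [e h]]] := Inv2_ex I1; rewrite e /c2 shiftv_canon // in I2 O.
case: i i2 I2 O => [|[|//]] _ I2 /= [-> ->].
  by constructor 1; rewrite -[RHS]/(c2 m x1 x2) -(c2_shift m 1) !mul1r.
constructor 3; exists x1, x2, (x2 + n%:Z).
split=> //; [lia| |by apply/Inv2_c2].
by rewrite -[n%:Z]mul1r (aff_shiftg A); lia.
Qed.

Lemma Pgen3P Y Z : Pgen n 3 w Y Z ->
  [\/ Y = Z,
    exists x1 x2 x3 x4, [/\ x1 < x2, g x1 < g x2, inv g x1 x3, inv g x2 x3 &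
      [/\ inv g x3 x4, Y = c3 m x1 x3 x4 & Z = c3 m x2 x3 x4]],
    exists x1 x2 x3 x4, [/\ x2 < x3, g x2 < g x3, inv g x1 x2, inv g x1 x3 &
      [/\ inv g x2 x4, inv g x3 x4, Y = c3 m x1 x3 x4 & Z = c3 m x1 x2 x4]] |
    exists x1 x2 x3 x4, [/\ x3 < x4, g x3 < g x4, inv g x1 x2, inv g x2 x3 &
      [/\ inv g x2 x4, Y = c3 m x1 x2 x3 & Z = c3 m x1 x2 x4]]].
Proof.
case=> [[X [k [[E _] [k2 [I O]]]]]|[X [i [i2 [I1 [I2 O]]]]]].
  have eX := @elt_ex 4 _ isT E; move: E => /(@is_eltP 4 _ isT)[].
  move: X eX I O => [|x1 [|x2 [|x3 [|x4 [|]]]]] // eX I O _ /= /and4P[l12 l23 l34 _] _ _.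
  rewrite -eX in I O.
  rewrite !pk_canon // in O.
  have {}I j : (j < 4)%N -> Inv n 3 w (canon n (take j [:: x1; x2; x3; x4] ++ drop j.+1 [:: x1; x2; x3; x4]))
      <-> j = k \/ j = k.+1 by move=> h; rewrite -pk_canon //; exact: I.
  have I0 := I 0%N isT; have I1 := I 1%N isT; have I2 := I 2%N isT; have I3 := I 3%N isT.
  rewrite /= !Inv3_c3 {I} in I0 I1 I2 I3 *.
  case: k k2 I0 I1 I2 I3 O => [|[|[|//]]] _ I0 I1 I2 I3 /= [-> ->].
  - have /andP[i23 i34] := I0.2 (or_introl erefl); have /andP[i13 _] := I1.2 (or_intror erefl).
    constructor 2; exists x1, x2, x3, x4; split=> //; rewrite (noninv A l12); apply/negP => i12.
    by have := I3.1; rewrite i12 i23 => /(_ isT)[].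
  - have /andP[i13 i34] := I1.2 (or_introl erefl); have /andP[i12 i24] := I2.2 (or_intror erefl).
    constructor 3; exists x1, x2, x3, x4; split=> //; rewrite (noninv A l23); apply/negP => i23.
    by have := I0.1; rewrite i23 i34 => /(_ isT)[].
  - have /andP[i12 i24] := I2.2 (or_introl erefl); have /andP[_ i23] := I3.2 (or_intror erefl).
    constructor 4; exists x1, x2, x3, x4; split=> //; rewrite (noninv A l34); apply/negP => i34.
    by have := I0.1; rewrite i23 i34 => /(_ isT)[].
have [x1 [x2 [x3 [e [i12 i23]]]]] := Inv3_ex I1; rewrite e /c3 shiftv_canon // in I2 O.
have gS x : g (x + n%:Z) = g x + n%:Z by rewrite -[X in x + X]mul1r (aff_shiftg A) mul1r.
(* Shifting all entries changes nothing; shifting the last two is, up to translation, lowering the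
   first; shifting the last is the third kind. *)
case: i i2 I2 O => [|[|[|//]]] _ I2 /= [-> ->].
- by constructor 1; rewrite -[LHS]/(c3 m x1 x2 x3) -(c3_shift m 1) !mul1r.
- constructor 2; exists (x1 - n%:Z), x1, x2, x3.
  have gM : g (x1 - n%:Z) = g x1 - n%:Z by rewrite -[X in _ = g X - _](subrK n%:Z) gS addrK.
  have -> : canon n [:: x1; x2 + n%:Z; x3 + n%:Z] = c3 m (x1 - n%:Z) x2 x3.
    by rewrite -(c3_shift m 1) !mul1r subrK.
  split=> //; try lia.
  have /Inv3_c3/andP[h _] := I2; move: h; rewrite /inv gS gM; lia.
- constructor 4; exists x1, x2, x3, (x3 + n%:Z).
  by have /Inv3_c3/andP[_ h] := I2; split=> //; rewrite ?gS; lia.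
Qed.

End Bridge.

(** * Order conditions on integers as relations of the permanent posets *)

Section Permanent.
Context (m : nat).
Local Notation n := m.+2.
Implicit Types (p q x y z : int) (X Y Z s : seq int) (rho : seq (seq int)).
Context (w g : int -> int) (A : aff m w g).

Lemma quasi_intro k s a b : (1 < size s)%N -> size s = k ->
  sorted (fun x y : int => x < y) s -> pairwise (fun x y => ~~ cg m x y) s ->
  (a < b < k)%N -> g (nth 0 s a) < g (nth 0 s b) ->
  (forall a' b', (a' < b' < k)%N -> a' <> a \/ b' <> b -> g (nth 0 s b') < g (nth 0 s a')) ->
  quasi_inv n k w (canon n s).
Proof.
move=> s1 <- so pw ab gab h; split; first exact: is_elt_canon.
exists a, b; split=> //; split.
  by rewrite (pair_inv_canon A) // => h'; lia.
move=> a' b' ab' np; apply: contrapT => /not_andP ne; apply: np.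
by apply/(pair_inv_canon A) => //; exact: h.
Qed.

Lemma cg_lt x y : x < y -> cg m x y -> exists k : nat, y = x + k%:Z * n%:Z.
Proof.
move=> xy /cgP[c e]; exists (absz c); have c0 : c <= 0 by nia.
by rewrite e abszE ler0_norm //; lia.
Qed.

Lemma lt3P (P : nat -> nat -> Prop) : P 0 1 -> P 0 2 -> P 1 2 ->
  forall a b, (a < b < 3)%N -> P a b.
Proof. by move=> ? ? ? [|[|[|a]]] [|[|[|b]]]; rewrite ?ltnS ?andbF. Qed.

Lemma lt4P (P : nat -> nat -> Prop) :
  P 0 1 -> P 0 2 -> P 0 3 -> P 1 2 -> P 1 3 -> P 2 3 ->
  forall a b, (a < b < 4)%N -> P a b.
Proof. by move=> ? ? ? ? ? ? [|[|[|[|a]]]] [|[|[|[|b]]]]; rewrite ?ltnS ?andbF. Qed.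

(** A path of c congruence relations. The intermediate pairs are inverted: their larger entry is at
    least the first one, and its position is at most the final one. *)
Lemma Ple2_add (c : nat) x y : inv g x y -> inv g x (y + c%:Z * n%:Z) ->
  Ple n 2 w (c2 m x y) (c2 m x (y + c%:Z * n%:Z)).
Proof.
elim: c => [|c IH] ixy; first by rewrite mul0r addr0 => _; exact: rt_refl.
move=> ic; have ic' : inv g x (y + c%:Z * n%:Z).
  by move: ixy ic; rewrite /inv !(aff_shiftg A); lia.
apply: rt_trans (IH ixy ic') _; apply: rt_step; right.
have e : shiftv n (c2 m x (y + c%:Z * n%:Z)) 1 = c2 m x (y + c.+1%:Z * n%:Z).
  by rewrite /c2 shiftv_canon //=; congr (canon _ [:: _; _]); lia.
exists (c2 m x (y + c%:Z * n%:Z)), 1%N; rewrite e /=.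
by split=> //; split; [exact/(Inv2_c2 A) | split => //; exact/(Inv2_c2 A)].
Qed.

(** For incongruent x1, x2 this is a quasi-inversion relation. If they are k periods apart,
    translation turns the shift of the first entry into a shift of the second. *)
Lemma Ple2_12 x1 x2 x3 : x1 < x2 -> g x1 < g x2 -> inv g x1 x3 -> inv g x2 x3 ->
  Ple n 2 w (c2 m x2 x3) (c2 m x1 x3).
Proof.
move=> l12 l12' i13 i23; have [/(cg_lt l12)[k e]|nc] := boolP (cg m x1 x2).
  have -> : c2 m x2 x3 = c2 m x1 (x3 - k%:Z * n%:Z) by rewrite -(c2_shift m k%:Z x1) subrK -e.
  have := @Ple2_add k x1 (x3 - k%:Z * n%:Z); rewrite subrK; apply=> //.
  by move: i23; rewrite e -{1}[x3](subrK (k%:Z * n%:Z)) (inv_shift A).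
apply: rt_step; left; exists (c3 m x1 x2 x3), 0%N.
have n13 := inv_cg A i13; have n23 := inv_cg A i23.
move: i13 i23 => /andP[l13 h13] /andP[l23 h23].
split; first apply: (@quasi_intro 3 [:: x1; x2; x3] 0 1) => //=.
- by rewrite l12 l23.
- by rewrite nc n13 n23.
- by apply: lt3P => //= -[].
split=> //; split; last by rewrite /= /c3 !pk_canon.
move=> [|[|[|]]] // _; rewrite /c3 pk_canon //=.
- by split=> [|_]; [left | apply/(Inv2_c2 A); rewrite /inv l23].
- by split=> [|_]; [right | apply/(Inv2_c2 A); rewrite /inv l13].
- by split=> [/(Inv2_c2 A)|[]//]; rewrite /inv; lia.
Qed.

Lemma Ple2_23 x1 x2 x3 : x2 < x3 -> g x2 < g x3 -> inv g x1 x2 -> inv g x1 x3 ->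
  Ple n 2 w (c2 m x1 x2) (c2 m x1 x3).
Proof.
move=> l23 l23' i12 i13; have [/(cg_lt l23)[k e]|nc] := boolP (cg m x2 x3).
  by rewrite e in i13 *; exact: Ple2_add.
apply: rt_step; left; exists (c3 m x1 x2 x3), 1%N.
have n13 := inv_cg A i13; have n12 := inv_cg A i12.
move: i13 i12 => /andP[l13 h13] /andP[l12 h12].
split; first apply: (@quasi_intro 3 [:: x1; x2; x3] 1 2) => //=.
- by rewrite l12 l23.
- by rewrite nc n13 n12.
- by apply: lt3P => //= -[].
split=> //; split; last by rewrite /= /c3 !pk_canon.
move=> [|[|[|]]] // _; rewrite /c3 pk_canon //=.
- by split=> [/(Inv2_c2 A)|[]//]; rewrite /inv; lia.
- by split=> [|_]; [left | apply/(Inv2_c2 A); rewrite /inv l13].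
- by split=> [|_]; [right | apply/(Inv2_c2 A); rewrite /inv l12].
Qed.

Lemma Ple3_12_add (c : nat) x1 x3 x4 : inv g x1 x3 -> inv g (x1 + c%:Z * n%:Z) x3 ->
  inv g x3 x4 -> Ple n 3 w (c3 m x1 x3 x4) (c3 m (x1 + c%:Z * n%:Z) x3 x4).
Proof.
elim: c => [|c IH] i13; first by rewrite mul0r addr0 => _ _; exact: rt_refl.
move=> ic i34; have ic' : inv g (x1 + c%:Z * n%:Z) x3.
  by move: i13 ic; rewrite /inv !(aff_shiftg A); lia.
apply: rt_trans (IH i13 ic' i34) _; apply: rt_step; right.
have e : shiftv n (c3 m (x1 + c.+1%:Z * n%:Z) x3 x4) 1 = c3 m (x1 + c%:Z * n%:Z) x3 x4.
  rewrite {1}/c3 shiftv_canon //= -[RHS](c3_shift m 1) mul1r.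
  by congr (canon _ [:: _; _; _]); lia.
exists (c3 m (x1 + c.+1%:Z * n%:Z) x3 x4), 1%N; rewrite e /=.
by split=> //; split; [apply/(Inv3_c3 A) | split => //; apply/(Inv3_c3 A)]; apply/andP.
Qed.

Lemma Ple3_34_add (c : nat) x1 x2 x3 : inv g x1 x2 -> inv g x2 x3 ->
  inv g x2 (x3 + c%:Z * n%:Z) ->
  Ple n 3 w (c3 m x1 x2 x3) (c3 m x1 x2 (x3 + c%:Z * n%:Z)).
Proof.
move=> i12 i23; elim: c => [|c IH]; first by rewrite mul0r addr0 => _; exact: rt_refl.
move=> ic; have ic' : inv g x2 (x3 + c%:Z * n%:Z).
  by move: i23 ic; rewrite /inv !(aff_shiftg A); lia.
apply: rt_trans (IH ic') _; apply: rt_step; right.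
have e : shiftv n (c3 m x1 x2 (x3 + c%:Z * n%:Z)) 2 = c3 m x1 x2 (x3 + c.+1%:Z * n%:Z).
  by rewrite {1}/c3 shiftv_canon //=; congr (canon _ [:: _; _; _]); lia.
exists (c3 m x1 x2 (x3 + c%:Z * n%:Z)), 2%N; rewrite e /=.
by split=> //; split; [apply/(Inv3_c3 A) | split => //; apply/(Inv3_c3 A)]; apply/andP.
Qed.

(** The parity [2 - k] is m - i for m = 3 and the one-based index i = k + 1. *)
Lemma Ple3_quasi k x1 x2 x3 x4 (s := [:: x1; x2; x3; x4]) (X := c4 m x1 x2 x3 x4) :
  (k < 3)%N -> x1 < x2 -> x2 < x3 -> x3 < x4 ->
  ~~ cg m (nth 0 s k) (nth 0 s k.+1) -> g (nth 0 s k) < g (nth 0 s k.+1) ->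
  (forall a b, (a < b < 4)%N -> (a != k) || (b != k.+1) -> inv g (nth 0 s a) (nth 0 s b)) ->
  if odd (2 - k) then Ple n 3 w (pk n X k) (pk n X k.+1)
  else Ple n 3 w (pk n X k.+1) (pk n X k).
Proof.
move=> k3 l12 l23 l34 nc gk I.
have pw a b : (a < b < 4)%N -> ~~ cg m (nth 0 s a) (nth 0 s b).
  move=> ab; have [/(I a b ab)/(inv_cg A)//|] := boolP ((a != k) || (b != k.+1)).
  by rewrite negb_or !negbK => /andP[/eqP -> /eqP ->].
have I' a b : (a < b < 4)%N -> inv g (nth 0 s a) (nth 0 s b) = (a != k) || (b != k.+1).
  move=> ab; apply/idP/idP; last exact: I.
  by rewrite -negb_and; apply: contraTN => /andP[/eqP -> /eqP ->]; rewrite /inv; lia.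
have Q : quasi_inv n 4 w X.
  apply: (@quasi_intro 4 s k k.+1) => //=; first by rewrite l12 l23 l34.
  - by rewrite (pw 0 1)%N ?(pw 0 2)%N ?(pw 0 3)%N ?(pw 1 2)%N ?(pw 1 3)%N ?(pw 2 3)%N.
  - by lia.
  - move=> a b ab ne; have : (a != k) || (b != k.+1) by lia.
    by case/(I a b ab)/andP.
have main : forall j, (j < 4)%N -> Inv n 3 w (pk n X j) <-> j = k \/ j = k.+1.
  have := (I' 0 1 isT, I' 0 2 isT, I' 0 3 isT, I' 1 2 isT, I' 1 3 isT, I' 2 3 isT)%N => /= E.
  move=> [|[|[|[|]]]] // _; rewrite /X /c4 pk_canon //= -/(c3 m _ _ _) (Inv3_c3 A) !E; lia.
have step Y Z : (if odd (3 - k.+1) then Y = pk n X k /\ Z = pk n X k.+1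
    else Y = pk n X k.+1 /\ Z = pk n X k) -> Ple n 3 w Y Z.
  by move=> h; apply: rt_step; left; exists X, k.
by move: step; rewrite subSS; case: odd => step; apply: step.
Qed.

Lemma Ple3_12 x1 x2 x3 x4 : x1 < x2 -> g x1 < g x2 -> inv g x1 x3 -> inv g x2 x3 ->
  inv g x3 x4 -> Ple n 3 w (c3 m x1 x3 x4) (c3 m x2 x3 x4).
Proof.
move=> l12 l12' i13 i23 i34; have [/(cg_lt l12)[k e]|nc] := boolP (cg m x1 x2).
  by rewrite e in i23 *; exact: Ple3_12_add.
have i14 := inv_trans i13 i34; have i24 := inv_trans i23 i34.
have := @Ple3_quasi 0 x1 x2 x3 x4; rewrite /= /c4 !pk_canon //=; apply=> //;
  [by case/andP: i23|by case/andP: i34|exact: lt4P].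
Qed.

Lemma Ple3_34 x1 x2 x3 x4 : x3 < x4 -> g x3 < g x4 -> inv g x1 x2 -> inv g x2 x3 ->
  inv g x2 x4 -> Ple n 3 w (c3 m x1 x2 x3) (c3 m x1 x2 x4).
Proof.
move=> l34 l34' i12 i23 i24; have [/(cg_lt l34)[k e]|nc] := boolP (cg m x3 x4).
  by rewrite e in i24 *; exact: Ple3_34_add.
have i13 := inv_trans i12 i23; have i14 := inv_trans i12 i24.
have := @Ple3_quasi 2 x1 x2 x3 x4; rewrite /= /c4 !pk_canon //=; apply=> //;
  [by case/andP: i12|by case/andP: i23|exact: lt4P].
Qed.

(** No congruence relation moves the middle entry alone. For x3 = x2 + d, moving it down by d is, up
    to translation, moving both outer entries up by d, one after the other. *)
Lemma Ple3_23 x1 x2 x3 x4 : x2 < x3 -> g x2 < g x3 -> inv g x1 x2 -> inv g x1 x3 ->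
  inv g x2 x4 -> inv g x3 x4 -> Ple n 3 w (c3 m x1 x3 x4) (c3 m x1 x2 x4).
Proof.
move=> l23 l23' i12 i13 i24 i34; have [/(cg_lt l23)[k e]|nc] := boolP (cg m x2 x3).
  have gS := aff_shiftg A; pose d := k%:Z * n%:Z.
  have gM x : g (x - d) = g x - d by rewrite -{2}[x](subrK d) gS addrK.
  have -> : c3 m x1 x3 x4 = c3 m (x1 - d) x2 (x4 - d).
    by rewrite -[RHS](c3_shift m k%:Z) -/d !subrK e.
  have i24' : inv g x2 (x4 - d) by move: i34; rewrite e -[x4](subrK d) (inv_shift A) addrK.
  apply: (@rt_trans _ _ _ (c3 m x1 x2 (x4 - d))).
    apply: Ple3_12 => //; rewrite ?gM; try by rewrite /d; lia.
    by move: i13; rewrite e -[x1](subrK d) (inv_shift A) addrK.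
  by apply: Ple3_34; rewrite ?gM //; rewrite /d; lia.
have i14 := inv_trans i12 i24.
have := @Ple3_quasi 1 x1 x2 x3 x4; rewrite /= /c4 !pk_canon //=; apply=> //;
  [by case/andP: i12|by case/andP: i34|exact: lt4P].
Qed.

End Permanent.

(** * Consistent sets of triples in terms of integers *)

Section Admissible.
Context (m : nat).
Local Notation n := m.+2.
Implicit Types (p q x y z : int) (X Y Z s : seq int) (rho : seq (seq int)).
Implicit Types (Rp : seq int -> Prop).
Context (w g : int -> int) (A : aff m w g).

Definition toR Rp x y z := `[< Rp (c3 m x y z) >].

Lemma mem_take_nth (T : eqType) (x0 : T) (r : seq T) i j : uniq r -> (i < size r)%N ->
  (nth x0 r i \in take j r) = (i < j)%N.
Proof. by move=> U h; rewrite in_take ?mem_nth // index_uniq. Qed.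

Lemma mem_take_uniq3 (T : eqType) (a b c : T) j (s := [:: a; b; c]) : uniq s ->
  [/\ (a \in take j s) = (0 < j)%N, (b \in take j s) = (1 < j)%N &
      (c \in take j s) = (2 < j)%N].
Proof.
move=> U; have I i := @mem_take_nth _ a s i j U.
by split; [exact: (I 0%N)|exact: (I 1%N)|exact: (I 2%N)].
Qed.

Lemma mem_take_uniq4 (T : eqType) (a b c d : T) j (s := [:: a; b; c; d]) : uniq s ->
  [/\ (a \in take j s) = (0 < j)%N, (b \in take j s) = (1 < j)%N,
      (c \in take j s) = (2 < j)%N & (d \in take j s) = (3 < j)%N].
Proof.
move=> U; have I i := @mem_take_nth _ a s i j U.
by split; [exact: (I 0%N)|exact: (I 1%N)|exact: (I 2%N)|exact: (I 3%N)].
Qed.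

Lemma c3_packet_uniq x y z t : inv g x y -> inv g y z -> inv g z t ->
  uniq [:: c3 m x y z; c3 m x y t; c3 m x z t; c3 m y z t].
Proof.
move=> xy yz zt; have nxy := inv_cg A xy.
have k0 (k : int) a : a = a + k * n%:Z -> k = 0 by nia.
have ncg k : y <> x + k * n%:Z by move=> e; case/negP: nxy; rewrite cg_sym; apply/cgP; exists k.
move: xy yz zt => /andP[xy _] /andP[yz _] /andP[zt _].
rewrite /= !inE !negb_or andbT -!andbA; apply/and5P; split; last (apply/andP; split);
  apply/eqP => /c3_eqP[k [e1 e2 e3]]; try (by move: (ncg k)); have := k0 _ _ e1; try (have := k0 _ _ e3); nia.
Qed.

(** The ideal condition becomes the three q-conditions, by [Ple3_12], [Ple3_23], [Ple3_34] in one
    direction and [Pgen3P] in the other; the condition on 4-packets becomes [mono]. *)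
Lemma consistent3P Rp : consistent n 3 w Rp <->
  (forall X, Rp X -> Inv n 3 w X) /\ cons3 m g (toR Rp).
Proof.
have I3 x y z : inv g x y -> inv g y z -> Inv n 3 w (c3 m x y z).
  by move=> h1 h2; apply/(Inv3_c3 A); rewrite h1.
split=> [[sub [ideal pack]]|[sub C]].
  split=> //; split.
  - by move=> x y z /asboolP /sub /(Inv3_c3 A).
  - by move=> k x y z; rewrite /toR c3_shift.
  - move=> x1 x2 x3 x4 l12 l12' i13 i23 i34 /asboolP r; apply/asboolP.
    by apply: ideal r _ _; [exact: I3 | exact: (Ple3_12 A)].
  - move=> x1 x2 x3 x4 l23 l23' i12 i13 i24 i34 /asboolP r; apply/asboolP.
    by apply: ideal r _ _; [exact: I3 | exact: (Ple3_23 A)].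
  - move=> x1 x2 x3 x4 l34 l34' i12 i23 i24 /asboolP r; apply/asboolP.
    by apply: ideal r _ _; [exact: I3 | exact: (Ple3_34 A)].
  - move=> x1 x2 x3 x4 i12 i23 i34.
    have [|j h] := pack (c4 m x1 x2 x3 x4); first by apply/(Inv4_c4 A); rewrite i12 i23.
    have U := c3_packet_uniq i12 i23 i34.
    rewrite lex_c4 antilex_c4 in h.
    case: h => h; rewrite /mono /toR.
      have [e1 e2 e3 e4] := mem_take_uniq4 j U.
      rewrite !(asbool_equiv_eq (h _ _)) ?inE ?eqxx ?orbT // !asboolb e1 e2 e3 e4; lia.
    have U' : uniq [:: c3 m x2 x3 x4; c3 m x1 x3 x4; c3 m x1 x2 x4; c3 m x1 x2 x3].
      by rewrite -rev_uniq.
    have [e1 e2 e3 e4] := mem_take_uniq4 j U'.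
    rewrite !(asbool_equiv_eq (h _ _)) ?inE ?eqxx ?orbT // !asboolb e1 e2 e3 e4; lia.
split=> //; split.
  move=> X Y rY _ h; elim: h rY => {X Y} [X Y h|//|X Y Z _ h1 _ h2 rZ]; last by auto.
  have R3 x y z : Rp (c3 m x y z) <-> toR Rp x y z by split=> /asboolP.
  case: (Pgen3P A h) => [->//|[x1 [x2 [x3 [x4 [? ? ? ? [? -> ->]]]]]]|
     [x1 [x2 [x3 [x4 [? ? ? ? [? ? -> ->]]]]]]|[x1 [x2 [x3 [x4 [? ? ? ? [? -> ->]]]]]]] /R3 r; apply/R3.
  - exact: (cons3_q12 C) r.
  - exact: (cons3_q23 C) r.
  - exact: (cons3_q34 C) r.
move=> X /(Inv4_ex A)[x1 [x2 [x3 [x4 [-> /and3P[i12 i23 i34]]]]]].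
have U := c3_packet_uniq i12 i23 i34.
have U' : uniq [:: c3 m x2 x3 x4; c3 m x1 x3 x4; c3 m x1 x2 x4; c3 m x1 x2 x3].
  by rewrite -rev_uniq.
have H := cons3_mono C i12 i23 i34; rewrite lex_c4 antilex_c4.
(* The length of the prefix or suffix is the number of triples of the packet in the set. *)
exists (toR Rp x1 x2 x3 + toR Rp x1 x2 x4 + toR Rp x1 x3 x4 + toR Rp x2 x3 x4)%N.
have key (P : seq int -> Prop) : P (c3 m x2 x3 x4) -> P (c3 m x1 x3 x4) ->
    P (c3 m x1 x2 x4) -> P (c3 m x1 x2 x3) ->
    forall Y, Y \in [:: c3 m x2 x3 x4; c3 m x1 x3 x4; c3 m x1 x2 x4; c3 m x1 x2 x3] -> P Y.
  by move=> ? ? ? ? Y; rewrite !inE => /or4P[] /eqP ->.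
set j := (_ + _)%N; have [e1 e2 e3 e4] := mem_take_uniq4 j U.
have [f1 f2 f3 f4] := mem_take_uniq4 j U'.
have R3 x y z b : toR Rp x y z = b -> Rp (c3 m x y z) <-> b.
  by move=> <-; split=> /asboolP.
(* Nondecreasing bits along the lex order are a prefix of the antilex order, whence the crossed
   alternatives. *)
move: H; rewrite /mono => /orP[] H; [right|left]; apply: key;
  rewrite ?e1 ?e2 ?e3 ?e4 ?f1 ?f2 ?f3 ?f4; apply: R3; rewrite /j; move: H;
  case: (toR Rp x1 x2 x3); case: (toR Rp x1 x2 x4); case: (toR Rp x1 x3 x4); by case: (toR Rp x2 x3 x4).
Qed.

End Admissible.

(** * Admissible orders are reflection orders *)

Section Orders.
Context (m : nat).
Local Notation n := m.+2.
Implicit Types (p q x y z : int) (X Y Z s : seq int) (rho : seq (seq int)).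
Implicit Types (Rp : seq int -> Prop).
Context (w g : int -> int) (A : aff m w g).
Local Notation idx rho x y := (index (c2 m x y) rho).

Lemma sorted_index (T : eqType) (r : seq T) : uniq r ->
  sorted (fun a b => index a r < index b r)%N r.
Proof.
case: r => [//|x0 r] U; apply/(sortedP x0) => i hi.
by rewrite !index_uniq //; exact: ltn_trans hi.
Qed.

(** The restriction is sorted by index, and a list sorted by a strict order is determined by its
    members. *)
Lemma restr3 rho (P : seq (seq int)) (a b c : seq int) : uniq rho ->
  a \in rho -> b \in rho -> c \in rho -> P =i [:: a; b; c] ->
  restr rho P = [:: a; b; c] <-> (index a rho < index b rho < index c rho)%N.
Proof.
move=> U ar br cr PE.
pose lt (u v : seq int) := (index u rho < index v rho)%N.
have tr : ssrbool.transitive lt by move=> y x z; exact: ltn_trans.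
have so : sorted lt (restr rho P) by apply: sorted_filter => //; exact: sorted_index.
split=> [e|h]; first by move: so; rewrite e /= andbT.
apply: (@irr_sorted_eq _ lt) => //; first by move=> x; rewrite /lt ltnn.
  by rewrite /= andbT.
move=> x; rewrite mem_filter PE; case: (boolP (x \in _)) => //=.
by rewrite !inE => /or3P[] /eqP ->.
Qed.

Lemma restr_lex rho x y z : lists m g rho -> inv g x y -> inv g y z ->
  restr rho (antilex n (c3 m x y z)) = lex n (c3 m x y z) <->
  (idx rho x y < idx rho x z < idx rho y z)%N.
Proof.
move=> L xy yz; have xz := inv_trans xy yz; rewrite lex_c3 antilex_c3.
have [U _] := L; apply: restr3 => //; rewrite ?(lists_c2 _ _ A L) //.
move=> X; rewrite !inE; case: (X == c2 m y z); case: (X == c2 m x z); by case: (X == c2 m x y).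
Qed.

Lemma restr_antilex rho x y z : lists m g rho -> inv g x y -> inv g y z ->
  restr rho (antilex n (c3 m x y z)) = antilex n (c3 m x y z) <->
  (idx rho y z < idx rho x z < idx rho x y)%N.
Proof.
move=> L xy yz; have xz := inv_trans xy yz; rewrite antilex_c3.
by have [U _] := L; apply: restr3 => //; rewrite ?(lists_c2 _ _ A L).
Qed.

Lemma tot_orderP rho : tot_order n 2 w rho <-> lists m g rho.
Proof.
have E X : Inv n 2 w X <-> exists x y, [/\ X = [:: x; y], 1 <= x <= n%:Z & inv g x y].
  rewrite (@InvP m w g A 2 X isT); split=> [[]|[x [y [-> h i]]]]; last by rewrite /= i.
  by case: X => [|x [|y []]] //= _; rewrite andbT => h1 h2; exists x, y.
by split=> -[U h]; split=> // X; rewrite h E.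
Qed.

Lemma index_eq rho (a b : seq int) : a \in rho -> b \in rho -> index a rho = index b rho -> a = b.
Proof. by move=> ar br e; rewrite -(nth_index [::] ar) e nth_index. Qed.

Lemma admissibleP rho : admissible n 2 w rho <-> lists m g rho /\ pair_order m g rho.
Proof.
rewrite /admissible tot_orderP.
split=> [[L [lin pack]]|[L D]].
  have [U _] := L; have M x y : inv g x y -> c2 m x y \in rho by rewrite (lists_c2 _ _ A L).
  (* A linear extension bounds indices only weakly; different classes have different indices. *)
  have strict x1 x2 y1 y2 : inv g x1 x2 -> inv g y1 y2 -> c2 m x1 x2 <> c2 m y1 y2 ->
      Ple n 2 w (c2 m x1 x2) (c2 m y1 y2) -> (idx rho x1 x2 < idx rho y1 y2)%N.
    move=> i1 i2 ne h; rewrite ltn_neqAle lin ?M // andbT.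
    by apply/eqP => /index_eq e; apply: ne; apply: e; exact: M.
  split=> //; split=> [x1 x2 x3 l l' i13 i23|x1 x2 x3 l l' i12 i13|x1 x2 x3 i12 i23].
  - by apply: strict => //; [exact: c2_neql | exact: (Ple2_12 A)].
  - by apply: strict => //; [exact: c2_neqr | exact: (Ple2_23 A)].
  - have i13 := inv_trans i12 i23.
    have [|h|h] := pack (c3 m x1 x2 x3); first by apply/(Inv3_c3 A); rewrite i12.
      by left; exact: (restr_lex L i12 i23).1 h.
    by right; exact: (restr_antilex L i12 i23).1 h.
have [U _] := L; have M x y : inv g x y -> c2 m x y \in rho by rewrite (lists_c2 _ _ A L).
split=> //; split=> [X Y _ _|X].
  elim=> {X Y} [X Y h|//|X Y Z _ h1 _ h2]; last exact: leq_trans h1 h2.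
  case: (Pgen2P A h) => [->//|[x1 [x2 [x3 [? ? ? ? [-> ->]]]]]|[x1 [x2 [x3 [? ? ? ? [-> ->]]]]]].
    by apply: ltnW; exact: (pair_order12 D).
  by apply: ltnW; exact: (pair_order23 D).
move=> /(Inv3_ex A)[x1 [x2 [x3 [-> [i12 i23]]]]]; have i13 := inv_trans i12 i23.
case: (pair_order123 D i12 i23) => h; [left|right].
  exact: (restr_lex L i12 i23).2 h.
exact: (restr_antilex L i12 i23).2 h.
Qed.

(** Since packets are ordered in lex or antilex order, comparing (y, z) with (x, y) decides between
    the two. *)
Lemma revset_c3 rho x y z : lists m g rho -> pair_order m g rho ->
  revset n 2 w rho (c3 m x y z) <-> reversed m g rho x y z.
Proof.
move=> L D; rewrite /revset (Inv3_c3 A) /reversed.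
split=> [[/andP[i12 i23] h]|/and3P[i12 i23 h]].
  by have := (restr_antilex L i12 i23).1 h; rewrite i12 i23; lia.
split; first by rewrite i12.
by apply/(restr_antilex L i12 i23); have := pair_order123 D i12 i23; lia.
Qed.

Lemma toR_revset rho : lists m g rho -> pair_order m g rho ->
  toR m (revset n 2 w rho) = reversed m g rho.
Proof.
move=> L D; apply: funext => x; apply: funext => y; apply: funext => z.
by apply/asboolP/idP => /(revset_c3 _ _ _ L D).
Qed.

Lemma revset_consistent rho : admissible n 2 w rho -> consistent n 3 w (revset n 2 w rho).
Proof.
move=> /admissibleP[L D]; apply/(consistent3P A); split; first by move=> X [].
by rewrite (toR_revset L D); exact: reversed_cons3 A L D.
Qed.

Lemma toR_inj Rp Rp' : (forall X, Rp X -> Inv n 3 w X) -> (forall X, Rp' X -> Inv n 3 w X) ->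
  toR m Rp = toR m Rp' -> Rp = Rp'.
Proof.
move=> s1 s2 e; apply: funext => X; apply: propext.
have E x y z : Rp (c3 m x y z) <-> Rp' (c3 m x y z).
  have := congr1 (fun f => f x y z) e; rewrite /toR => e'.
  by split=> h; apply/asboolP; [rewrite -e' | rewrite e']; apply/asboolP.
by split=> h; [have := s1 _ h | have := s2 _ h] => /(Inv3_ex A)[x [y [z [e' _]]]];
  rewrite e' in h *; apply/E.
Qed.

Lemma reduced_admissible (u : seq 'I_n) : reduced w u -> admissible n 2 w (refl_order u).
Proof.
by move=> r; apply/admissibleP; split; [exact: refl_lists A r | exact: refl_pair_order A r].
Qed.

Lemma admissible_reduced rho : admissible n 2 w rho ->
  exists2 u : seq 'I_n, reduced w u & refl_order u = rho.
Proof. by move=> /admissibleP[L D]; exact: pair_order_word A L D. Qed.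

Definition wrev (u : seq 'I_n) := revset n 2 w (refl_order u).

Lemma realizesP (u : seq 'I_n) Rp : (forall X, Rp X -> Inv n 3 w X) ->
  realizes w g (toR m Rp) u <-> reduced w u /\ wrev u = Rp.
Proof.
move=> sub; rewrite /realizes; split=> -[r e]; split=> //.
  apply: toR_inj => //; first by move=> X [].
  by rewrite e; apply: toR_revset (refl_lists A r) (refl_pair_order A r).
by rewrite -e; apply: toR_revset (refl_lists A r) (refl_pair_order A r).
Qed.

Lemma prefix_consistent rho j : admissible n 2 w rho ->
  consistent n 2 w (fun X => X \in take j rho).
Proof.
move=> ad; have [[U E] [lin pack]] := ad; have /admissibleP[L D] := ad.
split; first by move=> X /mem_take /E.
split=> [X Y Yj /E Xr XY|X].
  have Yr := mem_take Yj; rewrite in_take // in Yj; rewrite in_take //.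
  exact: leq_ltn_trans (lin _ _ Xr Yr XY) Yj.
move=> /(Inv3_ex A)[x1 [x2 [x3 [-> [i12 i23]]]]]; have i13 := inv_trans i12 i23.
have M x y : inv g x y -> c2 m x y \in rho by rewrite (lists_c2 _ _ A L).
rewrite lex_c3 antilex_c3.
exists ((idx rho x1 x2 < j) + (idx rho x1 x3 < j) + (idx rho x2 x3 < j))%N.
have key (P : seq int -> Prop) : P (c2 m x2 x3) -> P (c2 m x1 x3) -> P (c2 m x1 x2) ->
    forall Y, Y \in [:: c2 m x2 x3; c2 m x1 x3; c2 m x1 x2] -> P Y.
  by move=> ? ? ? Y; rewrite !inE => /or3P[] /eqP ->.
have U3 a b c : (index a rho < index b rho < index c rho)%N -> uniq [:: a; b; c].
  move=> h; rewrite /= !inE negb_or andbT -andbA; apply/and3P.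
  by split; apply/eqP => e; move: h; rewrite e; lia.
by case: (pair_order123 D i12 i23) => h; have [e1 e2 e3] := mem_take_uniq3
  ((idx rho x1 x2 < j) + (idx rho x1 x3 < j) + (idx rho x2 x3 < j))%N (U3 _ _ _ h);
  [left|right]; apply: key; rewrite in_take ?M // ?e1 ?e2 ?e3; move: h; lia.
Qed.

End Orders.

(** * Consistent sets of pairs as prefixes of reflection orders *)

Section WeakOrder.
Context (m : nat).
Local Notation n := m.+2.
Implicit Types (w g : int -> int) (p q x y z : int) (X Y Z s : seq int).
Implicit Types (rho : seq (seq int)) (Rp : seq int -> Prop) (r : int -> int -> bool).

(* The analogue of [cons3] for sets of inversions. *)
Record cons2 g r : Prop := Cons2 {
  cons2_inv : forall x y, r x y -> inv g x y;
  cons2_shift : forall k x y, r (x + k * n%:Z) (y + k * n%:Z) = r x y;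
  cons2_12 : forall x1 x2 x3, x1 < x2 -> g x1 < g x2 -> inv g x1 x3 -> inv g x2 x3 ->
    r x1 x3 -> r x2 x3;
  cons2_23 : forall x1 x2 x3, x2 < x3 -> g x2 < g x3 -> inv g x1 x2 -> inv g x1 x3 ->
    r x1 x3 -> r x1 x2;
  cons2_and : forall x1 x2 x3, inv g x1 x2 -> inv g x2 x3 -> r x1 x2 -> r x2 x3 -> r x1 x3;
  cons2_or : forall x1 x2 x3, inv g x1 x2 -> inv g x2 x3 -> r x1 x3 -> r x1 x2 || r x2 x3
}.

Lemma consistent2P w g Rp : aff m w g -> consistent n 2 w Rp ->
  cons2 g (fun x y => `[< Rp (c2 m x y) >]).
Proof.
move=> A [sub [ideal pack]].
have U3 x y z : inv g x y -> inv g y z -> uniq [:: c2 m x y; c2 m x z; c2 m y z].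
  move=> xy yz; have nxy := inv_cg A xy.
  move: xy yz => /andP[xy _] /andP[yz _].
  rewrite /= !inE negb_or andbT -andbA; apply/and3P; split; apply/eqP.
  - exact: c2_neqr.
  - by move=> /c2_eqP[k [e1 e2]]; case/negP: nxy; rewrite cg_sym; apply/cgP; exists k.
  - by move/esym; exact: c2_neql.
have P3 x y z : inv g x y -> inv g y z -> exists j : nat,
   [/\ `[< Rp (c2 m x y) >] = (0 < j)%N, `[< Rp (c2 m x z) >] = (1 < j)%N & `[< Rp (c2 m y z) >] = (2 < j)%N] \/
   [/\ `[< Rp (c2 m y z) >] = (0 < j)%N, `[< Rp (c2 m x z) >] = (1 < j)%N & `[< Rp (c2 m x y) >] = (2 < j)%N].
  move=> xy yz; have [|j h] := pack (c3 m x y z); first by apply/(Inv3_c3 A); rewrite xy.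
  rewrite lex_c3 antilex_c3 in h; exists j.
  have U := U3 _ _ _ xy yz; have U' : uniq [:: c2 m y z; c2 m x z; c2 m x y] by rewrite -rev_uniq.
  case: h => h; [left|right].
    have [e1 e2 e3] := mem_take_uniq3 j U.
    by rewrite !(asbool_equiv_eq (h _ _)) ?inE ?eqxx ?orbT // !asboolb e1 e2 e3.
  have [e1 e2 e3] := mem_take_uniq3 j U'.
  by rewrite !(asbool_equiv_eq (h _ _)) ?inE ?eqxx ?orbT // !asboolb e1 e2 e3.
split.
- by move=> x y /asboolP/sub/(Inv2_c2 A).
- by move=> k x y; rewrite c2_shift.
- move=> x1 x2 x3 l l' i13 i23 /asboolP r13; apply/asboolP; apply: ideal r13 _ _.
    exact/(Inv2_c2 A).
  exact: (Ple2_12 A).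
- move=> x1 x2 x3 l l' i12 i13 /asboolP r13; apply/asboolP; apply: ideal r13 _ _.
    exact/(Inv2_c2 A).
  exact: (Ple2_23 A).
- by move=> x1 x2 x3 i12 i23; have [j [[-> -> ->]|[-> -> ->]]] := P3 _ _ _ i12 i23; lia.
- by move=> x1 x2 x3 i12 i23; have [j [[-> -> ->]|[-> -> ->]]] := P3 _ _ _ i12 i23; lia.
Qed.

(** Induction on the distance of the positions. With z the line next to y, the pair (z, y) is at a
    descent or not inverted, and (x, z) is closer or not inverted; [cons2_and], [cons2_12] or
    [cons2_23] gives (x, y). *)
Lemma cons2_desc w g r : aff m w g -> cons2 g r ->
  (forall p, w (p + 1) < w p -> r (w (p + 1)) (w p)) -> forall x y, inv g x y -> r x y.
Proof.
move=> A C h x y; have [wK gK _ _] := A.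
have [k] := ubnP (absz (g x - g y)%R); elim: k x y => // k IH x y hk ixy.
have [e|ne] := eqVneq (g x) (g y + 1).
  by have := h (g y); rewrite -e !gK; apply; case/andP: ixy.
pose z := w (g y + 1); have gz : g z = g y + 1 by rewrite /z wK.
have nx : x <> z by move=> e; move/eqP: ne; apply; rewrite e.
have ny : y <> z by move=> e; move: gz; rewrite -e; lia.
have [zx|zx] := ltrP z x.
  have izy : inv g z y by move: ixy; rewrite /inv; lia.
  apply: (cons2_12 C zx _ izy ixy); first by move: ixy; rewrite /inv; lia.
  by have /andP[zy _] := izy; have := h (g y); rewrite -gz !gK; apply.
have [zy|zy] := ltrP y z.
  have ixz : inv g x z by move: ixy; rewrite /inv; lia.
  apply: (cons2_23 C zy _ ixy ixz); first by rewrite gz; lia.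
  by apply: IH => //; move: ixz ixy hk; rewrite /inv; lia.
have ixz : inv g x z by move: ixy; rewrite /inv; lia.
have izy : inv g z y by move: ixy; rewrite /inv; lia.
apply: (cons2_and C ixz izy).
  by apply: IH => //; move: ixz ixy hk; rewrite /inv; lia.
by have /andP[zy' _] := izy; have := h (g y); rewrite -gz !gK; apply.
Qed.

(** If the pair at some descent is missing, [r] is still consistent after it is split off, the new
    conditions being instances of [cons2_or] with this pair missing; the letter is then appended
    behind the prefix. If none is missing, [r] is everything by [cons2_desc]. *)
Lemma cons2_prefix w g r : aff m w g -> cons2 g r ->
  exists (u : seq 'I_n) (j : nat), [/\ reduced w u, (j <= size u)%N &
    forall x y, r x y = (c2 m x y \in take j (refl_order u))].
Proof.
move=> A; move: w g A r; apply: aff_ind => w g A IH r C.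
have [[p d nr]|full] := pselect (exists2 p, w (p + 1) < w p & ~~ r (w (p + 1)) (w p)); last first.
  have [u e l] := word_ex A; exists u, (size u).
  have red : reduced w u by apply/(reducedP _ A).
  split=> // x y; rewrite -size_refl_order take_size (c2_in_refl _ _ A red).
  apply/idP/idP => [/(cons2_inv C)//|]; apply: cons2_desc A C _ _ _.
  by move=> p d; apply: contraT => nr; case: full; exists p.
have A' := aff_sp p A; have I x y := inv_sp x y A d.
have nt x y (xy : x < y) := @sp_noninv m w g p x y A d xy.
have inv_t x y : pair_at m g p x y -> inv g x y by exact: pair_at_inv A d.
have r_t x y : pair_at m g p x y -> ~~ r x y.
  move=> /(pair_atP _ _ _ A) e; have /c2_eqP[k [-> ->]] := esym e.
  by rewrite (cons2_shift C).
have sub x y : inv (sp m p \o g) x y -> inv g x y by exact: inv_sp_sub A d.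
have C' : cons2 (sp m p \o g) r.
  split.
  - move=> x y rxy; rewrite I (cons2_inv C rxy) /=; apply: contraL rxy; exact: r_t.
  - exact: cons2_shift C.
  - move=> x1 x2 x3 l l' /sub i13 /sub i23 r13; case: (nt _ _ l l') => [l''|t].
      exact: (cons2_12 C l l'' i13 i23).
    by have := cons2_or C (inv_t _ _ t) i23 r13; rewrite (negbTE (r_t _ _ t)).
  - move=> x1 x2 x3 l l' /sub i12 /sub i13 r13; case: (nt _ _ l l') => [l''|t].
      exact: (cons2_23 C l l'' i12 i13).
    by have := cons2_or C i12 (inv_t _ _ t) r13; rewrite (negbTE (r_t _ _ t)) orbF.
  - by move=> x1 x2 x3 /sub i12 /sub i23; exact: (cons2_and C i12 i23).
  - by move=> x1 x2 x3 /sub i12 /sub i23; exact: (cons2_or C i12 i23).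
have [u [j [ru ju E]]] := IH p d r C'.
set i := letter m p; have ip : cg m (Posz i) p by exact: cg_letter.
have di : w (Posz i + 1) < w (Posz i) by rewrite (desc_cg A ip).
have red : reduced w (rcons u i) by apply/(reduced_rcons _ _ A); rewrite sp_letter.
exists (rcons u i), j; rewrite size_rcons; split=> //; first exact: leqW.
move=> x y; have /(reducedP _ A')[e _] := ru.
rewrite (@refl_order_rcons m w u i _ di); last by rewrite e sp_letter comp_spK.
by rewrite -cats1 takel_cat ?size_refl_order.
Qed.

End WeakOrder.

(** * Commutations of words and of orders *)

Section Moves.
Context (m : nat).
Local Notation n := m.+2.
Implicit Types (p q x y z : int) (X Y Z s : seq int) (rho sigma : seq (seq int)).
Implicit Types (Rp : seq int -> Prop) (u v a b : seq 'I_n) (f : int -> int).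
Local Notation pos i := (Posz (nat_of_ord i)).
Local Notation idx rho x y := (index (c2 m x y) rho).

Lemma wprod_cat a b : wprod (a ++ b) = wprod a \o wprod b.
Proof. by elim: a => //= i a ->. Qed.

Lemma refl_aux_cat f a b : refl_aux f (a ++ b) = refl_aux f a ++ refl_aux (f \o wprod a) b.
Proof. by elim: a f => //= i a IH f; rewrite IH. Qed.

Lemma refl_order_cat a b : refl_order (a ++ b) = refl_order a ++ refl_aux (wprod a) b.
Proof. by rewrite /refl_order refl_aux_cat. Qed.

Lemma sref_spE (i : 'I_n) : sref i = sp m (pos i).
Proof. exact/funext/sref_sp. Qed.

(** The last entry, a translate of (w (p + 1), w p), determines p mod n and so the last letter. *)
Lemma refl_order_inj w g u v : aff m w g -> reduced w u -> reduced w v ->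
  refl_order u = refl_order v -> u = v.
Proof.
elim/last_ind: u v w g => [|u i IH] v w g A ru rv e.
  by move: (congr1 size e); rewrite !size_refl_order; case: v {rv e}.
case/lastP: v rv e => [|v j] rv e.
  by move: (congr1 size e); rewrite !size_refl_order size_rcons.
have [di ru'] := (reduced_rcons u i A).1 ru; have [dj rv'] := (reduced_rcons v j A).1 rv.
have eu : wprod u \o sp m (pos i) = w.
  by have /(reducedP _ (aff_sp _ A))[-> _] := ru'; rewrite comp_spK.
have ev : wprod v \o sp m (pos j) = w.
  by have /(reducedP _ (aff_sp _ A))[-> _] := rv'; rewrite comp_spK.
move: e; rewrite (refl_order_rcons eu di) (refl_order_rcons ev dj) => /eqP.
rewrite eqseq_rcons => /andP[/eqP e /eqP].
move=> /c2_eqP[k [_ ek]]; have [wK _ wS _] := A.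
have eij : i = j.
  rewrite -(letter_ord i) -(letter_ord j); apply: letter_eq.
  rewrite cg_sym; apply/cgP; exists k; rewrite -wS in ek.
  by have := congr1 g ek; rewrite !wK.
by subst j; rewrite (IH v _ _ (aff_sp (pos i) A) ru' rv' e).
Qed.

Lemma reduced_prefix w g a b : aff m w g -> reduced w (a ++ b) ->
  exists g', aff m (wprod a) g' /\ reduced (wprod a) a.
Proof.
elim/last_ind: b w g => [|b i IH] w g A.
  by rewrite cats0 => r; exists g; have /(reducedP _ A)[-> _] := r.
rewrite -rcons_cat => /(reduced_rcons _ _ A)[_]; exact: IH (aff_sp _ A).
Qed.

Lemma reduced_asc w g a i b : aff m w g -> reduced w (a ++ i :: b) ->
  wprod a (pos i) < wprod a (pos i + 1).
Proof.
move=> A; rewrite -cat_rcons => /(reduced_prefix A)[g' [A' r]].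
have [] := (reduced_rcons _ _ A').1 r.
rewrite wprod_rcons /= (@sp_l m _ (pos i)) ?cg_refl // (@sp_r m (pos i)) ?cg_refl //.
by rewrite addrK.
Qed.

Lemma refl_mem w g a i b : aff m w g -> reduced w (a ++ i :: b) ->
  inv g (wprod a (pos i)) (wprod a (pos i + 1)).
Proof.
move=> A r; rewrite -(c2_in_refl _ _ A r) refl_order_cat mem_cat /= in_cons.
by rewrite mkset_lt ?eqxx ?orbT // (reduced_asc A r).
Qed.

Lemma reduced_comm_step w u v : reduced w u -> comm_step u v -> reduced w v.
Proof.
move=> [e h] [a [b [i [j [[h1 [h2 h3]] [eu ev]]]]]]; split; last first.
  by move=> t /h; rewrite eu ev !size_cat.
move=> x; rewrite -e eu ev !wprod_cat /= !sref_spE; congr (wprod a _).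
apply: sp_comm; rewrite ?cg_ord ?cg_ord_succ; apply/eqP => // e'; by rewrite e' in h1.
Qed.

Lemma reduced_comm_equiv w u v : comm_equiv u v -> reduced w u -> reduced w v.
Proof.
by elim=> // {u v} [u v h r|u v t _ h1 _ h2 r]; [exact: reduced_comm_step r h | auto].
Qed.

Lemma c2_mod x y x' y' : c2 m x y = c2 m x' y' -> cg m x x' /\ cg m y y'.
Proof.
by move=> /c2_eqP[k [-> ->]]; rewrite ![cg m _ (_ + _)]cg_sym !cg_mul.
Qed.

Lemma packet_common x y x' y' X : is_elt n 3 X ->
  c2 m x y \in antilex n X -> c2 m x' y' \in antilex n X ->
  [|| cg m x x', cg m x y', cg m y x' | cg m y y'].
Proof.
move=> E; have eX := @elt_ex m 3 X isT E; case: E => sX _.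
move: X eX sX => [|a [|b [|c []]]] // eX _; rewrite -eX -/(c3 m a b c) antilex_c3 !inE.
have T p q r : cg m p r -> cg m q r -> cg m p q.
  by move=> h1 h2; apply: cg_trans h1 _; rewrite cg_sym.
by move=> /or3P[]/eqP/c2_mod[h1 h2] /or3P[]/eqP/c2_mod[h3 h4];
  rewrite ?(T _ _ _ h1 h3) ?(T _ _ _ h1 h4) ?(T _ _ _ h2 h3) ?(T _ _ _ h2 h4) ?orbT.
Qed.

(** Both orders extend the permanent poset and disagree on the two swapped pairs, so these are
    incomparable. Their four lines are pairwise incongruent, whereas two pairs of one packet share a
    residue. *)
Lemma comm_step_refl w g u v : aff m w g -> reduced w u -> comm_step u v ->
  ord_comm_step n 2 w (refl_order u) (refl_order v).
Proof.
move=> A ru uv; have rv := reduced_comm_step ru uv.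
case: uv => a [b [i [j [[h1 [h2 h3]] [eu ev]]]]].
have n1 : ~~ cg m (pos j) (pos i) by rewrite cg_ord; apply/eqP => e'; rewrite e' in h1.
have n2 : ~~ cg m (pos j) (pos i + 1) by rewrite cg_ord_succ; apply/eqP.
have n3 : ~~ cg m (pos i) (pos j + 1) by rewrite cg_ord_succ; apply/eqP.
have n1' : ~~ cg m (pos i) (pos j) by rewrite cg_sym.
have n2' : ~~ cg m (pos i + 1) (pos j) by rewrite cg_sym.
have n3' : ~~ cg m (pos j + 1) (pos i) by rewrite cg_sym.
have n4 : ~~ cg m (pos i + 1) (pos j + 1) by rewrite cg_addr.
have n4' : ~~ cg m (pos j + 1) (pos i + 1) by rewrite cg_addr.
pose f := wprod a.
have [fi fj] : f (pos i) < f (pos i + 1) /\ f (pos j) < f (pos j + 1).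
  by rewrite eu in ru; rewrite ev in rv; split; [exact: reduced_asc A ru | exact: reduced_asc A rv].
pose Xi := c2 m (f (pos i)) (f (pos i + 1)); pose Xj := c2 m (f (pos j)) (f (pos j + 1)).
pose B := refl_aux (f \o sp m (pos i) \o sp m (pos j)) b.
have Eu : refl_order u = refl_order a ++ [:: Xi; Xj] ++ B.
  rewrite eu refl_order_cat /= !sref_spE -/f /= !sp_id // !mkset_lt //.
have Ev : refl_order v = refl_order a ++ [:: Xj; Xi] ++ B.
  have eB : f \o sp m (pos i) \o sp m (pos j) = f \o sp m (pos j) \o sp m (pos i).
    by apply: funext => x /=; rewrite sp_comm.
  by rewrite ev refl_order_cat /= !sref_spE -/f /= !sp_id // !mkset_lt // /B eB.
exists (refl_order a), B, Xi, Xj; split=> //.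
have [[U1 _] [lin1 _]] := reduced_admissible A ru; have [[U2 _] [lin2 _]] := reduced_admissible A rv.
have iX (c d : seq (seq int)) (P Q : seq int) : uniq (c ++ [:: P; Q] ++ d) ->
    ~~ (index Q (c ++ [:: P; Q] ++ d) <= index P (c ++ [:: P; Q] ++ d))%N.
  rewrite cat_uniq => /and3P[_ /hasPn h /= /andP[]].
  rewrite inE negb_or => /andP[PQ _] _.
  have Pc : P \notin c by apply: h; rewrite !inE eqxx.
  have Qc : Q \notin c by apply: h; rewrite !inE eqxx orbT.
  by rewrite !index_cat (negbTE Pc) (negbTE Qc) /= !eqxx (negbTE PQ) leq_add2l.
have mu (P : seq int) : P \in [:: Xi; Xj] -> P \in refl_order u /\ P \in refl_order v.
  move=> h; have h' : P \in [:: Xj; Xi] by move: h; rewrite !inE orbC.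
  by rewrite Eu Ev !mem_cat h h' !orbT.
have [mi1 mi2] := mu Xi (mem_head _ _).
have [mj1 mj2] : Xj \in refl_order u /\ Xj \in refl_order v by apply: mu; rewrite !inE eqxx orbT.
split; [|split].
- by move=> /(lin2 _ _ mi2 mj2); rewrite Ev; apply/negP; apply: iX; rewrite -Ev.
- by move=> /(lin1 _ _ mj1 mi1); rewrite Eu; apply/negP; apply: iX; rewrite -Eu.
case=> Z [EZ [Zi Zj]]; have := packet_common EZ Zi Zj.
have [g' [A' _]] : exists g', aff m f g' /\ reduced f a.
  by rewrite eu in ru; exact: reduced_prefix A ru.
have fcg x y : cg m (f x) (f y) -> cg m x y.
  move=> /cgP[k e]; apply/cgP; exists k; have [fK _ fS _] := A'.
  by have := congr1 g' e; rewrite -fS !fK.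
by move=> /or4P[]/fcg h; [move: n1'|move: n3|move: n2'|move: n4]; rewrite h.
Qed.

Lemma comm_equiv_refl w g u v : aff m w g -> reduced w u -> comm_equiv u v ->
  ord_comm_equiv n 2 w (refl_order u) (refl_order v).
Proof.
move=> A r uv; elim: uv r => {u v} [u v h|u|u v t h1 IH1 _ IH2] r.
- by apply: rt_step; exact: comm_step_refl A r h.
- exact: rt_refl.
- by apply: rt_trans (IH1 r) (IH2 _); exact: reduced_comm_equiv h1 r.
Qed.

Lemma ord_comm_step_revset w rho sigma : ord_comm_step n 2 w rho sigma ->
  revset n 2 w rho = revset n 2 w sigma /\
  forall X, Inv n 3 w X -> restr rho (antilex n X) = restr sigma (antilex n X).
Proof.
case=> [r1 [r2 [X [Y [[_ [_ nZ]] [-> ->]]]]]].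
have E Z : Inv n 3 w Z -> restr (r1 ++ [:: X; Y] ++ r2) (antilex n Z) =
    restr (r1 ++ [:: Y; X] ++ r2) (antilex n Z).
  move=> [hZ _]; rewrite /restr !filter_cat; congr (_ ++ (_ ++ _)) => /=.
  case: (boolP (X \in _)) => hX; case: (boolP (Y \in _)) => hY //.
  by case: nZ; exists Z.
split=> //; apply: funext => Z; apply: propext; rewrite /revset.
by split=> -[i h]; split=> //; rewrite ?E // -?E.
Qed.

Lemma index_block (T : eqType) (r1 r2 s s' : seq T) (P Q : T) :
  uniq (r1 ++ s ++ r2) -> perm_eq s s' ->
  P \in r1 ++ s ++ r2 -> Q \in r1 ++ s ++ r2 ->
  (index P (r1 ++ s ++ r2) < index Q (r1 ++ s ++ r2))%N ->
  ~~ ((P \in s) && (Q \in s)) ->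
  (index P (r1 ++ s' ++ r2) < index Q (r1 ++ s' ++ r2))%N.
Proof.
move=> U pe Pm Qm; rewrite !index_cat -(perm_size pe) -!(perm_mem pe).
have sz R : R \in s -> (index R s' < size s)%N by rewrite (perm_size pe) index_mem (perm_mem pe).
have sz' R : R \in s -> (index R s < size s)%N by rewrite index_mem.
have sr R : R \in r1 -> (index R r1 < size r1)%N by rewrite index_mem.
case P1: (P \in r1); case Q1: (Q \in r1); case Ps: (P \in s); case Qs: (Q \in s) => //= h _;
  have := sr P; have := sr Q; have := sz P; have := sz Q; have := sz' P; have := sz' Q;
  rewrite ?P1 ?Q1 ?Ps ?Qs; lia.
Qed.

Lemma ord_comm_step_admissible w rho sigma : admissible n 2 w rho ->
  ord_comm_step n 2 w rho sigma -> admissible n 2 w sigma.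
Proof.
move=> ad st; have [_ E] := ord_comm_step_revset st.
case: st ad E => r1 [r2 [X [Y [[nXY [nYX _]] [-> ->]]]]] [[U M] [lin pack]] E.
have pe : perm_eq [:: X; Y] [:: Y; X] by rewrite (perm_catC [:: X] [:: Y]).
have pe2 : perm_eq (r1 ++ [:: X; Y] ++ r2) (r1 ++ [:: Y; X] ++ r2).
  by rewrite perm_cat2l perm_cat2r.
split; [|split].
- split; first by rewrite -(perm_uniq pe2).
  by move=> Z; rewrite -(perm_mem pe2).
- move=> P Q; rewrite -!(perm_mem pe2) => Pm Qm PQ.
  have [->//|ne] := eqVneq P Q; apply: ltnW; apply: (index_block U pe) => //.
    rewrite ltn_neqAle lin // andbT; apply/eqP => e.
    by move/eqP: ne; apply; rewrite -(nth_index [::] Pm) e nth_index.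
  apply/negP; rewrite !inE => /andP[/orP[]/eqP e1 /orP[]/eqP e2]; subst P Q => //; by rewrite eqxx in ne.
- by move=> Z hZ; rewrite -(E Z hZ); exact: pack.
Qed.

Lemma m_gt0_cg p : (0 < m)%N -> ~~ cg m p (p + 1 + 1).
Proof. by move=> m0; apply/negP => h; have := cg_small h; lia. Qed.

(** Three pairwise crossing lines need three residues. *)
Lemma inv3_m_gt0 w g x y z : aff m w g -> inv g x y -> inv g y z -> (0 < m)%N.
Proof.
move=> A xy yz; have := inv_cg A xy; have := inv_cg A yz.
have := inv_cg A (inv_trans xy yz); rewrite lt0n; case: (m) => // .
rewrite /cg -!eqz_mod_dvd => h1 h2 h3.
have := modz_ge0 x (_ : 2%:Z != 0); have := modz_ge0 y (_ : 2%:Z != 0); have := modz_ge0 z (_ : 2%:Z != 0).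
have := ltz_pmod x (_ : 0 < 2%:Z); have := ltz_pmod y (_ : 0 < 2%:Z); have := ltz_pmod z (_ : 0 < 2%:Z).
lia.
Qed.

End Moves.

(** * Braid moves and packet flips *)

Section BraidMoves.
Context (m : nat).
Local Notation n := m.+2.
Implicit Types (p q x y z : int) (X Y Z s : seq int) (rho sigma : seq (seq int)).
Implicit Types (Rp : seq int -> Prop) (u v a b : seq 'I_n) (f w g : int -> int).
Local Notation pos i := (Posz (nat_of_ord i)).
Local Notation idx rho x y := (index (c2 m x y) rho).

Lemma sref_letterE p : sref (letter m p) = sp m p.
Proof. exact/funext/sref_letter. Qed.

Lemma mkset_letter f p : (forall x k, f (x + k * n%:Z) = f x + k * n%:Z) ->
  f p < f (p + 1) ->
  mkset n [:: f (pos (letter m p)); f (pos (letter m p) + 1)] = c2 m (f p) (f (p + 1)).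
Proof.
move=> fS fp; have [k ->] := letterE m p; rewrite addrAC !fS mkset_lt ?c2_shift //.
by rewrite ltrD2r.
Qed.

Lemma refl_aux_letter f p u : (forall x k, f (x + k * n%:Z) = f x + k * n%:Z) ->
  f p < f (p + 1) ->
  refl_aux f (letter m p :: u) = c2 m (f p) (f (p + 1)) :: refl_aux (f \o sp m p) u.
Proof. by move=> fS fp; rewrite -mkset_letter // -sref_letterE. Qed.

Lemma refl_braid f p b : (0 < m)%N -> (forall x k, f (x + k * n%:Z) = f x + k * n%:Z) ->
  f p < f (p + 1) -> f (p + 1) < f (p + 1 + 1) ->
  exists B, refl_aux f (braid3 m p false ++ b) =
      lex n (c3 m (f p) (f (p + 1)) (f (p + 1 + 1))) ++ B /\
    refl_aux f (braid3 m p true ++ b) =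
      antilex n (c3 m (f p) (f (p + 1)) (f (p + 1 + 1))) ++ B.
Proof.
move=> m0 fS xy yz; have n3 := m_gt0_cg p m0.
have [e1 e2 e3 e4 [e5 e6]] := sp_braid_at n3.
have S q (h : int -> int) : (forall x k, h (x + k * n%:Z) = h x + k * n%:Z) ->
    forall x k, (h \o sp m q) (x + k * n%:Z) = (h \o sp m q) x + k * n%:Z.
  by move=> hS x k; rewrite /= sp_add hS.
have xz := lt_trans xy yz.
exists (refl_aux (f \o sp m p \o sp m (p + 1) \o sp m p) b).
have S1 q := S q f fS; have S2 q q' := S q' _ (S1 q).
rewrite lex_c3 antilex_c3 /braid3; split.
  rewrite -[_ ++ b]/[:: letter m p, letter m (p + 1), letter m p & b].
  rewrite (refl_aux_letter _ fS xy).
  rewrite (refl_aux_letter _ (S1 p)); last by rewrite [X in X < _]/= e4 /= e2.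
  rewrite (refl_aux_letter _ (S2 p (p + 1))); last by rewrite [X in X < _]/= e1 e3 /= e5 e2.
  by rewrite [RHS]/= ![(_ \o _) _]/= e4 e2 e1 e3 e5 e2.
have -> : f \o sp m p \o sp m (p + 1) \o sp m p = f \o sp m (p + 1) \o sp m p \o sp m (p + 1).
  by apply: funext => x; rewrite /= sp_braid.
rewrite -[_ ++ b]/[:: letter m (p + 1), letter m p, letter m (p + 1) & b].
rewrite (refl_aux_letter _ fS yz).
rewrite (refl_aux_letter _ (S1 (p + 1))); last by rewrite [X in X < _]/= e1 /= e5.
rewrite (refl_aux_letter _ (S2 (p + 1) p)); last by rewrite [X in X < _]/= e4 e1 /= e2 e6.
by rewrite [RHS]/= ![(_ \o _) _]/= e1 e5 e4 e1 e2 e6.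
Qed.

Lemma wprod_braid a b p : (0 < m)%N ->
  wprod (a ++ braid3 m p false ++ b) = wprod (a ++ braid3 m p true ++ b).
Proof.
move=> m0; rewrite !wprod_cat /= !sref_letterE; congr (wprod a \o _).
by apply: funext => x; rewrite /= sp_braid //; exact: m_gt0_cg.
Qed.

Lemma reduced_braid w a b p c : (0 < m)%N ->
  reduced w (a ++ braid3 m p c ++ b) -> reduced w (a ++ braid3 m p (~~ c) ++ b).
Proof.
move=> m0 [e h]; have E := wprod_braid a b p m0; split=> [x|v /h].
  by rewrite -e; case: c {e h} => /=; rewrite E.
by rewrite !size_cat; case: c {e h}.
Qed.

Lemma braid_flip w g a b p : aff m w g -> (0 < m)%N ->
  reduced w (a ++ braid3 m p false ++ b) ->
  exists X A B, [/\ Inv n 3 w X,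
    refl_order (a ++ braid3 m p false ++ b) = A ++ lex n X ++ B,
    refl_order (a ++ braid3 m p true ++ b) = A ++ antilex n X ++ B & size A = size a].
Proof.
move=> A m0 r; have r' := reduced_braid m0 r; rewrite /= in r'.
have [g' [[fK _ fS _] _]] := reduced_prefix A r.
have cgm q : exists k, pos (letter m q) = q + k * n%:Z := letterE m q.
have asc q b' : reduced w (a ++ letter m q :: b') -> wprod a q < wprod a (q + 1).
  move=> /(reduced_asc A); have [k ->] := cgm q.
  by rewrite addrAC !fS ltrD2r.
have xy := asc _ _ r; have yz := asc _ _ r'.
have [B [E1 E2]] := refl_braid b m0 fS xy yz.
exists (c3 m (wprod a p) (wprod a (p + 1)) (wprod a (p + 1 + 1))), (refl_order a), B.
have M q b' : reduced w (a ++ letter m q :: b') -> inv g (wprod a q) (wprod a (q + 1)).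
  move=> /(refl_mem A); have [k ->] := cgm q.
  by rewrite addrAC !fS (inv_shift A).
split; last exact: size_refl_order.
- by apply/(Inv3_c3 A); rewrite (M _ _ r) (M _ _ r').
- by rewrite refl_order_cat E1.
- by rewrite refl_order_cat E2.
Qed.

(** A lex block comes from three letters i, j, k. Its first two pairs share the line x, which forces
    [j] to be congruent to i + 1; its first and third share y, which then forces k = i. *)
Lemma flip_braid w g u X A B : aff m w g -> reduced w u -> Inv n 3 w X ->
  refl_order u = A ++ lex n X ++ B ->
  exists a p b, u = a ++ braid3 m p false ++ b /\
    refl_order (a ++ braid3 m p true ++ b) = A ++ antilex n X ++ B.
Proof.
move=> Aw r IX e; have [x [y [z [eX [ixy iyz]]]]] := Inv3_ex Aw IX.
have m0 := inv3_m_gt0 Aw ixy iyz.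
have su : (size u = size A + (3 + size B))%N.
  by rewrite -(size_refl_order u) e !size_cat eX lex_c3.
pose a := take (size A) u.
have sa : size a = size A by rewrite size_takel // su leq_addr.
have [i [j [k [b eu]]]] : exists i j k b, u = a ++ [:: i; j; k] ++ b.
  have := cat_take_drop (size A) u; rewrite -/a.
  have := size_drop (size A) u; rewrite su addKn.
  case: (drop _ _) => [|i [|j [|k b]]] //= _ <-; by exists i, j, k, b.
have [i0 j0] : a ++ [:: i; j; k] ++ b = rcons a i ++ [:: j; k] ++ b /\
    a ++ [:: i; j; k] ++ b = rcons (rcons a i) j ++ [:: k] ++ b by rewrite -!cats1 -!catA.
have r1 := r; have r2 := r; have r3 := r; rewrite eu in r1; rewrite eu i0 in r2; rewrite eu j0 in r3.
have [g' [[fK gK fS _] _]] := reduced_prefix Aw r1.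
have l1 := reduced_asc Aw r1; have l2 := reduced_asc Aw r2; have l3 := reduced_asc Aw r3.
rewrite !wprod_rcons /= in l2 l3.
have e0 := e; rewrite eu refl_order_cat eX lex_c3 /= !sref_spE !mkset_lt // in e0.
move/eqP: e0.
rewrite eqseq_cat ?size_refl_order // => /andP[/eqP eA /eqP] E.
have E1 := congr1 (nth [::] ^~ 0%N) E; have E2 := congr1 (nth [::] ^~ 1%N) E.
have E3 := congr1 (nth [::] ^~ 2%N) E; rewrite /= in E1 E2 E3.
move: E1 E2 E3 => /c2_eqP[k1 [ex1 ey1]] /c2_eqP[k2 [ex2 _]] /c2_eqP[k3 [ey3 _]].
have cj : cg m (pos j) (pos i + 1).
  apply/cgP; exists (k1 - k2).
  have : sp m (pos i) (pos j) = pos i + (k1 - k2) * n%:Z.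
    by rewrite -(fK (sp _ _ _)) -(fK (pos i + _)) fS; congr g'; move: ex1 ex2; lia.
  move=> /(congr1 (sp m (pos i))); rewrite spK sp_add => ->.
  by rewrite (@sp_l m _ (pos i)) ?cg_refl.
have ej : j = letter m (pos i + 1) by rewrite -(letter_eq cj) letter_ord.
have spj : sp m (pos j) = sp m (pos i + 1) by exact/funext/sp_cg.
have [e1 e2 e3 e4 _] := sp_braid_at (m_gt0_cg (pos i) m0).
have ck : cg m (pos k) (pos i).
  apply/cgP; exists (k1 - k3).
  have : sp m (pos i) (sp m (pos j) (pos k)) = pos i + 1 + (k1 - k3) * n%:Z.
    by rewrite -(fK (sp _ _ _)) -(fK (pos i + 1 + _)) fS; congr g'; move: ey1 ey3; lia.
  move=> /(congr1 (sp m (pos i))); rewrite spK sp_add e4.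
  by move=> /(congr1 (sp m (pos j))); rewrite spK sp_add spj e1.
have ek : k = i by rewrite -(letter_ord k) -(letter_ord i); exact: letter_eq.
have ei : i = letter m (pos i) by rewrite letter_ord.
have F : [:: i; j; k] ++ b = braid3 m (pos i) false ++ b by rewrite /braid3 -ej -ei ek.
exists a, (pos i), b; split; first by rewrite -F.
have yz : wprod a (pos i + 1) < wprod a (pos i + 1 + 1).
  move: l3; rewrite ek spj e1 e3 (_ : sp m (pos i + 1) (pos i + 1) = pos i + 1 + 1).
    by rewrite e2.
  by rewrite sp_l ?cg_refl.
have [B' [F1 F2]] := refl_braid b m0 fS l1 yz.
rewrite refl_order_cat F2 eA; congr (_ ++ _).
have G' : refl_aux (wprod a) ([:: i; j; k] ++ b) = lex n (c3 m x y z) ++ B.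
  by rewrite lex_c3 /= !sref_spE !mkset_lt // E.
move: G'; rewrite F F1 => /eqP; rewrite eqseq_cat; last by rewrite !lex_c3.
by rewrite eX /lex => /andP[/eqP/(congr1 rev) + /eqP ->]; rewrite !revK => ->.
Qed.

Lemma flip_admissible w g rho sigma : aff m w g -> admissible n 2 w rho ->
  flip_step n 2 w rho sigma -> admissible n 2 w sigma.
Proof.
move=> Aw /(admissible_reduced Aw)[u r <-] [A [B [X [IX [e ->]]]]].
have [a [p [b [eu <-]]]] := flip_braid Aw r IX e.
have [x [y [z [_ [ixy iyz]]]]] := Inv3_ex Aw IX; have m0 := inv3_m_gt0 Aw ixy iyz.
apply: (reduced_admissible Aw); have /= := @reduced_braid w a b p false m0; apply.
by rewrite -eu.
Qed.

(** x2 is the larger line of one pair and the smaller of the other. As x, y, z are incongruent,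
    within the packet only y plays both parts. *)
Lemma packet_two w g x1 x2 x3 x y z : aff m w g -> inv g x y -> inv g y z ->
  c2 m x1 x2 \in [:: c2 m x y; c2 m x z; c2 m y z] ->
  c2 m x2 x3 \in [:: c2 m x y; c2 m x z; c2 m y z] -> c3 m x1 x2 x3 = c3 m x y z.
Proof.
move=> A ixy iyz; have nxy := inv_cg A ixy; have nyz := inv_cg A iyz.
have nxz := inv_cg A (inv_trans ixy iyz).
have T t q q' : cg m t q -> cg m t q' -> cg m q' q.
  by move=> h1 h2; apply: cg_trans h1; rewrite cg_sym.
have main t q q' (Q : Prop) : ~~ cg m q' q -> cg m t q -> cg m t q' -> Q.
  by move=> h h1 h2; move: h; rewrite (T _ _ _ h1 h2).
rewrite !inE => /or3P[]/eqP e1 /or3P[]/eqP e2; have [_ h1] := c2_mod e1; have [h2 _] := c2_mod e2;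
  try by [exact: main nxy h1 h2 | exact: main nyz h1 h2 | exact: main nxz h1 h2].
move: e1 e2 => /c2_eqP[k [-> ey]] /c2_eqP[l [ey' ->]].
have kl : k = l by move: ey ey'; nia.
by rewrite ey kl c3_shift.
Qed.

Lemma index_mid (T : eqType) (r1 r2 s : seq T) (P Q : T) : uniq (r1 ++ s ++ r2) ->
  P \in s -> Q \in s ->
  (index P (r1 ++ s ++ r2) < index Q (r1 ++ s ++ r2))%N = (index P s < index Q s)%N.
Proof.
rewrite cat_uniq => /and3P[_ /hasPn h _] Ps Qs.
have N R : R \in s -> R \notin r1 by move=> Rs; apply: h; rewrite mem_cat Rs.
by rewrite !index_cat (negbTE (N _ Ps)) (negbTE (N _ Qs)) Ps Qs ltn_add2l.
Qed.

(** Reversal of a triple is decided by its lower and its upper pair. The flip changes their relative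
    order only if both are in the block, and then the triple is [X] by [packet_two]. *)
Lemma flip_revset w g A B X : aff m w g -> Inv n 3 w X ->
  admissible n 2 w (A ++ lex n X ++ B) -> admissible n 2 w (A ++ antilex n X ++ B) ->
  ~ revset n 2 w (A ++ lex n X ++ B) X /\
  forall Z, revset n 2 w (A ++ antilex n X ++ B) Z <->
    revset n 2 w (A ++ lex n X ++ B) Z \/ Z = X.
Proof.
move=> Aw IX /(admissibleP Aw)[L1 D1] /(admissibleP Aw)[L2 D2].
have [x [y [z [eX [ixy iyz]]]]] := Inv3_ex Aw IX; subst X.
have [U1 _] := L1; have [U2 _] := L2.
rewrite lex_c3 in L1 D1 U1 *; rewrite antilex_c3 in L2 D2 U2 *.
have U : uniq [:: c2 m x y; c2 m x z; c2 m y z].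
  by move: U1; rewrite cat_uniq => /and3P[_ _]; rewrite cat_uniq => /and3P[].
have U' : uniq [:: c2 m y z; c2 m x z; c2 m x y] by rewrite -rev_uniq.
have pe : perm_eq [:: c2 m x y; c2 m x z; c2 m y z] [:: c2 m y z; c2 m x z; c2 m x y].
  by rewrite -[X in perm_eq _ X]/(rev [:: c2 m x y; c2 m x z; c2 m y z]) perm_sym perm_rev.
have i0 (P Q S : seq int) : uniq [:: P; Q; S] -> (index P [:: P; Q; S] < index S [:: P; Q; S])%N.
  by move=> V; rewrite (@index_uniq _ [::] 0 [:: P; Q; S]) // (@index_uniq _ [::] 2 [:: P; Q; S]).
split.
  move=> /(revset_c3 Aw _ _ _ L1 D1)/and3P[_ _]; apply/negP; rewrite -leqNgt ltnW //.
  by rewrite index_mid ?inE ?eqxx ?orbT //; exact: i0.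
have memL rho x' y' : lists m g rho -> inv g x' y' -> c2 m x' y' \in rho.
  by move=> L; rewrite (lists_c2 _ _ Aw L).
move=> Z; split=> [rZ|[rZ|->]].
- have [/(Inv3_ex Aw)[x1 [x2 [x3 [eZ [i12 i23]]]]] _] := rZ; subst Z.
  have [/andP[m1 m2]|nm] := boolP ((c2 m x1 x2 \in [:: c2 m x y; c2 m x z; c2 m y z])
     && (c2 m x2 x3 \in [:: c2 m x y; c2 m x z; c2 m y z])).
    by right; exact: packet_two Aw ixy iyz m1 m2.
  left; apply/(revset_c3 Aw _ _ _ L1 D1); move/(revset_c3 Aw _ _ _ L2 D2): rZ.
  rewrite /reversed i12 i23 !andTb => h; apply: (index_block U2 _ _ _ h); rewrite ?(memL _ _ _ L2) //.
    by rewrite perm_sym.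
  by rewrite -!(perm_mem pe) andbC.
- have [/(Inv3_ex Aw)[x1 [x2 [x3 [eZ [i12 i23]]]]] _] := rZ; subst Z.
  have [/andP[m1 m2]|nm] := boolP ((c2 m x1 x2 \in [:: c2 m x y; c2 m x z; c2 m y z])
     && (c2 m x2 x3 \in [:: c2 m x y; c2 m x z; c2 m y z])).
    apply/(revset_c3 Aw _ _ _ L2 D2); rewrite (packet_two Aw ixy iyz m1 m2) in rZ.
    move/(revset_c3 Aw _ _ _ L1 D1): rZ => /and3P[_ _].
    by rewrite index_mid ?inE ?eqxx ?orbT // ltnNge ltnW ?i0.
  apply/(revset_c3 Aw _ _ _ L2 D2); move/(revset_c3 Aw _ _ _ L1 D1): rZ.
  rewrite /reversed i12 i23 !andTb => h; apply: (index_block U1 pe _ _ h); rewrite ?(memL _ _ _ L1) //.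
  by rewrite andbC.
- apply/(revset_c3 Aw _ _ _ L2 D2); rewrite /reversed ixy iyz !andTb.
  by rewrite index_mid ?inE ?eqxx ?orbT //; exact: i0.
Qed.

End BraidMoves.

(** * Chains of consistent sets, and rank by cardinality *)

Section Chains.
Context (n k : nat) (w : int -> int).
Implicit Types (R S Q : seq int -> Prop).
Local Notation cons := (consistent n k w).
Local Notation Cle := (Cle n k w).

Definition add_one R R' := exists x : seq int, ~ R x /\ forall y, R' y <-> R y \/ y = x.

Lemma Cle_refl R : cons R -> Cle R R.
Proof. by move=> c; exists 0%N, (fun _ => R). Qed.

Lemma Cle_add_one R R' : cons R -> cons R' -> add_one R R' -> Cle R R'.
Proof.
move=> c c' s; exists 1%N, (fun j => if j is 0%N then R else R'); split=> //; split=> //.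
by split=> [[|]|[]].
Qed.

Lemma Cle_trans R S Q : Cle R S -> Cle S Q -> Cle R Q.
Proof.
move=> [t [F [F0 [Ft [Fc Fs]]]]] [t' [G [G0 [Gt [Gc Gs]]]]].
exists (t + t')%N, (fun j => if (j <= t)%N then F j else G (j - t)%N); split=> //=.
split; first by case: leqP => h; [have -> : t' = 0%N by lia | rewrite addKn];
  rewrite ?addn0 ?Ft // -G0 -Gt; congr G; lia.
split=> j h; first by case: leqP => jt; [apply: Fc | apply: Gc; lia].
case: (ltngtP j t) => jt; first exact: Fs.
  by rewrite subSn ?(ltnW jt) //; apply: Gs; lia.
by rewrite jt Ft -G0 subSnn; apply: Gs; lia.
Qed.

Lemma Cle_ind (P : (seq int -> Prop) -> Prop) R R' : P R ->
  (forall S Q, cons S -> cons Q -> add_one S Q -> P S -> P Q) -> Cle R R' -> P R'.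
Proof.
move=> PR step [t [F [F0 [Ft [Fc Fs]]]]]; rewrite -Ft.
have : (t <= t)%N by []; elim: {-2}t => [|j IH] jt; first by rewrite F0.
apply: (step (F j)); [exact/Fc/ltnW | exact: Fc | exact: Fs | exact/IH/ltnW].
Qed.

Lemma Cle_consistent R R' : Cle R R' -> cons R /\ cons R'.
Proof. by move=> [t [F [<- [<- [Fc _]]]]]; split; apply: Fc. Qed.

Lemma Cle_sub R R' : Cle R R' -> forall X, R X -> R' X.
Proof.
apply: (Cle_ind (P := fun S => forall X, R X -> S X)) => // S Q _ _ [x [_ h]] IH X /IH rX.
by apply/h; left.
Qed.

Section Rank.
Context (T : seq (seq int)) (T_uniq : uniq T).
Hypothesis T_sub : forall R, cons R -> forall X, R X -> X \in T.

Definition rank R := count (fun X => `[< R X >]) T.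

Lemma rank_add_one R R' : cons R' -> add_one R R' -> rank R' = (rank R).+1.
Proof.
move=> c [x [nx h]]; have xT : x \in T by apply: (T_sub c); apply/h; right.
have e : count (pred1 x) T = 1%N by rewrite (count_uniq_mem x T_uniq) xT.
rewrite /rank -addn1 -[in RHS]e -count_predUI [X in (_ + X)%N](_ : _ = 0%N).
  rewrite addn0; apply: eq_count => X /=; apply/asboolP/orP => [/h[rX|->]|[/asboolP rX|/eqP ->]].
  - by left; apply/asboolP.
  - by right; rewrite eqxx.
  - by apply/h; left.
  - by apply/h; right.
rewrite (@eq_count _ _ pred0) ?count_pred0 // => X /=; apply/negbTE/negP => /andP[/asboolP rX /eqP e'].
by rewrite e' in rX.
Qed.

Lemma rank_sub R R' : (forall X, R X -> R' X) -> (rank R <= rank R')%N.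
Proof. by move=> h; apply: sub_count => X /asboolP/h/asboolP. Qed.

Lemma rank_eq R R' : cons R' -> (forall X, R X -> R' X) -> rank R = rank R' -> R = R'.
Proof.
move=> c h e; apply: funext => X; apply: propext; split; first exact: h.
move=> r; apply: contrapT => nr.
have XT : X \in T := T_sub c r.
have : (rank R + count (pred1 X) T <= rank R')%N.
  rewrite /rank -count_predUI [X in (_ + X)%N](_ : _ = 0%N).
    rewrite addn0; apply: sub_count => Y /= /orP[/asboolP/h hY|/eqP ->]; exact/asboolP.
  rewrite (@eq_count _ _ pred0) ?count_pred0 // => Y /=; apply/negbTE/negP => /andP[/asboolP rX /eqP e'].
  by rewrite e' in rX.
by rewrite (count_uniq_mem X T_uniq) XT e; lia.
Qed.

Lemma rank_le_size R : (rank R <= size T)%N.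
Proof. exact: count_size. Qed.

Lemma Cle_chain R R' : Cle R R' -> exists t F, [/\ F 0%N = R, F t = R',
  (rank R + t)%N = rank R', forall j, (j <= t)%N -> cons (F j) &
  forall j, (j < t)%N -> add_one (F j) (F j.+1)].
Proof.
move=> [t [F [F0 [Ft [Fc Fs]]]]]; exists t, F; split=> //; rewrite -Ft -F0.
have : (t <= t)%N by []; elim: {-2}t => [|j IH] jt; first by rewrite addn0.
by rewrite (rank_add_one (Fc _ jt) (Fs _ jt)) -IH ?addnS // ltnW.
Qed.

Lemma Cle_rank_eq R R' : Cle R R' -> rank R = rank R' -> R = R'.
Proof.
by move=> h; apply: rank_eq (Cle_sub h); have [] := Cle_consistent h.
Qed.

(** The second set of a chain from [R] already lies between the ends, so a cover is a single step.
    Conversely, a set within a single step has the rank of one end, hence equals it. *)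
Lemma Ccover_add_one R R' : cons R -> cons R' -> Ccover n k w R R' <-> add_one R R'.
Proof.
move=> c c'; split=> [[h [ne cov]]|s].
  have [[|t] [F [F0 Ft _ Fc Fs]]] := Cle_chain h; first by case: ne; rewrite -F0.
  have c1 : cons (F 1%N) by exact: Fc.
  have s1 : add_one R (F 1%N) by rewrite -F0; exact: Fs.
  have h1 := Cle_add_one c c1 s1.
  case: (cov (F 1%N)) => //.
  - exists t, (fun j => F j.+1); split=> //; split=> //; split=> j jt; [exact: Fc|exact: Fs].
  - by move=> e; case: s1 => x [nx hx]; case: nx; rewrite -e; apply/hx; right.
  - by move=> e; rewrite -e.
split; first exact: Cle_add_one.
have r := rank_add_one c' s.
split; first by move=> e; move: r; rewrite e; lia.
move=> Q cQ RQ QR'; have l1 := rank_sub (Cle_sub RQ); have l2 := rank_sub (Cle_sub QR').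
have [e|e] : rank Q = rank R \/ rank Q = rank R' by lia.
  by left; apply/esym; apply: Cle_rank_eq RQ _.
by right; apply: Cle_rank_eq QR' e.
Qed.

End Rank.
End Chains.

(** * Maximal chains of consistent sets of pairs *)

Section MaximalChains.
Context (m : nat).
Local Notation n := m.+2.
Implicit Types (p q x y z : int) (X Y Z s : seq int) (rho sigma : seq (seq int)).
Implicit Types (R S : seq int -> Prop) (K : (seq int -> Prop) -> Prop).
Context (w g : int -> int) (A : aff m w g).
Local Notation cons := (consistent n 2 w).
Local Notation Cle := (Cle n 2 w).
Local Notation prefix rho j := (fun X : seq int => is_true (X \in take j rho)).

Lemma prefix_add_one rho j : uniq rho -> (j < size rho)%N ->
  add_one (prefix rho j) (prefix rho j.+1).
Proof.
move=> U jr; exists (nth [::] rho j); split.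
  by rewrite in_take ?mem_nth // index_uniq // ltnn.
move=> X; rewrite (take_nth [::] jr) mem_rcons inE; split=> [/orP[/eqP|]|[->|->]]; auto.
- by rewrite orbT.
- by rewrite eqxx.
Qed.

Lemma prefix_Cle rho i j : admissible n 2 w rho -> (i <= j <= size rho)%N ->
  Cle (prefix rho i) (prefix rho j).
Proof.
move=> ad; have [[U _] _] := ad; move=> /andP[ij jr].
exists (j - i)%N, (fun t => prefix rho (i + t)); rewrite /= addn0 subnKC //; split=> //; split=> //.
split=> t ht; first exact: prefix_consistent A _ _ ad.
by rewrite addnS; apply: prefix_add_one => //; lia.
Qed.

Lemma rank_prefix rho j : uniq rho -> (j <= size rho)%N -> rank rho (prefix rho j) = j.
Proof.
move=> U jr; rewrite /rank -[in LHS](cat_take_drop j rho) count_cat.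
rewrite (@eq_in_count _ _ predT) => [|X Xj]; last by apply/asboolP; rewrite cat_take_drop.
rewrite count_predT size_takel // (@eq_in_count _ _ pred0) ?count_pred0 ?addn0 // => X Xd /=.
apply/asboolP; rewrite cat_take_drop => Xt.
by move: U; rewrite -(cat_take_drop j rho) cat_uniq => /and3P[_ /hasPn/(_ X Xd)]; rewrite /= Xt.
Qed.

Lemma admissible_sub rho : admissible n 2 w rho ->
  forall R, cons R -> forall X, R X -> X \in rho.
Proof. by move=> [[_ E] _] R [sub _] X /sub/E. Qed.

Lemma comparable_prefix rho R (j := rank rho R) : admissible n 2 w rho ->
  Cle R (prefix rho j) \/ Cle (prefix rho j) R -> R = prefix rho j.
Proof.
move=> ad; have [[U _] _] := ad; have sub := admissible_sub ad.
have e : rank rho (prefix rho j) = rank rho R by rewrite rank_prefix // rank_le_size.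
by case=> h; [exact: Cle_rank_eq U sub _ _ h (esym e) | exact/esym/(Cle_rank_eq U sub h e)].
Qed.

(** By [cons2_prefix] the set is a prefix of some reflection order, whose prefixes run from the
    empty set to all inversions. *)
Lemma consistent2_between rho0 R : admissible n 2 w rho0 -> cons R ->
  Cle (fun=> False) R /\ Cle R (prefix rho0 (size rho0)).
Proof.
move=> ad0 cR; have [u [j [ru ju E]]] := cons2_prefix A (consistent2P A cR).
have ad := reduced_admissible A ru.
have eR : R = prefix (refl_order u) j.
  apply: funext => X; apply: propext; split=> [rX|Xj].
    have [sub _] := cR; have [x [y [eX _]]] := Inv2_ex A (sub _ rX).
    by rewrite eX -E; apply/asboolP; rewrite -eX.
  have /(admissible_sub ad (prefix_consistent A j ad)) Xu := Xj.
  have [[_ M] _] := ad; have [x [y [eX _]]] := Inv2_ex A ((M _).1 Xu).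
  by rewrite eX in Xj *; rewrite -E in Xj; apply/asboolP.
have e0 : (fun=> False) = prefix (refl_order u) 0 by apply: funext => X; apply: propext; rewrite take0.
have e1 : prefix rho0 (size rho0) = prefix (refl_order u) (size (refl_order u)).
  rewrite !take_size; apply: funext => X; apply: propext.
  by have [[_ M] _] := ad; have [[_ M0] _] := ad0; rewrite M M0.
rewrite e0 e1 eR; split.
  by apply: (@prefix_Cle _ 0 j ad); rewrite size_refl_order.
by apply: (@prefix_Cle _ j _ ad); rewrite size_refl_order ju leqnn.
Qed.

Lemma prefix_chain_maximal rho : admissible n 2 w rho -> Cmaxchain n 2 w (prefix_chain rho).
Proof.
move=> ad; split; first split.
- by move=> R [j [_ ->]]; exact: prefix_consistent A _ _ ad.
- move=> R R' [i [ir ->]] [j [jr ->]]; case: (leqP i j) => ij; [left|right];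
    apply: prefix_Cle => //; lia.
move=> K [Kc Kt] sK R KR; have jr := rank_le_size rho R.
exists (rank rho R); split=> //; apply: comparable_prefix => //.
by apply: Kt => //; apply: sK; exists (rank rho R).
Qed.

Lemma prefix_chain_inj rho sigma : admissible n 2 w rho -> admissible n 2 w sigma ->
  (forall R, prefix_chain rho R <-> prefix_chain sigma R) -> rho = sigma.
Proof.
move=> ad1 ad2 h; have [[U1 M1] _] := ad1; have [[U2 M2] _] := ad2.
have pe : perm_eq rho sigma.
  by apply: uniq_perm => // X; apply/idP/idP => [/M1/M2|/M2/M1].
have sz := perm_size pe.
have rk R : rank rho R = rank sigma R by rewrite /rank; apply/permP.
have E j : (j <= size rho)%N -> take j rho =i take j sigma.
  move=> jr; have [j' [j'r e]] : prefix_chain sigma (prefix rho j) by apply/h; exists j.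
  have : rank rho (prefix rho j) = j by rewrite rank_prefix.
  rewrite e rk rank_prefix // => ej X; subst j'.
  by have := congr1 (@^~ X) e => /= eX; apply/idP/idP; rewrite eX.
apply: (@eq_from_nth _ [::]) => // i ir.
have := E i.+1 ir (nth [::] rho i); rewrite (take_nth [::] ir) mem_rcons mem_head.
rewrite (take_nth [::]) -?sz // mem_rcons inE => /esym/orP[/eqP//|].
by rewrite -E ?(ltnW ir) // in_take ?mem_nth // index_uniq // ltnn.
Qed.

Lemma maxchain_insert K R : Cmaxchain n 2 w K -> cons R ->
  (forall S, K S -> Cle R S \/ Cle S R) -> K R.
Proof.
move=> [[Kc Kt] Kmax] cR hR.
apply: (Kmax (fun S => K S \/ S = R)); [|by left|by right].
split=> [S [/Kc|->]|S S' [KS|->] [KS'|->]] //.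
- exact: Kt.
- by case: (hR S KS); [right|left].
- exact: hR.
- by left; exact: Cle_refl.
Qed.

Lemma maxchain_prefixes K : Cmaxchain n 2 w K ->
  exists rho, admissible n 2 w rho /\ forall R, K R <-> prefix_chain rho R.
Proof.
move=> Kmax; have [[Kc Kt] _] := Kmax.
have [u0 e0 l0] := word_ex A; have r0 : reduced w u0 by apply/(reducedP _ A).
have ad0 := reduced_admissible A r0; set T := refl_order u0 in ad0.
have [[U M] _] := ad0; have sub := admissible_sub ad0.
have btw R cR := consistent2_between (R := R) ad0 cR.
have K0 : K (fun=> False).
  have c0 : cons (fun=> False).
    by have [] := Cle_consistent (btw _ (prefix_consistent A 0 ad0)).1.
  by apply: maxchain_insert => // S /Kc/btw[]; left.
have KT : K (prefix T (size T)).
  by apply: maxchain_insert => //; [exact: (prefix_consistent A _ ad0)|move=> S /Kc/btw[]; right].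
have rT : rank T (prefix T (size T)) = size T by rewrite rank_prefix.
(* Let S be a set of the chain of least rank above R. The first set on a way from R to S is
   comparable with all of [K], hence belongs to it by maximality. *)
have next R : K R -> (rank T R < size T)%N -> exists x : seq int, ~ R x /\ K (fun y : seq int => R y \/ y = x).
  move=> KR rR.
  have [k] := ex_minnP (P := fun k => `[< exists S, [/\ K S, (rank T R < k)%N & rank T S = k] >])
    (ex_intro _ (size T) (introT (asboolP _) (ex_intro _ _ (And3 KT rR rT)))).
  move=> /asboolP[S [KS RS eS]] kmin; rewrite -eS in RS kmin.
  have RleS : Cle R S.
    by case: (Kt R S KR KS) => // /Cle_sub SR; have := rank_sub T SR; lia.
  have [[|t] [F [F0 Ft rF Fc Fs]]] := Cle_chain U sub RleS; first by lia.
  have [x [nx hx]] := Fs 0%N isT; rewrite F0 in nx hx.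
  have eF : F 1%N = (fun y : seq int => R y \/ y = x) by apply: funext => y; apply: propext; exact: hx.
  exists x; split=> //; rewrite -eF; apply: maxchain_insert => //; first exact: Fc.
  have h1 : Cle R (F 1%N) by apply: Cle_add_one; [exact: Kc|exact: Fc|exists x].
  have h2 : Cle (F 1%N) S.
    by exists t, (fun j => F j.+1); split=> //; split=> //; split=> j jt; [exact: Fc|exact: Fs].
  move=> Q KQ; have [le|gt] := leqP (rank T Q) (rank T R).
    right; apply: Cle_trans h1; case: (Kt Q R KQ KR) => // RQ.
    have e : R = Q by apply: (Cle_rank_eq U sub RQ); have := rank_sub T (Cle_sub RQ); lia.
    by rewrite e; apply: Cle_refl; exact: Kc.
  left; apply: Cle_trans h2 _; have le : (rank T S <= rank T Q)%N.
    by apply: kmin; apply/asboolP; exists Q.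
  case: (Kt S Q KS KQ) => // QS.
  have e : Q = S by apply: (Cle_rank_eq U sub QS); have := rank_sub T (Cle_sub QS); lia.
  by rewrite e; apply: Cle_refl; exact: Kc.
have build k : (k <= size T)%N -> exists rho, [/\ uniq rho, size rho = k,
    {subset rho <= T} & forall j, (j <= k)%N -> K (prefix rho j)].
  elim: k => [_|k IH kT]; first by exists [::]; split=> // j _;
    rewrite (_ : (fun X => _) = (fun=> False)) //; apply: funext => X; exact: propext.
  have [rho [Ur sr subr Kr]] := IH (ltnW kT).
  have KR := Kr k (leqnn k).
  have rk : rank T (prefix rho k) = k.
    rewrite /rank -sr take_size -size_filter; apply: perm_size; apply: uniq_perm => //.
      exact: filter_uniq.
    move=> X; rewrite mem_filter; apply/andP/idP => [[/asboolP]//|Xr].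
    by split; [apply/asboolP | exact: subr].
  have [|x [nx Kx]] := next _ KR; first by rewrite rk.
  have xr : x \notin rho by apply/negP => xr; apply: nx; rewrite -sr take_size.
  exists (rcons rho x); rewrite rcons_uniq xr size_rcons sr; split=> //.
    move=> X; rewrite mem_rcons inE => /orP[/eqP ->|/subr //].
    by apply: (sub _ (Kc _ Kx)); right.
  move=> j; rewrite leq_eqVlt => /orP[/eqP ->|jk].
    move: Kx; congr K; apply: funext => X; apply: propext.
    have -> : take k.+1 (rcons rho x) = rcons rho x by rewrite -sr -(size_rcons rho x) take_size.
    rewrite mem_rcons inE -sr take_size.
    by split=> [[->|->]|/orP[/eqP|]]; rewrite ?eqxx ?orbT //; auto.
  have -> : take j (rcons rho x) = take j rho by rewrite -cats1 takel_cat // sr.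
  exact: Kr.
have [rho [Ur sr subr Kr]] := build (size T) (leqnn _).
have eT : rho =i T.
  by have [] := uniq_min_size Ur subr; rewrite ?sr.
have L : lists m g rho.
  by apply/(tot_orderP A); split=> // X; rewrite eT; exact: M.
have mem x y : inv g x y -> c2 m x y \in rho by rewrite (lists_c2 _ _ A L).
have C j : (j <= size rho)%N -> cons2 m g (fun x y => `[< c2 m x y \in take j rho >]).
  by rewrite sr => jT; exact: (consistent2P (Rp := prefix rho j) A (Kc _ (Kr _ jT))).
have P x y j : inv g x y -> `[< c2 m x y \in take j rho >] = (index (c2 m x y) rho < j)%N.
  by move=> i; rewrite asboolb in_take ?mem.
have sz x y : inv g x y -> (index (c2 m x y) rho < size rho)%N by move=> i; rewrite index_mem mem.
have ne x y x' y' : inv g x y -> inv g x' y' -> c2 m x y <> c2 m x' y' ->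
    index (c2 m x y) rho <> index (c2 m x' y') rho.
  by move=> i i' h e; apply: h; exact: (index_eq (mem _ _ i) (mem _ _ i') e).
(* Each relation is read off the consistent prefix that ends with one of the pairs: [sz] is used as
   [index.+1 <= size rho]. *)
have D : pair_order m g rho.
  split=> [x1 x2 x3 l l' i13 i23|x1 x2 x3 l l' i12 i13|x1 x2 x3 i12 i23].
  - have := cons2_12 (C _ (sz _ _ i13)) l l' i13 i23; rewrite !P //.
    have : index (c2 m x2 x3) rho <> index (c2 m x1 x3) rho.
      by apply: ne => //; exact: c2_neql.
    lia.
  - have := cons2_23 (C _ (sz _ _ i13)) l l' i12 i13; rewrite !P //.
    have : index (c2 m x1 x2) rho <> index (c2 m x1 x3) rho.
      by apply: ne => //; exact: c2_neqr.
    lia.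
  - have i13 := inv_trans i12 i23.
    have l12 : x1 < x2 by case/andP: i12.
    have l23 : x2 < x3 by case/andP: i23.
    have n1 : index (c2 m x1 x2) rho <> index (c2 m x1 x3) rho.
      by apply: ne => //; exact: c2_neqr.
    have n2 : index (c2 m x2 x3) rho <> index (c2 m x1 x3) rho.
      by apply: ne => //; exact: c2_neql.
    have := cons2_or (C _ (sz _ _ i13)) i12 i23.
    have := cons2_and (C _ (sz _ _ i12)) i12 i23; have := cons2_and (C _ (sz _ _ i23)) i12 i23.
    rewrite !P //; lia.
have ad : admissible n 2 w rho by apply/(admissibleP A).
exists rho; split=> // R; split=> [KR|[j [jr ->]]]; last by apply: Kr; rewrite -sr.
have jr := rank_le_size rho R; exists (rank rho R); split=> //.
by apply: comparable_prefix => //; apply: Kt => //; apply: Kr; rewrite -sr.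
Qed.

End MaximalChains.

(** * Consistent sets of triples as reversal sets of words *)

Section HigherOrder.
Context (m : nat).
Local Notation n := m.+2.
Implicit Types (p q x y z : int) (X Y Z s : seq int) (rho sigma : seq (seq int)).
Implicit Types (R S Q : seq int -> Prop) (u v : seq 'I_n).
Context (w g : int -> int) (A : aff m w g).
Local Notation cons := (consistent n 3 w).
Local Notation Cle := (Cle n 3 w).
Local Notation rev_of := (revset n 2 w).
Local Notation wrev := (wrev w).

Lemma wrev_consistent u : reduced w u -> cons (wrev u).
Proof. by move=> r; apply: (revset_consistent A); exact: (reduced_admissible A). Qed.

Lemma realizes_wrev u R : (forall X, R X -> Inv n 3 w X) ->
  realizes w g (toR m R) u -> reduced w u /\ wrev u = R.
Proof. by move=> sub /(realizesP A _ sub). Qed.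

Lemma wrev_ex R : cons R -> exists2 u : seq 'I_n, reduced w u & wrev u = R.
Proof.
move=> cR; have [sub C] := (consistent3P A R).1 cR.
by have [u /(realizes_wrev sub)[r e]] := realizes_ex A C; exists u.
Qed.

Lemma comm_equiv_wrev u v : reduced w u -> reduced w v ->
  comm_equiv u v <-> wrev u = wrev v.
Proof.
move=> ru rv; split=> [|e].
  move=> h; have := comm_equiv_refl A ru h; rewrite /wrev; elim=> // [r s /ord_comm_step_revset[]|r s t _ h1 _ h2] //.
  by rewrite h1.
have sub X : wrev v X -> Inv n 3 w X by case.
by apply: (realizes_comm_equiv A (R := toR m (wrev v))); apply/(realizesP A _ sub).
Qed.

Lemma revset_ord_comm_equiv rho sigma : admissible n 2 w rho -> admissible n 2 w sigma ->
  rev_of rho = rev_of sigma -> ord_comm_equiv n 2 w rho sigma.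
Proof.
move=> /(admissible_reduced A)[u ru <-] /(admissible_reduced A)[v rv <-].
by move=> /(comm_equiv_wrev ru rv); exact: comm_equiv_refl A ru.
Qed.

Lemma wrev_braid a p b : (0 < m)%N -> reduced w (a ++ braid3 m p false ++ b) ->
  add_one (wrev (a ++ braid3 m p false ++ b)) (wrev (a ++ braid3 m p true ++ b)).
Proof.
move=> m0 r; have r' := reduced_braid m0 r.
have [X [B1 [B2 [IX e1 e2 _]]]] := braid_flip A m0 r.
have a1 := reduced_admissible A r; have a2 := reduced_admissible A r'.
rewrite /wrev; rewrite e1 in a1 *; rewrite e2 in a2 *.
by have [nX h] := flip_revset A IX a1 a2; exists X.
Qed.

Lemma Inv3_m_gt0 X : Inv n 3 w X -> (0 < m)%N.
Proof. by move=> /(Inv3_ex A)[x [y [z [_ [xy yz]]]]]; exact: inv3_m_gt0 A xy yz. Qed.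

Lemma add_one_words R S : cons R -> cons S -> add_one R S -> exists a p b,
  [/\ reduced w (a ++ braid3 m p false ++ b), reduced w (a ++ braid3 m p true ++ b),
      wrev (a ++ braid3 m p false ++ b) = R & wrev (a ++ braid3 m p true ++ b) = S].
Proof.
move=> cR cS [X [nX h]]; have [sR CR] := (consistent3P A R).1 cR.
have [sS CS] := (consistent3P A S).1 cS.
have SX : S X by apply/h; right.
have [x [y [z [eX _]]]] := Inv3_ex A (sS _ SX); subst X.
have [|||a [p [b []]]] := @cover_words m w g (toR m R) (toR m S) x y z A CR CS.
- exact/asboolP.
- exact/asboolP.
- move=> a b c; apply/asboolP/orP => [/h[r|->]|[/asboolP r|/eqP ->]].
  + by left; apply/asboolP.
  + by right; rewrite eqxx.
  + by apply/h; left.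
  + by apply/h; right.
by move=> /(realizes_wrev sR)[r1 e1] /(realizes_wrev sS)[r2 e2]; exists a, p, b.
Qed.

(** A nonempty set has a word that contains the reversed side of a braid; undoing the braid removes
    one triple. *)
Lemma consistent_remove R : cons R -> (exists X, R X) ->
  exists2 S, cons S & add_one S R.
Proof.
move=> cR [X RX]; have [sR CR] := (consistent3P A R).1 cR.
have m0 := Inv3_m_gt0 (sR _ RX).
have [x [y [z [eX _]]]] := Inv3_ex A (sR _ RX); subst X.
have [|a [p [b /(realizes_wrev sR)[r e]]]] := @flip_down_ex m w g (toR m R) x y z A CR.
  exact/asboolP.
have r' := reduced_braid m0 r.
by exists (wrev (a ++ braid3 m p false ++ b)); [exact: wrev_consistent | rewrite -e; exact: wrev_braid].
Qed.

Lemma consistent_add R : cons R -> (exists2 X, Inv n 3 w X & ~ R X) ->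
  exists2 S, cons S & add_one R S.
Proof.
move=> cR [X IX nX]; have [sR CR] := (consistent3P A R).1 cR.
have m0 := Inv3_m_gt0 IX.
have [x [y [z [eX [xy yz]]]]] := Inv3_ex A IX; subst X.
have [|a [p [b /(realizes_wrev sR)[r e]]]] := @flip_up_ex m w g (toR m R) x y z A CR xy yz.
  exact/asboolP.
have r' := reduced_braid m0 r.
by exists (wrev (a ++ braid3 m p true ++ b)); [exact: wrev_consistent | rewrite -e; exact: wrev_braid].
Qed.

Lemma Inv3_list : exists2 T : seq (seq int), uniq T & forall X, X \in T <-> Inv n 3 w X.
Proof.
have [M B] := aff_bounded A; pose L := inv2s m g M.
(* A triple x < y < z is assembled from the pairs (x, y) and (x, z), which are canonical when the
   triple is. *)
pose C := [seq [:: nth 0 Y 0; nth 0 Y 1; nth 0 Z 1] | Y <- L, Z <- L].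
exists (undup [seq X <- C | `[< Inv n 3 w X >]]); first exact: undup_uniq.
move=> X; rewrite mem_undup mem_filter; split=> [/andP[/asboolP]//|IX].
apply/andP; split; first exact/asboolP.
have [] := (@InvP m w g A 3 X isT).1 IX.
case: X IX => [|x [|y [|z []]]] //= IX _ /and3P[xy yz _] h.
apply/allpairsP; exists ([:: x; y], [:: x; z]); split=> //; apply/(mem_inv2s _ _ B).
  by exists x, y.
by exists x, z; split=> //; exact: inv_trans xy yz.
Qed.

Lemma aff_wprod u : exists g', aff m (wprod u) g'.
Proof.
elim/last_ind: u => [|u i [g' A']]; first by exists id; exact: aff_id.
by exists (sp m (Posz i) \o g'); rewrite wprod_rcons; exact: aff_sp.
Qed.

(** For n = 2 the two sides move p to p + 3 and p - 3. *)
Lemma braid3_neq p : m = 0%N -> wprod (braid3 m p false) p <> wprod (braid3 m p true) p.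
Proof.
move=> m0; have C k x y : x = y + k * n%:Z -> cg m x y by move=> e; apply/cgP; exists k.
rewrite /= !sref_letterE.
rewrite [sp m p p]sp_l ?cg_refl // [sp m (p + 1) (p + 1)]sp_l ?cg_refl //.
rewrite [sp m p (p + 1 + 1)]sp_l; last by apply: (C 1); rewrite m0; lia.
rewrite [sp m (p + 1) p]sp_r; last by apply: (C (-1)); rewrite m0; lia.
rewrite [sp m p (p - 1)]sp_r; last by apply: (C (-1)); rewrite m0; lia.
rewrite [sp m (p + 1) _]sp_r; last by apply: (C (-2)); rewrite m0; lia.
lia.
Qed.

Lemma G_edge_add_one u v : reduced w u -> reduced w v ->
  G_edge w u v <-> add_one (wrev u) (wrev v).
Proof.
move=> ru rv; split=> [[_ [_ [u' [v' [uu' [vv' st]]]]]]|h].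
  have ru' := reduced_comm_equiv uu' ru; have rv' := reduced_comm_equiv vv' rv.
  rewrite ((comm_equiv_wrev ru ru').1 uu') ((comm_equiv_wrev rv rv').1 vv').
  case: st => a [b [i [j [ji [eu ev]]]]].
  have ej : j = letter m (Posz i + 1) by apply: val_inj; apply: etrans ji _; rewrite -{1}(letter_ord i) -letter_succ.
  have ei : i = letter m (Posz i) by rewrite letter_ord.
  have eu' : u' = a ++ braid3 m (Posz i) false ++ b by rewrite /braid3 -ej -ei.
  have ev' : v' = a ++ braid3 m (Posz i) true ++ b by rewrite /braid3 -ej -ei.
  (* Both words have product [w], so by [braid3_neq] n is not 2. *)
  have m0 : (0 < m)%N.
    rewrite lt0n; apply/negP => /eqP m0.
    have [E1 _] := ru'; have [E2 _] := rv'.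
    have [g' [[fK _ fS _] _]] : exists g', aff m (wprod a) g' /\ reduced (wprod a) a.
      by rewrite eu' in ru'; exact: reduced_prefix A ru'.
    have {E1 E2} E x : wprod (braid3 m (Posz i) false) (wprod b x) =
        wprod (braid3 m (Posz i) true) (wprod b x).
      apply: (can_inj fK); have := E1 x; rewrite -E2 eu' ev' !wprod_cat; exact.
    have [gb [_ bK _ _]] := aff_wprod b.
    have := E (gb (Posz i)); rewrite bK; exact: braid3_neq.
  by rewrite eu' ev' in ru' *; exact: wrev_braid.
have [a [p [b [r1 r2 e1 e2]]]] := add_one_words (wrev_consistent ru) (wrev_consistent rv) h.
split=> //; split=> //; exists (a ++ braid3 m p false ++ b), (a ++ braid3 m p true ++ b).
split; first exact/(comm_equiv_wrev ru r1).
split; first exact/(comm_equiv_wrev rv r2).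
by exists a, b, (letter m p), (letter m (p + 1)); rewrite letter_succ.
Qed.

Section Ranked.
Context (T : seq (seq int)) (T_uniq : uniq T) (T_mem : forall X, X \in T <-> Inv n 3 w X).

Lemma cons_sub_T R : cons R -> forall X, R X -> X \in T.
Proof. by move=> [sub _] X /sub /T_mem. Qed.
Local Notation rank := (rank T).
Let TS := cons_sub_T.

Lemma rank_bottom : rank (fun=> False) = 0%N.
Proof.
rewrite /rank (@eq_count _ _ pred0) ?count_pred0 // => X /=.
by apply/asboolP.
Qed.

Lemma rank_top : rank (Inv n 3 w) = size T.
Proof.
rewrite /rank (@eq_in_count _ _ predT) ?count_predT // => X XT /=.
by apply/asboolP/T_mem.
Qed.

Lemma Cle_bottom R : cons R -> Cle (fun=> False) R.
Proof.
have [k] := ubnP (rank R); elim: k R => // k IH R hk cR.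
have [ne|em] := pselect (exists X, R X).
  have [S cS SR] := consistent_remove cR ne.
  apply: Cle_trans (IH S _ cS) (Cle_add_one cS cR SR).
  by rewrite (rank_add_one T_uniq TS cR SR) in hk.
have e : (fun=> False) = R.
  by apply: funext => X; apply: propext; split=> // RX; apply: em; exists X.
by rewrite e; exact: Cle_refl.
Qed.

Lemma Cle_top R : cons R -> Cle R (Inv n 3 w).
Proof.
have [k] := ubnP (size T - rank R); elim: k R => // k IH R hk cR.
have [ne|em] := pselect (exists2 X, Inv n 3 w X & ~ R X).
  have [S cS RS] := consistent_add cR ne.
  apply: Cle_trans (Cle_add_one cR cS RS) (IH S _ cS).
  have := rank_add_one T_uniq TS cS RS; have := rank_le_size T S; lia.
have e : Inv n 3 w = R.
  apply: funext => X; apply: propext; split=> [IX|]; last by have [sub _] := cR; exact: sub.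
  by apply: contrapT => nX; apply: em; exists X.
by rewrite e; exact: Cle_refl.
Qed.

(** No packet needs checking: a chain below the reversal set of any word begins with the empty
    set. *)
Lemma cons_bottom : cons (fun=> False).
Proof.
have [u _ r] : exists2 u : seq 'I_n, True & reduced w u.
  by have [u e l] := word_ex A; exists u => //; apply/(reducedP _ A).
by have [] := Cle_consistent (Cle_bottom (wrev_consistent r)).
Qed.

Lemma cons_top : cons (Inv n 3 w).
Proof. by have [] := Cle_consistent (Cle_top cons_bottom). Qed.

End Ranked.
End HigherOrder.

(** * The order on commutation classes, the graph and its diameter *)

Section Conclusion.
Context (m : nat).
Local Notation n := m.+2.
Implicit Types (X Y Z : seq int) (rho sigma : seq (seq int)).
Implicit Types (R S Q : seq int -> Prop) (u v : seq 'I_n).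
Context (w g : int -> int) (A : aff m w g).
Context (T : seq (seq int)) (T_uniq : uniq T) (T_mem : forall X, X \in T <-> Inv n 3 w X).
Local Notation cons := (consistent n 3 w).
Local Notation Cle := (Cle n 3 w).
Local Notation wrev := (wrev w).
Local Notation rank := (rank T).
Let TS := cons_sub_T T_mem.

Lemma Cle_Ble rho sigma : admissible n 2 w rho -> admissible n 2 w sigma ->
  Cle (revset n 2 w rho) (revset n 2 w sigma) -> Ble n 2 w rho sigma.
Proof.
have comm_Ble r s : ord_comm_equiv n 2 w r s -> Ble n 2 w r s.
  elim=> {r s} [r s h|r|r s t _ h1 _ h2]; [by apply: rt_step; left|exact: rt_refl|exact: rt_trans h1 h2].
move=> ad1 ad2 h.
(* The braid of each step starts from a word that need not be the one reached before, so the
   induction covers all orders with reversal set S; commutations join them. *)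
pose P S := forall s, admissible n 2 w s -> revset n 2 w s = S -> Ble n 2 w rho s.
apply: (Cle_ind (P := P) _ _ h sigma ad2 erefl).
  by move=> s ads e; apply: comm_Ble; exact: (revset_ord_comm_equiv A).
move=> S Q cS cQ st IH s ads e.
have [a [p [b [r1 r2 e1 e2]]]] := add_one_words A cS cQ st.
have m0 : (0 < m)%N.
  case: st => X [_ hX]; apply: (Inv3_m_gt0 A (X := X)).
  by have [sub _] := cQ; apply: sub; apply/hX; right.
have [X [B1 [B2 [IX f1 f2 _]]]] := braid_flip A m0 r1.
apply: rt_trans (IH _ (reduced_admissible A r1) e1) _.
apply: (@rt_trans _ _ _ (refl_order (a ++ braid3 m p true ++ b))).
  by apply: rt_step; right; rewrite f1 f2; exists B1, B2, X.
apply: comm_Ble; apply: (revset_ord_comm_equiv A) => //; first exact: (reduced_admissible A).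
by rewrite e.
Qed.

Lemma Ble_Cle rho sigma : Ble n 2 w rho sigma -> admissible n 2 w rho ->
  admissible n 2 w sigma /\ Cle (revset n 2 w rho) (revset n 2 w sigma).
Proof.
elim=> {rho sigma} [r s [h|h] ad|r ad|r s t _ h1 _ h2 ad].
- have ad' := ord_comm_step_admissible ad h; split=> //.
  by have [-> _] := ord_comm_step_revset h; apply: Cle_refl; exact: (revset_consistent A).
- have ad' := flip_admissible A ad h; split=> //.
  case: h ad ad' => B1 [B2 [X [IX [-> ->]]]] ad ad'; have [nX hX] := flip_revset A IX ad ad'.
  by apply: Cle_add_one; [exact: (revset_consistent A)|exact: (revset_consistent A)|exists X].
- by split=> //; apply: Cle_refl; exact: (revset_consistent A).
- have [ad' c1] := h1 ad; have [ad'' c2] := h2 ad'; split=> //; exact: Cle_trans c1 c2.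
Qed.

Lemma G_walk (F : nat -> seq int -> Prop) k u v : reduced w u -> reduced w v ->
  F 0%N = wrev u -> F k = wrev v -> (forall j, (j <= k)%N -> cons (F j)) ->
  (forall j, (j < k)%N -> add_one (F j) (F j.+1) \/ add_one (F j.+1) (F j)) ->
  forall l, (k <= l)%N -> G_dist_le w u v l.
Proof.
move=> ru rv F0 Fk Fc Fs l kl.
(* [choice] needs a word for every set, hence the dummy for inconsistent ones. *)
have ex (R : seq int -> Prop) : exists x : seq 'I_n, cons R -> reduced w x /\ wrev x = R.
  have [c|c] := pselect (cons R); last by exists [::].
  by have [x rx ex] := wrev_ex A c; exists x.
have [h hP] := choice ex.
have hF j : (j <= k)%N -> reduced w (h (F j)) /\ wrev (h (F j)) = F j by move=> jk; exact/hP/Fc.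
exists k, (fun j => h (F j)); split=> //; split; last split.
- by have [r e] := hF 0%N (leq0n _); apply/(comm_equiv_wrev A ru r); rewrite e.
- by have [r e] := hF k (leqnn _); apply/(comm_equiv_wrev A r rv); rewrite e.
- move=> j jk; have [r1 e1] := hF j (ltnW jk); have [r2 e2] := hF j.+1 jk.
  case: (Fs j jk) => st; [left|right].
    by apply: (G_edge_add_one A r1 r2).2; rewrite e1 e2.
  by apply: (G_edge_add_one A r2 r1).2; rewrite e1 e2.
Qed.

Lemma G_diameter_size : G_diameter n w (size T).
Proof.
have cw u : reduced w u -> cons (wrev u) by exact: (wrev_consistent A).
split=> [u v ru rv|].
  have cu := cw u ru; have cv := cw v rv.
  (* The path through the minimum has length the sum of the two ranks, the one through the maximum
     twice [size T] minus that sum; the shorter is at most [size T]. *)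
  have [down|up] := leqP (rank (wrev u) + rank (wrev v)) (size T).
    have [t [F [F0 Ft rF Fc Fs]]] := Cle_chain T_uniq TS (Cle_bottom A T_uniq T_mem cu).
    have [t' [F' [F0' Ft' rF' Fc' Fs']]] := Cle_chain T_uniq TS (Cle_bottom A T_uniq T_mem cv).
    apply: (@G_walk (fun j => if (j <= t)%N then F (t - j)%N else F' (j - t)%N) (t + t')) => //=.
    - by rewrite subn0.
    - case: leqP => h; last by rewrite addKn.
      have t0 : t' = 0%N by lia.
      by rewrite -Ft' t0 addn0 subnn F0 F0'.
    - move=> j jk; case: leqP => h; [apply: Fc|apply: Fc']; lia.
    - move=> j jk; case: (ltngtP j t) => h.
      + by right; have := Fs (t - j.+1)%N; rewrite -subSn // subSS; apply; lia.
      + by left; rewrite subSn ?(ltnW h) //; apply: Fs'; lia.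
      + by left; rewrite h subnn subSnn F0 -F0'; apply: Fs'; lia.
    - by move: rF rF'; rewrite rank_bottom; lia.
  have [t [F [F0 Ft rF Fc Fs]]] := Cle_chain T_uniq TS (Cle_top A T_uniq T_mem cu).
  have [t' [F' [F0' Ft' rF' Fc' Fs']]] := Cle_chain T_uniq TS (Cle_top A T_uniq T_mem cv).
  apply: (@G_walk (fun j => if (j <= t)%N then F j else F' (t' - (j - t))%N) (t + t')) => //=.
  - case: leqP => h; last by rewrite addKn subnn.
    have t0 : t' = 0%N by lia.
    by rewrite t0 addn0 Ft -Ft' t0 F0'.
  - move=> j jk; case: leqP => h; [apply: Fc|apply: Fc']; lia.
  - move=> j jk; case: (ltngtP j t) => h.
    + by left; apply: Fs.
    + right; have -> : (t' - (j - t) = (t' - (j.+1 - t)).+1)%N by lia.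
      by apply: Fs'; lia.
    + right; rewrite h Ft -Ft' subSnn; have -> : t' = (t' - 1).+1 by lia.
      by rewrite subn1 /=; apply: Fs'; lia.
  - by move: rF rF'; rewrite (rank_top T_mem); lia.
have [u ru eu] := wrev_ex A (cons_bottom A T_uniq T_mem).
have [v rv ev] := wrev_ex A (cons_top A T_uniq T_mem).
exists u, v; split=> //; split=> // k [k' [f [kk' [uf [fv fs]]]]].
apply: leq_trans kk'.
have ref0 := reduced_comm_equiv uf ru.
(* An edge changes the rank by one, so reaching the maximum from the minimum takes at least [size T]
   edges. *)
have E j : (j <= k')%N -> (rank (wrev (f j)) <= j)%N /\ reduced w (f j).
  elim: j => [_|j IH jk].
    by rewrite -((comm_equiv_wrev A ru ref0).1 uf) eu rank_bottom.
  have [h r] := IH (ltnW jk).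
  case: (fs j jk) => e; have [r1 [r2 _]] := e; split=> //;
    have := rank_add_one T_uniq TS (cw _ _) ((G_edge_add_one A _ _).1 e).
  - by move=> /(_ r2 r1 r2) ->.
  - by move=> /(_ r2 r1 r2) e'; move: h; rewrite e'; lia.
have [h r] := E k' (leqnn _).
by rewrite -(rank_top T_mem) -ev -((comm_equiv_wrev A r rv).1 fv).
Qed.

Lemma Cranked3 : Cranked n 3 w.
Proof.
exists rank; split=> [R [cR minR]|R S cR cS].
  by rewrite -(minR _ (cons_bottom A T_uniq T_mem) (Cle_bottom A T_uniq T_mem cR)) rank_bottom.
move=> /(Ccover_add_one T_uniq TS cR cS); exact: (rank_add_one T_uniq TS cS).
Qed.

End Conclusion.

Theorem theorem1p3 (n : nat) (w : int -> int) :
  (2 <= n)%N -> is_affperm n w ->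
  (* (a) natural bijections: reduced words -> reflection orders (injective),
     reflection orders = A_w(n,2), A_w(n,2) -> maximal chains of C_w(n,2)
     via prefix sets (bijective) *)
  ((forall u v : seq 'I_n, reduced w u -> reduced w v ->
      refl_order u = refl_order v -> u = v) /\
   (forall rho, is_refl_order n w rho <-> admissible n 2 w rho) /\
   (forall rho, admissible n 2 w rho -> Cmaxchain n 2 w (prefix_chain rho)) /\
   (forall rho sigma, admissible n 2 w rho -> admissible n 2 w sigma ->
      (forall R, prefix_chain rho R <-> prefix_chain sigma R) -> rho = sigma) /\
   (forall K, Cmaxchain n 2 w K ->
      exists rho, admissible n 2 w rho /\ forall R, K R <-> prefix_chain rho R))
  /\
  (* (b) [rho] |-> revset rho is a poset isomorphism B_w(n,2) ~ C_w(n,3);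
     ranked, unique min (empty set) and unique max (Inv_3(w)) *)
  ((forall rho, admissible n 2 w rho -> consistent n 3 w (revset n 2 w rho)) /\
   (forall rho sigma, admissible n 2 w rho -> ord_comm_equiv n 2 w rho sigma ->
      revset n 2 w rho = revset n 2 w sigma) /\
   (forall rho sigma, admissible n 2 w rho -> admissible n 2 w sigma ->
      revset n 2 w rho = revset n 2 w sigma -> ord_comm_equiv n 2 w rho sigma) /\
   (forall R, consistent n 3 w R -> exists rho, admissible n 2 w rho /\ revset n 2 w rho = R) /\
   (forall rho sigma, admissible n 2 w rho -> admissible n 2 w sigma ->
      (Ble n 2 w rho sigma <-> Cle n 3 w (revset n 2 w rho) (revset n 2 w sigma))) /\
   Cranked n 3 w /\
   Cminimal n 3 w (fun _ => False) /\
   (forall R, consistent n 3 w R -> Cle n 3 w (fun _ => False) R) /\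
   (forall R, Cminimal n 3 w R -> R = (fun _ => False)) /\
   Cmaximal n 3 w (Inv n 3 w) /\
   (forall R, consistent n 3 w R -> Cle n 3 w R (Inv n 3 w)) /\
   (forall R, Cmaximal n 3 w R -> R = Inv n 3 w))
  /\
  (* (c) Hasse diagram of C_w(n,3) (~ B_w(n,2)) is isomorphic to G(w);
     undirected diameter of G(w) is |Inv_3(w)| *)
  ((exists f : seq 'I_n -> (seq int -> Prop),
      (forall u, reduced w u -> consistent n 3 w (f u)) /\
      (forall u v, reduced w u -> reduced w v -> (comm_equiv u v <-> f u = f v)) /\
      (forall R, consistent n 3 w R -> exists u, reduced w u /\ f u = R) /\
      (forall u v, reduced w u -> reduced w v ->
         (G_edge w u v <-> Ccover n 3 w (f u) (f v)))) /\
   exists N : nat, card_is (Inv n 3 w) N /\ G_diameter n w N).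
Proof.
case: n => [|[|m]] // _ aw; have [g A] := affperm_aff aw.
have [T T_uniq T_mem] := Inv3_list A; have TS := cons_sub_T T_mem.
have bot := Cle_bottom A T_uniq T_mem; have top := Cle_top A T_uniq T_mem.
have cbot := cons_bottom A T_uniq T_mem; have ctop := cons_top A T_uniq T_mem.
have minimal R : consistent m.+2 3 w R -> Cle m.+2 3 w R (fun=> False) -> R = (fun=> False).
  move=> cR h; apply: funext => X; apply: propext; split=> //; exact: (Cle_sub h).
have maximal R : consistent m.+2 3 w R -> Cle m.+2 3 w (Inv m.+2 3 w) R -> R = Inv m.+2 3 w.
  move=> [sub _] h; apply: funext => X; apply: propext; split; [exact: sub | exact: (Cle_sub h)].
split; last split.
- split; first by move=> u v; exact: (refl_order_inj A).
  split.
    move=> rho; split=> [[u [ru <-]]|/(admissible_reduced A)[u ru e]]; last by exists u.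
    exact: (reduced_admissible A ru).
  split; first exact: (prefix_chain_maximal A).
  split; first exact: (prefix_chain_inj (w := w)).
  exact: (maxchain_prefixes A).
- split; first by move=> rho; exact: (revset_consistent A).
  split.
    move=> rho sigma _; elim=> // [r s /ord_comm_step_revset[]|r s t _ h1 _ h2] //.
    by rewrite h1.
  split; first by move=> rho sigma; exact: (revset_ord_comm_equiv A).
  split.
    move=> R cR; have [u ru e] := wrev_ex A cR; exists (refl_order u).
    by split=> //; exact: (reduced_admissible A ru).
  split.
    move=> rho sigma ad1 ad2; split=> [h|]; last exact: (Cle_Ble A ad1 ad2).
    by have [] := Ble_Cle A h ad1.
  split; first exact: (Cranked3 A T_uniq T_mem).
  split; first by split.
  split=> //; split.
    by move=> R [cR h]; apply/esym/h => //; exact: bot.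
  split; first by split.
  split=> //.
  by move=> R [cR h]; apply/esym/h => //; exact: top.
- split; last by exists (size T); split; [exists T | exact: (G_diameter_size A T_uniq T_mem)].
  exists (wrev w); split; first by move=> u; exact: (wrev_consistent A).
  split; first by move=> u v; exact: (comm_equiv_wrev A).
  split; first by move=> R /(wrev_ex A)[u ru e]; exists u.
  move=> u v ru rv; rewrite (G_edge_add_one A ru rv).
  by symmetry; apply: (Ccover_add_one T_uniq TS); exact: (wrev_consistent A).
Qed.
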